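(* Let $n\geq 1$ and let $\iota=\{\theta(w^{-1})w : w\in S_{2n}\}$ be the set of twisted identities of the symmetric group $S_{2n}$, ordered by the order induced from the Bruhat order. Then $\iota$ is a dircon. Furthermore, the Kazhdan--Lusztig--Vogan $R$-polynomials and $Q$-polynomials for fixed point free involutions coincide, respectively, with the Kazhdan--Lusztig $R^{q}$-polynomials and $R^{-1}$-polynomials of $\iota$ as a dircon.
   Context: **Twisted identities.** $S_{2n}$ is the symmetric group, a Coxeter group with generators $s_k=(k,k+1)$, $k\in[1,2n-1]$, and identity $e$. $\theta$ is the involutive automorphism of $S_{2n}$ sending $s_i$ to $s_{2n-i}$ (equivalently $\theta(w)=w_0ww_0$, where $w_0$ is the reverse permutation). For $x\in\iota$ and a simple generator $s$, set $x\ast s=\theta(s)xs$ (an element of $\iota$). $D_R(w)=\{s: \ell(ws)<\ell(w)\}$, where $\ell$ is Coxeter length. All covering relations $\lhd$ below are taken in the poset $\iota$ with the order induced by the Bruhat order. **Kazhdan--Lusztig--Vogan polynomials for fixed point free involutions.** The $R$-polynomials $\{R_{u,w}\}_{u,w\in\iota}$ are the polynomials in $q$ uniquely determined by: $R_{e,e}=1$; $R_{u,w}=0$ if $u\not\leq w$; and, if $s\in D_R(w)$ (and $u\le w$), $R_{u,w}=R_{u\ast s,w\ast s}$ if $u\ast s\lhd u$; $R_{u,w}=(q-1)R_{u,w\ast s}+qR_{u\ast s,w\ast s}$ if $u\ast s\rhd u$; $R_{u,w}=-R_{u,w\ast s}$ if $u\ast s=u$. The $Q$-polynomials $\{Q_{u,w}\}_{u,w\in\iota}$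 are uniquely determined by the same rules, except that in the last case ($u\ast s=u$) one has $Q_{u,w}=q\,Q_{u,w\ast s}$. **Pircons.** In a poset, $x\lhd y$ means that $y$ covers $x$, i.e. $x<y$ and $[x,y]=\{x,y\}$. $P_{\leq x}=\{y\in P: y\leq x\}$. A special partial matching of a finite poset $Q$ with maximum $\hat1$ is an involution $M:Q\to Q$ such that (i) $M(\hat1)\lhd\hat1$; (ii) for all $x\in Q$, $M(x)\lhd x$, $M(x)=x$ or $x\lhd M(x)$; (iii) if $x\lhd y$ and $M(x)\neq y$, then $M(x)<M(y)$. A poset $P$ is a pircon if, for every non-minimal $x\in P$, $P_{\leq x}$ is finite and admits a special partial matching. $SPM_w$ is the set of special partial matchings of $P_{\leq w}$. **Coherence and dircons.** Let $P$ be a pircon, $w\in P$ and $M,N\in SPM_w$. $\langle M,N\rangle$ is the group of permutations of $P_{\le w}$ generated by $M$ and $N$; $\langle M,N\rangle(u)$ is the orbit of $u$; orbits carry the induced order. An orbit $\mathcal O$ is dihedral if it is isomorphic, as a poset, to an interval in the Bruhat order of a Coxeter group with two Coxeter generators and $u\notin\{M(u),N(u)\}$ for all $u\in\mathcal O$; it is chain-like if it is isomorphic to a chain, its minimum is fixed by $M$ or $N$, and its maximum is fixed by $M$ or $N$. Every orbit is of one of these two types, and $\langle M,N\rangle(w)$ is dihedral. $M$ and $N$ are strictly coherent if, for every orbit $\mathcal O$, the rank of $\mathcal O$ divides the rank of $\langle M,N\rangle(w)$ when $\mathcal O$ is dihedral, and the rank of $\mathcal O$ plus 1 divides the rank of $\langle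 M,N\rangle(w)$ when $\mathcal O$ is chain-like. $M$ and $N$ are coherent if there is a sequence $M=M_0,M_1,\dots,M_k=N$ in $SPM_w$ with $M_i$ and $M_{i+1}$ strictly coherent for all $i$. A pircon $D$ is a dircon if, for all $w\in D$, any two $M,N\in SPM_w$ are coherent. **Kazhdan--Lusztig $R^x$-polynomials.** Let $x\in\{q,-1\}$ and let $P$ be a pircon with minimum $\hat0$. A refinement $\mathcal M=\{M_v\}$ of $P$ is a choice of $M_v\in SPM_v$ for each $v\in P\setminus\{\hat0\}$. The $R^x$-polynomials of $(P,\mathcal M)$ are the unique family $\{R^x_{u,w}(q)\}_{u,w\in P}\subseteq\mathbb Z[q]$ with $R^x_{w,w}=1$, $R^x_{u,w}=0$ if $u\not\leq w$, and, for $u<w$, $R^x_{u,w}=R^x_{M_w(u),M_w(w)}$ if $M_w(u)\lhd u$; $R^x_{u,w}=(q-1)R^x_{u,M_w(w)}+qR^x_{M_w(u),M_w(w)}$ if $M_w(u)\rhd u$; $R^x_{u,w}=(q-1-x)R^x_{u,M_w(w)}$ if $M_w(u)=u$. For a dircon, this family does not depend on the refinement $\mathcal M$; it is called the family of $R^x$-polynomials of the dircon. *)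

(* Defs.v *)
From HB Require Import structures.
From mathcomp Require Import all_boot all_order all_algebra all_fingroup.
From mathcomp Require Import boolp classical_sets cardinality.
From Stdlib Require Import Relation_Operators.

Set Implicit Arguments.
Unset Strict Implicit.
Unset Printing Implicit Defensive.

Import Order.TTheory GRing.Theory.

(* ** Coxeter groups: length and Bruhat order *)

Section Coxeter.
Local Open Scope group_scope.
Variables (G : groupType) (S : set G).

Definition is_word (a : seq G) (w : G) : Prop :=
  (forall x, x \in a -> S x) /\ \prod_(x <- a) x = w.

Definition word_of_length (w : G) (k : nat) : Prop :=
  exists2 a : seq G, is_word a w & size a = k.

(* The default value 0 is only used for elements outside the subgroup
   generated by [S]. *)
Definition coxeter_length (w : G) : nat :=
  xget 0%N [set k | word_of_length w k /\
                    forall j, word_of_length w j -> (k <= j)%N].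

Definition reflection (t : G) : Prop := exists g s, S s /\ t = s ^ g.

Definition bruhat_step (u v : G) : Prop :=
  exists t, [/\ reflection t, v = u * t
              & (coxeter_length u < coxeter_length v)%N].

Definition bruhat : G -> G -> Prop := clos_refl_trans G bruhat_step.

(* [S] is a generating set of involutions and the relations
   [(s * t) ^+ k = 1], for [k] a multiple of the order of [s * t], form a
   presentation of [G]; the order of [s * t] may be infinite. *)
Definition coxeter_system : Prop :=
  [/\ forall s, S s -> s <> 1 /\ s * s = 1,
      forall w, exists a, is_word a w
    & forall (H : groupType) (f : G -> H),
        (forall s t k, S s -> S t -> (s * t) ^+ k = 1 ->
                       (f s * f t) ^+ k = 1) ->
        exists g : G -> H,
          {morph g : x y / x * y} /\ (forall s, S s -> g s = f s)].

Lemma bruhat_length u v : bruhat u v ->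
  u = v \/ (coxeter_length u < coxeter_length v)%N.
Proof.
elim=> {u v} [u v [t [_ _ uv]]|u|u v w _ uv _ vw]; [by right|by left|].
case: uv => [->//|uv]; case: vw => [<-|vw]; first by right.
by right; apply: ltn_trans uv vw.
Qed.

Lemma bruhat_anti u v : bruhat u v -> bruhat v u -> u = v.
Proof.
move=> /bruhat_length[//|uv] /bruhat_length[//|vu].
by have := ltn_trans uv vu; rewrite ltnn.
Qed.

End Coxeter.

(* ** Pircons and dircons

   A map of the lower set P_{<= w} to itself is represented by any of its
   extensions to P: all the notions below only depend on its values on
   P_{<= w}. *)

Section Pircons.
Local Open Scope order_scope.
Local Open Scope classical_set_scope.
Variables (d : Order.disp_t) (P : porderType d).
Implicit Types (w u v x y z : P) (M N : P -> P) (O : set P).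

Definition covers x y : Prop :=
  x < y /\ [set z | x <= z <= y] = [set x; y].

Definition special_partial_matching w M : Prop :=
  [/\ forall x, x <= w -> M x <= w,
      forall x, x <= w -> M (M x) = x,
      covers (M w) w,
      forall x, x <= w -> [\/ covers (M x) x, M x = x | covers x (M x)]
    & forall x y, x <= w -> y <= w -> covers x y -> M x <> y -> M x < M y].

Definition pircon : Prop :=
  forall x, (exists y, y < x) ->
    finite_set [set y | y <= x] /\ exists M, special_partial_matching x M.

(* As [M] and [N] are involutions, every element of the group that they
   generate is a word in [M] and [N]. *)
Definition spm_orbit M N u : set P :=
  [set x | exists a : seq bool,
     x = foldr (fun (b : bool) y => if b then M y else N y) u a].

Definition chain_of_length O (r : nat) : Prop :=
  exists c : seq P, [/\ size c = r.+1, sorted <%O c & forall x, x \in c -> O x].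

Definition rank O : nat :=
  xget 0%N [set r | chain_of_length O r /\
                    forall j, chain_of_length O j -> (j <= r)%N].

(* The map [f] is injective on [O] because it reflects the order. *)
Definition dihedral_interval O : Prop :=
  exists (G : groupType) (s t a b : G) (f : P -> G),
    [/\ s <> t /\ coxeter_system [set s; t],
        bruhat [set s; t] a b,
        f @` O = [set g | bruhat [set s; t] a g /\ bruhat [set s; t] g b]
      & forall x y, O x -> O y -> (x <= y <-> bruhat [set s; t] (f x) (f y))].

Definition dihedral_orbit M N O : Prop :=
  dihedral_interval O /\ forall x, O x -> x <> M x /\ x <> N x.

Definition chain_like_orbit M N O : Prop :=
  [/\ forall x y, O x -> O y -> x <= y \/ y <= x,
      exists x, [/\ O x, forall y, O y -> x <= y & M x = x \/ N x = x]
    & exists x, [/\ O x, forall y, O y -> y <= x & M x = x \/ N x = x]].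

Definition strictly_coherent w M N : Prop :=
  forall u, u <= w ->
    (dihedral_orbit M N (spm_orbit M N u) ->
       rank (spm_orbit M N u) %| rank (spm_orbit M N w))%N /\
    (chain_like_orbit M N (spm_orbit M N u) ->
       (rank (spm_orbit M N u)).+1 %| rank (spm_orbit M N w))%N.

Definition coherent w M N : Prop :=
  exists (k : nat) (F : nat -> P -> P),
    [/\ F 0%N = M, F k = N,
        forall i, (i <= k)%N -> special_partial_matching w (F i)
      & forall i, (i < k)%N -> strictly_coherent w (F i) (F i.+1)].

Definition dircon : Prop :=
  pircon /\
  forall w M N, special_partial_matching w M -> special_partial_matching w N ->
    coherent w M N.

End Pircons.

(* ** Families of polynomials indexed by pairs of elements of a poset *)

Notation poly_family P := (P -> P -> {poly int}).

Definition unique_family (P : Type) (Phi : poly_family P -> Prop)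
    (R : poly_family P) : Prop :=
  Phi R /\ forall R', Phi R' -> R' =2 R.

Section KazhdanLusztig.
Local Open Scope ring_scope.
Variables (d : Order.disp_t) (P : porderType d).

(* The matchings are indexed by the elements other than the minimum of P. *)
Definition refinement (M : P -> P -> P) : Prop :=
  forall v : P, ~ (forall y, v <= y)%O -> special_partial_matching v (M v).

Definition Rx_family (x : {poly int}) (M : P -> P -> P) (R : poly_family P) :
    Prop :=
  [/\ forall w, R w w = 1,
      forall u w, ~ (u <= w)%O -> R u w = 0
    & forall u w, (u < w)%O ->
      [/\ covers (M w u) u -> R u w = R (M w u) (M w w),
          covers u (M w u) ->
            R u w = ('X - 1) * R u (M w w) + 'X * R (M w u) (M w w)
        & M w u = u -> R u w = ('X - 1 - x) * R u (M w w)]].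

Definition dircon_Rx_polynomials (x : {poly int}) (R : poly_family P) : Prop :=
  forall M, refinement M -> unique_family (Rx_family x M) R.

End KazhdanLusztig.

(* ** Twisted identities *)

Section TwistedIdentities.
Local Open Scope group_scope.
Variable n : nat.

(* Products of permutations are composed from left to right: [s * t] maps [i]
   to [t (s i)]. This group is isomorphic, as a Coxeter group with involution
   [theta], to the one with the opposite convention. *)

(* Indices are shifted: for 0 <= k < 2n - 1, [simple k] is the transposition
   (k, k+1) of {0, ..., 2n-1}. *)
Lemma simple_subproof (k : 'I_(n.*2).-1) : (k.+1 < n.*2)%N.
Proof. by rewrite -ltn_predRL ltn_ord. Qed.

Definition simple (k : 'I_(n.*2).-1) : 'S_(n.*2) :=
  tperm (widen_ord (leq_pred _) k) (Ordinal (simple_subproof k)).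

Definition simples : set 'S_(n.*2) := [set s | exists k, s = simple k].

Definition w0 : 'S_(n.*2) := perm (@rev_ord_inj n.*2).

Definition theta (w : 'S_(n.*2)) : 'S_(n.*2) := w0 * w * w0.

Lemma w0_mul : w0 * w0 = 1.
Proof. by apply/permP => i; rewrite permM !permE rev_ordK. Qed.

Lemma thetaM : {morph theta : x y / x * y}.
Proof.
move=> x y; rewrite /theta !mulgA; congr (_ * y * _).
by rewrite -(mulgA (w0 * x)) w0_mul mulg1.
Qed.

Lemma theta_simple k : theta (simple k) = simple (rev_ord k).
Proof.
have w0V : w0^-1 = w0 by rewrite -[LHS]mulg1 -w0_mul mulKg.
have -> : theta (simple k) = simple k ^ w0 by rewrite conjgE w0V mulgA.
rewrite /simple tpermJ tpermC !permE; congr tperm; apply: val_inj => /=.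
all: have := ltn_ord k; move: (k : nat) => j; case: (n.*2) => // m /= jm.
by rewrite subSS subnSK.
Qed.

Definition iota_set : {set 'S_(n.*2)} :=
  [set theta w^-1 * w | w in [set: 'S_(n.*2)]].

Definition twisted : Type := {w : 'S_(n.*2) | w \in iota_set}.
HB.instance Definition _ := Finite.on twisted.

Definition twisted_le (u v : twisted) : bool :=
  `[< bruhat simples (val u) (val v) >].

Lemma twisted_le_refl : reflexive twisted_le.
Proof. by move=> u; apply/asboolP; apply: rt_refl. Qed.

Lemma twisted_le_anti : antisymmetric twisted_le.
Proof.
by move=> u v /andP[/asboolP uv /asboolP vu]; apply/val_inj/(bruhat_anti uv vu).
Qed.

Lemma twisted_le_trans : transitive twisted_le.
Proof.
move=> v u w /asboolP uv /asboolP vw; apply/asboolP.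
exact: rt_trans uv vw.
Qed.

Fact bruhat_display : Order.disp_t. Proof. exact: Order.Disp tt tt. Qed.

HB.instance Definition _ := Order.Le_isPOrder.Build bruhat_display twisted
  twisted_le_refl twisted_le_anti twisted_le_trans.

Lemma twisted_one_subproof : (1 : 'S_(n.*2)) \in iota_set.
Proof.
by apply/imsetP; exists 1; rewrite // invg1 mulg1 /theta mulg1 w0_mul.
Qed.

Definition twisted_one : twisted :=
  exist (fun w => w \in iota_set) 1 twisted_one_subproof.

Lemma twisted_star_subproof (x : twisted) k :
  theta (simple k) * val x * simple k \in iota_set.
Proof.
case: x => x /= /imsetP[w _ ->]; apply/imsetP; exists (w * simple k) => //.
by rewrite invMg tpermV thetaM !mulgA.
Qed.

Definition twisted_star (x : twisted) (k : 'I_(n.*2).-1) : twisted :=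
  exist (fun w => w \in iota_set) _ (twisted_star_subproof x k).

Definition right_descent (w : twisted) (k : 'I_(n.*2).-1) : Prop :=
  (coxeter_length simples (val w * simple k)
     < coxeter_length simples (val w))%N.

End TwistedIdentities.

Section KazhdanLusztigVogan.
Local Open Scope ring_scope.
Variable n : nat.

(* The recursions for the R- and the Q-polynomials only differ by the factor
   [c] used when u * s = u. *)
Definition KLV_family (c : {poly int}) (R : poly_family (twisted n)) : Prop :=
  [/\ R (twisted_one n) (twisted_one n) = 1,
      forall u w, ~ (u <= w)%O -> R u w = 0
    & forall u w k, right_descent w k -> (u <= w)%O ->
      let u' := twisted_star u k in
      let w' := twisted_star w k in
      [/\ covers u' u -> R u w = R u' w',
          covers u u' -> R u w = ('X - 1) * R u w' + 'X * R u' w'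
        & u' = u -> R u w = c * R u w']].

Definition KLV_R_polynomials : poly_family (twisted n) -> Prop :=
  unique_family (KLV_family (- 1)).

Definition KLV_Q_polynomials : poly_family (twisted n) -> Prop :=
  unique_family (KLV_family 'X).

End KazhdanLusztigVogan.

(* Main.v *)
Require Import Defs.
From mathcomp Require Import all_boot all_order all_algebra all_fingroup.
From mathcomp Require Import boolp classical_sets cardinality.
From mathcomp Require Import zify ring.
From Stdlib Require Import Relation_Operators.

(** Let iota be the set of twisted identities of the symmetric group on 2n
    points. Multiplication by the reversal identifies iota with the set of fixed
    point free involutions of {0, ..., 2n-1}, and x |-> theta(s) x s with
    conjugation by s. The theorem follows from three facts about iota.

    - The order is given by rank matrices (leE): x is below y if and only if, for
      all i and j, at least as many points below i have an image at least j under
      the involution of x as under that of y. As conjugation by s changes a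
      single row and a single column of the rank matrix, x |-> x * s has the
      lifting property (lift). Hence iota is graded by half of the length
      and is a pircon: descents of w define special partial matchings of the
      lower set of w (spm_star).

    - An element of rank at least three has several coatoms and is determined by
      them (unique_coatom, coatoms_inj). Therefore a matching of a lower set is
      determined by its values on the minimum and on the atoms (pm_agree), and it
      commutes with the multiplication by s as soon as it does so there
      (pm_commute). An analysis of the possible values in rank at most one shows
      that every special partial matching of w agrees with the multiplication by
      a descent k of w, or commutes with it and has another value at w
      (classify). The hard case is that of a matching that acts from the left on
      one neighbour of an atom and from the right on the other: the elements of
      its domain avoid a configuration, which leaves enough descents of w
      (mixed_descent).

    - Consequently any two special partial matchings of w are joined by a sequence
      in which consecutive ones are equal, or commute with different values at
      w, or are the multiplications by two adjacent descents (near_connected).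
      The orbits of such a pair have at most six elements, and their ranks give
      strict coherence (near_strict).

    As for the polynomials, each matching M of w defines an operator, and the
    recursion says that R(., w) is the image of R(., M w) under this operator.
    Commuting matchings define commuting operators (recop_commute), and adjacent
    generators define operators satisfying the braid relation (recop_braid); the
    latter uses that the factor c of the fixed points is a root of
    c^2 = (q - 1) c + q, whose roots -1 and q are the factors for the R- and the
    Q-polynomials. So, by induction on w, the recursion for one matching of w
    implies the recursions for all of them (satisfies_near). The family defined
    by choosing one descent of each w thus satisfies the recursions for all
    descents, which characterize the Kazhdan--Lusztig--Vogan polynomials, and
    the recursions of all refinements. *)

Set Implicit Arguments.
Unset Strict Implicit.
Unset Printing Implicit Defensive.

Import Order.TTheory GRing.Theory.

(** * Permutations acting on natural numbers *)

Definition sw (k p : nat) : nat :=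
  if p == k then k.+1 else if p == k.+1 then k else p.

Variant sw_spec k p : nat -> Type :=
  | SwL of p = k : sw_spec k p k.+1
  | SwR of p = k.+1 : sw_spec k p k
  | SwD of p <> k & p <> k.+1 : sw_spec k p p.

Lemma swP k p : sw_spec k p (sw k p).
Proof.
rewrite /sw; case: eqP => [?|?]; first by constructor.
by case: eqP => ?; constructor.
Qed.

Lemma sw_l k : sw k k = k.+1.
Proof. by case: swP; lia. Qed.
Lemma sw_r k : sw k k.+1 = k.
Proof. by case: swP; lia. Qed.

Lemma swK k : involutive (sw k).
Proof. by move=> p; case: (swP k p); case: swP; lia. Qed.

Lemma incr_id N (f : nat -> nat) :
  (forall p, p.+1 < N -> f p < f p.+1) -> (forall p, p < N -> f p < N) ->
  forall p, p < N -> f p = p.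
Proof.
move=> f_incr f_lt p pN.
have ge q : q < N -> q <= f q.
  by elim: q => // q IH qN; have := f_incr q qN; have := IH (ltnW qN); lia.
have le q : q < N -> f (N.-1 - q) <= N.-1 - q.
  elim: q => [|q IH] qN; first by rewrite subn0; have := f_lt N.-1; lia.
  have := f_incr (N.-1 - q.+1); have := IH (ltnW qN).
  have -> : (N.-1 - q.+1).+1 = N.-1 - q by lia.
  by lia.
have := ge p pN; have := le (N.-1 - p).
have -> : N.-1 - (N.-1 - p) = p by lia.
lia.
Qed.

Section Permutations.
Variable n : nat.
Local Notation N := (n.*2).
Implicit Types (u v : 'S_N) (i j : 'I_N) (k : 'I_N.-1).
Local Open Scope group_scope.

(** Permutations are extended by the identity to all natural numbers, so that
    positions and values are handled by plain arithmetic. *)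
Definition pv u (p : nat) : nat := oapp (fun i : 'I_N => val (u i)) p (insub p).

Lemma pvE u i : pv u i = u i.
Proof. by rewrite /pv valK. Qed.

Lemma pv_ord u p (hp : (p < N)%N) : pv u p = u (Ordinal hp).
Proof. by rewrite -(pvE u (Ordinal hp)). Qed.

Lemma pv_lt u p : (p < N)%N -> (pv u p < N)%N.
Proof. by move=> hp; rewrite (pv_ord u hp). Qed.

Lemma simple_lt k : (k.+1 < N)%N.
Proof. exact: simple_subproof. Qed.

Lemma val_simple k i : val (simple k i) = sw k i.
Proof.
rewrite /simple permE /= /sw -!val_eqE /=.
by case: eqP => [//|_]; case: eqP.
Qed.

Lemma pvM u v p : pv (u * v) p = pv v (pv u p).
Proof.
case: (ltnP p N) => hp; first by rewrite !(pv_ord _ hp) permM pvE.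
by rewrite /pv !insubF ?ltnNge ?hp //= insubF // ltnNge hp.
Qed.

Lemma pv_simple k p : pv (simple k) p = sw k p.
Proof.
case: (ltnP p N) => hp; first by rewrite (pv_ord _ hp) val_simple.
rewrite /pv insubF ?ltnNge ?hp //= /sw.
by have := simple_lt k; case: eqP; [|case: eqP]; lia.
Qed.

Lemma pvV u p : (p < N)%N -> pv u^-1 (pv u p) = p.
Proof. by move=> hp; rewrite (pv_ord u hp) pvE permK. Qed.

Lemma pvVK u p : (p < N)%N -> pv u (pv u^-1 p) = p.
Proof. by move=> hp; rewrite (pv_ord _ hp) pvE permKV. Qed.

Lemma pv_inj u p q : (p < N)%N -> (q < N)%N -> pv u p = pv u q -> p = q.
Proof. by move=> hp hq e; rewrite -(pvV u hp) e pvV. Qed.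

Lemma eq_pv u v : (forall p, (p < N)%N -> pv u p = pv v p) -> u = v.
Proof. by move=> e; apply/permP => i; apply: ord_inj; rewrite -!pvE e. Qed.

Lemma pv_w0 p : (p < N)%N -> pv (w0 n) p = (N.-1 - p)%N.
Proof. by move=> hp; rewrite (pv_ord _ hp) permE /=; lia. Qed.

Lemma simpleK k : simple k * simple k = 1.
Proof. by rewrite /simple tperm2. Qed.

Lemma simpleV k : (simple k)^-1 = simple k.
Proof. by rewrite /simple tpermV. Qed.

(** * Length and inversions *)

Definition inversions u : {set 'I_N * 'I_N} :=
  [set ij : 'I_N * 'I_N | (ij.1 < ij.2)%N && (u ij.2 < u ij.1)%N].
Definition ninv u : nat := #|inversions u|.

(** Multiplying by an adjacent transposition of values only changes the status
    of the pair of positions of these two values. *)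
Lemma inv_up u k : (pv u^-1 k < pv u^-1 k.+1)%N ->
  ninv (u * simple k) = (ninv u).+1.
Proof.
have kN := simple_lt k; have kN' : (k < N)%N by lia.
rewrite (pv_ord _ kN) (pv_ord _ kN') => lt_pos.
set i0 := u^-1 _ in lt_pos; set j0 := u^-1 _ in lt_pos.
have ui0 : val (u i0) = k by rewrite /i0 permKV.
have uj0 : val (u j0) = k.+1 by rewrite /j0 permKV.
have -> : ninv (u * simple k) = #|(i0, j0) |: inversions u|.
  congr #|pred_of_set _|; apply/setP=> -[i j]; rewrite !inE /= !permM.
  have -> : ((i, j) == (i0, j0)) = ((u i : nat) == k) && ((u j : nat) == k.+1).
    by rewrite xpair_eqE -uj0 -ui0 !val_eqE !(inj_eq perm_inj).
  rewrite !val_simple.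
  have e1 : (u i : nat) = k -> (u j : nat) = k.+1 -> (i < j)%N.
    rewrite -{1}ui0 -uj0 => /val_inj/perm_inj-> /val_inj/perm_inj->; exact: lt_pos.
  have e2 : (u j : nat) = k -> (u i : nat) = k.+1 -> (j < i)%N.
    rewrite -{1}ui0 -uj0 => /val_inj/perm_inj-> /val_inj/perm_inj->; exact: lt_pos.
  have e3 : (u i : nat) = u j -> (i : nat) = j by move=> /val_inj/perm_inj->.
  by case: (swP k (u i)); case: (swP k (u j)); lia.
rewrite cardsU1 inE /= ui0 uj0.
have -> : (k.+1 < k)%N = false by lia.
by rewrite andbF.
Qed.

Lemma pos_simple u k p : pv (u * simple k)^-1 p = pv u^-1 (sw k p).
Proof. by rewrite invMg simpleV pvM pv_simple. Qed.

Lemma inv_down u k : (pv u^-1 k.+1 < pv u^-1 k)%N ->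
  ninv u = (ninv (u * simple k)).+1.
Proof.
move=> lt_pos; have /inv_up <- : (pv (u * simple k)^-1 k < pv (u * simple k)^-1 k.+1)%N.
  rewrite !pos_simple.
  by case: (swP k k); case: (swP k k.+1); lia.
by rewrite -mulgA simpleK mulg1.
Qed.

Lemma pos_neq u k : pv u^-1 k != pv u^-1 k.+1.
Proof.
by have kN := simple_lt k; apply/eqP => /(pv_inj (ltnW kN) kN); lia.
Qed.

Lemma inv1 : ninv 1 = 0%N.
Proof. by apply/eqP; rewrite cards_eq0; apply/eqP/setP=> -[i j]; rewrite !inE !perm1; lia. Qed.

Lemma inv_le_simple u k : (ninv (u * simple k) <= (ninv u).+1)%N.
Proof.
case: (ltngtP (pv u^-1 k) (pv u^-1 k.+1)) => [/inv_up->//|/inv_down|/eqP]; first by lia.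
by rewrite (negPf (pos_neq _ _)).
Qed.

Lemma no_descent u : (forall k, (pv u^-1 k < pv u^-1 k.+1)%N) -> u = 1.
Proof.
move=> incr; suff : u^-1 = 1 by move/(congr1 (@invg _)); rewrite invgK invg1.
apply: eq_pv => p hp; rewrite (@incr_id N (pv u^-1)) //.
- by rewrite (pv_ord _ hp) perm1.
- move=> q qN; have qN' : (q < N.-1)%N by lia.
  exact: (incr (Ordinal qN')).
- by move=> q; apply: pv_lt.
Qed.

Lemma descent_ex u : u != 1 -> exists k, (pv u^-1 k.+1 < pv u^-1 k)%N.
Proof.
move=> u1; apply: contrapT => nex; case/eqP: u1; apply: no_descent => k.
rewrite ltnNge; apply/negP => h; apply: nex; exists k.
by rewrite ltn_neqAle h eq_sym pos_neq.
Qed.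

Lemma word_inv a w : is_word (simples (n:=n)) a w -> (ninv w <= size a)%N.
Proof.
case=> sa <-; elim/last_ind: a sa => [|a x IH] sa; first by rewrite big_nil inv1.
rewrite -cats1 big_cat big_seq1 size_cat addn1 /=.
have /sa[k ->] : x \in rcons a x by rewrite mem_rcons inE eqxx.
apply: leq_trans (inv_le_simple _ _) _; rewrite ltnS; apply: IH => y ya.
by apply: sa; rewrite mem_rcons inE ya orbT.
Qed.

Lemma word_ex w : word_of_length (simples (n:=n)) w (ninv w).
Proof.
have [m] := ubnP (ninv w); elim: m w => // m IH w; rewrite ltnS => wm.
have [->|/descent_ex[k dk]] := eqVneq w 1.
  by exists [::]; rewrite ?inv1 //; split=> //; rewrite big_nil.
have e := inv_down dk; have [|a [sa pa] za] := IH (w * simple k); first by move: wm; rewrite e.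
exists (rcons a (simple k)); last by rewrite size_rcons za -e.
split; first by move=> x; rewrite mem_rcons inE => /predU1P[->|/sa//]; exists k.
by rewrite -cats1 big_cat big_seq1 /= pa -mulgA simpleK mulg1.
Qed.

(** Sorting by adjacent transpositions removes the inversions one at a time, and
    no generator removes more than one. *)
Lemma lengthE w : coxeter_length (simples (n:=n)) w = ninv w.
Proof.
rewrite /coxeter_length; set A := [set _ | _]%classic.
have Ai : A (ninv w).
  split; first exact: word_ex.
  by move=> j [a wa <-]; apply: word_inv.
have := xgetPex 0%N (ex_intro A _ Ai); case=> wk mk.
by apply/eqP; rewrite eqn_leq mk ?Ai.2 //; exact: word_ex.
Qed.

Lemma invV u : ninv u^-1 = ninv u.
Proof.
pose f (ij : 'I_N * 'I_N) := (u ij.2, u ij.1).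
have f_inj : injective f.
  by move=> [i j] [i' j'] [/perm_inj-> /perm_inj->].
rewrite /ninv -(card_imset (mem (inversions u)) f_inj).
congr #|pred_of_set _|; apply/setP => -[i j]; rewrite inE /=.
apply/idP/imsetP => [/andP[ij ji]|[[i' j'] /[!inE]/= /andP[ij ji] [-> ->]]].
  by exists (u^-1 j, u^-1 i); rewrite ?inE /= ?permKV ?ij ?ji //= /f /= !permKV.
by rewrite !permK ij ji.
Qed.

Lemma ltn_ord_neq (i j : 'I_N) : (i < j)%N -> i != j.
Proof. by move=> h; apply/eqP => e; move: h; rewrite e ltnn. Qed.

(** The transposition (a, b) is the conjugate by (a, a+1) of a transposition of
    closer points. One of the two outer factors adds an inversion, which
    compensates for the other. *)
Lemma tperm_up u (a b : 'I_N) : (a < b)%N -> (u^-1 a < u^-1 b)%N ->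
  (ninv u < ninv (u * tperm a b))%N.
Proof.
have [m] := ubnP (b - a); elim: m a b u => // m IH a b u ltm ab lt_ab.
have aN : (a < N.-1)%N by have := ltn_ord b; lia.
pose k := Ordinal aN; pose a' := Ordinal (simple_lt k).
have sE : simple k = tperm a a' by congr tperm; apply: val_inj.
have [b_a'|a'b] := eqVneq b a'.
  have -> : tperm a b = simple k by rewrite b_a' sE.
  rewrite inv_up // (pv_ord _ (ltnW (simple_lt k))) (pv_ord _ (simple_lt k)).
  rewrite -[Ordinal (simple_lt k)]/a' -b_a'.
  by rewrite [Ordinal (ltnW _)](_ : _ = a) //; apply: val_inj.
have a'_b : (a' < b)%N.
  by have := a'b; rewrite -val_eqE /=; lia.
have sV : simple k a' = a by rewrite sE tpermR.
have sA : simple k a = a' by rewrite sE tpermL.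
have sB : simple k b = b.
  by rewrite sE tpermD // ltn_ord_neq.
have -> : tperm a b = simple k * tperm a' b * simple k.
  transitivity (tperm a' b ^ simple k); first by rewrite tpermJ sV sB.
  by rewrite conjgE simpleV mulgA.
set y := u * simple k; rewrite !mulgA -/y.
have yV c : y^-1 c = u^-1 (simple k c) by rewrite /y invMg simpleV permM.
have IHy : (ninv y < ninv (y * tperm a' b))%N.
  by apply: IH => //=; [move: ltm; rewrite /=; lia|rewrite !yV sV sB].
set y' := y * tperm a' b in IHy *.
have y'V c : y'^-1 c = y^-1 (tperm a' b c) by rewrite /y' invMg tpermV permM.
have kE : forall v : 'S_N, pv v^-1 k = v^-1 a.
  by move=> v; rewrite (_ : (k : nat) = a) // pvE.
have kE' : forall v : 'S_N, pv v^-1 k.+1 = v^-1 a'.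
  by move=> v; rewrite (_ : (k.+1 : nat) = a') // pvE.
have ta : tperm a' b a = a by rewrite tpermD // eq_sym ltn_ord_neq //=.
case: (ltngtP (pv u^-1 k) (pv u^-1 k.+1)) => [up|down|/eqP]; last first.
- by rewrite (negPf (pos_neq _ _)).
- have e1 := inv_down down; rewrite -/y in e1.
  have : ninv (y' * simple k) = (ninv y').+1.
    apply: inv_up; rewrite kE kE' !y'V !yV ta tpermL sA sB.
    by move: down; rewrite kE kE'; lia.
  by move=> ->; rewrite e1 ltnS.
- have e1 := inv_up up; rewrite -/y in e1.
  have : (ninv y' <= (ninv (y' * simple k)).+1)%N.
    by rewrite -{1}[y'](mulgK (simple k)) simpleV; apply: inv_le_simple.
  by move=> h; rewrite -ltnS -e1; apply: leq_trans IHy h.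
Qed.

End Permutations.

(** * Rank matrices *)

Definition rmat (f : nat -> nat) (i j : nat) : nat := \sum_(0 <= p < i) (j <= f p).

Lemma rmat0 f j : rmat f 0 j = 0.
Proof. by rewrite /rmat big_geq. Qed.

Lemma rmatS f i j : rmat f i.+1 j = rmat f i j + (j <= f i).
Proof. by rewrite /rmat big_nat_recr. Qed.

Lemma rmat_jS f i j : rmat f i j.+1 <= rmat f i j.
Proof. by elim: i => [|i IH]; rewrite ?rmat0 // !rmatS; lia. Qed.

Lemma rmat_mono f i j i' j' : i <= i' -> j' <= j -> rmat f i j <= rmat f i' j'.
Proof.
move=> /subnK<- /subnK<-; apply: (@leq_trans (rmat f i j')).
  by elim: (j - j') => // d IH; rewrite addSn; apply: leq_trans (rmat_jS _ _ _) IH.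
by elim: (i' - i) => // d IH; rewrite addSn rmatS; lia.
Qed.

Lemma eq_rmat f g i j : (forall p, p < i -> (j <= f p) = (j <= g p)) ->
  rmat f i j = rmat g i j.
Proof.
by elim: i => [|i IH] e; rewrite ?rmat0 // !rmatS IH ?e // => p pi; apply: e; lia.
Qed.

(** Moving the larger of two values to the right lowers the rank matrix by the
    indicator function of a rectangle. *)
Lemma rmat_swap f g a b p1 p2 i j : p2 < p1 -> a < b ->
  f p1 = a -> f p2 = b -> g p1 = b -> g p2 = a ->
  (forall p, p < i -> p != p1 -> p != p2 -> g p = f p) ->
  rmat g i j <= rmat f i j.
Proof.
move=> p21 ab fa fb ga gb e.
suff -> : rmat f i j = rmat g i j + [&& p2 < i, i <= p1, a < j & j <= b] by lia.
elim: i e => [|i IH] e; first by rewrite !rmat0.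
rewrite !rmatS IH => [|p pi]; last by apply: e; lia.
have [->|ip1] := eqVneq i p1; first by rewrite fa ga; lia.
have [->|ip2] := eqVneq i p2; first by rewrite fb gb; lia.
by rewrite e //; lia.
Qed.

Definition cj (k : nat) (f : nat -> nat) (p : nat) : nat := sw k (f (sw k p)).

(** Conjugation by the transposition (k, k+1) only affects the row and the
    column of index k+1: elsewhere the counted set of points is permuted. *)
Lemma rmat_cj k f i j : i != k.+1 -> j != k.+1 -> rmat (cj k f) i j = rmat f i j.
Proof.
move=> ik jk; have e p : (j <= cj k f p) = (j <= f (sw k p)).
  by rewrite /cj; case: (swP k (f _)); lia.
rewrite (@eq_rmat _ (fun p => f (sw k p))) // {e}.
have lo i' : i' <= k -> rmat (fun p => f (sw k p)) i' j = rmat f i' j.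
  by move=> ik'; apply: eq_rmat => p pi; case: swP => //; lia.
case: (ltnP i k.+1) => ik'; first exact: lo.
have {ik ik'} : k.+1 < i by lia.
elim: i => // i IH; rewrite ltnS leq_eqVlt => /predU1P[<-|/[dup] ki /IH e]; last first.
  by rewrite !rmatS e; case: swP; lia.
by rewrite !rmatS lo //; case: (swP k k); case: (swP k k.+1); lia.
Qed.

Lemma rmat_cj_row k f j : j != k.+1 ->
  rmat (cj k f) k.+1 j = rmat f k j + (j <= f k.+1).
Proof.
move=> jk; rewrite rmatS rmat_cj //; last by lia.
congr addn; rewrite /cj; case: (swP k k); try lia.
by move=> _; case: (swP k (f _)); lia.
Qed.

(** * Fixed point free involutions of an initial segment *)

Definition fpf (N : nat) (f : nat -> nat) : Prop :=
  forall p, p < N -> [/\ f p < N, f (f p) = p & f p <> p].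

Section FPF.
Variable N : nat.
Implicit Types f g : nat -> nat.

Let cross f i j := \sum_(0 <= p < i) \sum_(0 <= q < j) (f p == q).

Lemma crossE f i j : cross f i j + rmat f i j = i.
Proof.
have inner v m : \sum_(0 <= q < m) (v == q) = (v < m) :> nat.
  by elim: m => [|m IH]; [rewrite big_geq|rewrite big_nat_recr //= IH; lia].
rewrite /cross; elim: i => [|i IH]; first by rewrite rmat0 big_geq.
by rewrite rmatS big_nat_recr //= inner; lia.
Qed.

Lemma cross_sym f i j : fpf N f -> i <= N -> j <= N -> cross f i j = cross f j i.
Proof.
move=> ff iN jN; rewrite /cross exchange_big_nat /=.
rewrite [LHS]big_nat_cond [RHS]big_nat_cond; apply: eq_bigr => q /andP[/andP[_ qj] _].
rewrite [LHS]big_nat_cond [RHS]big_nat_cond; apply: eq_bigr => p /andP[/andP[_ pi] _].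
have [_ ep _] := ff p ltac:(lia); have [_ eq _] := ff q ltac:(lia).
by congr nat_of_bool; apply/eqP/eqP => <-.
Qed.

(** The points below i with image below j and the points below j with image
    below i are exchanged by f. *)
Lemma rmat_sym f i j : fpf N f -> i <= N -> j <= N ->
  rmat f i j + j = rmat f j i + i.
Proof.
by move=> ff iN jN; have := crossE f i j; have := crossE f j i;
   rewrite (cross_sym ff iN jN); lia.
Qed.

(** The points below a with image below a form pairs. *)
Lemma rmat_parity f a : fpf N f -> a <= N -> odd (rmat f a a) = odd a.
Proof.
move=> ff aN; suff : ~~ odd (cross f a a) by have := crossE f a a; lia.
elim: a aN => [|a IH] aN; first by rewrite /cross big_geq.
suff -> : cross f a.+1 a.+1 = cross f a a + (cross f a.+1 a - cross f a a).*2.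
  by have := IH (ltnW aN); lia.
have s1 := cross_sym ff aN (ltnW aN).
have e1 : cross f a a.+1 = cross f a a + \sum_(0 <= p < a) (f p == a).
  by rewrite /cross -big_split /=; apply: eq_bigr => p _; rewrite big_nat_recr.
have [_ _ fa] := ff a ltac:(lia).
have e2 : cross f a.+1 a.+1 = cross f a a.+1 + \sum_(0 <= q < a) (f a == q).
  rewrite {1}/cross big_nat_recr //=; congr addn; rewrite big_nat_recr //=.
  by case: eqP => // _; rewrite addn0.
have e3 : cross f a.+1 a = cross f a a + \sum_(0 <= q < a) (f a == q).
  by rewrite {1}/cross big_nat_recr.
by lia.
Qed.

Lemma fpf_inj f p q : fpf N f -> p < N -> q < N -> f p = f q -> p = q.
Proof. by move=> ff /ff[_ ep _] /ff[_ eq _] e; rewrite -ep e eq. Qed.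

(** Two symmetric ways to recover an inequality of rank matrices from the
    entries outside of one row and one column: either the larger matrix is
    concave along that row, or the smaller one is convex. When g k = k+1, the
    diagonal entry needs the parity of rank matrices. *)
Lemma rmat_le_concave k f g : k.+1 < N -> fpf N f -> fpf N g -> f k.+1 < f k ->
  (forall i j, i <= N -> j <= N -> i != k.+1 -> j != k.+1 ->
     rmat g i j <= rmat f i j) ->
  forall i j, i <= N -> j <= N -> rmat g i j <= rmat f i j.
Proof.
move=> kN ff gg dk h.
have row j : j <= N -> j != k.+1 -> rmat g k.+1 j <= rmat f k.+1 j.
  move=> jN jk; have := h k j ltac:(lia) jN ltac:(lia) jk.
  by have := h k.+2 j ltac:(lia) jN ltac:(lia) jk; rewrite !rmatS; lia.
have col i : i <= N -> i != k.+1 -> rmat g i k.+1 <= rmat f i k.+1.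
  move=> iN ik; have := row i iN ik.
  by have := rmat_sym ff iN (ltnW kN); have := rmat_sym gg iN (ltnW kN); lia.
have dia : rmat g k.+1 k.+1 <= rmat f k.+1 k.+1.
  have := col k ltac:(lia) ltac:(lia).
  by have := col k.+2 ltac:(lia) ltac:(lia); rewrite !rmatS; lia.
move=> i j iN jN; have [->|ik] := eqVneq i k.+1.
  by have [->//|jk] := eqVneq j k.+1; apply: row.
by have [->|jk] := eqVneq j k.+1; [apply: col|apply: h].
Qed.

Lemma rmat_le_convex k f g : k.+1 < N -> fpf N f -> fpf N g ->
  g k < g k.+1 \/ g k = k.+1 ->
  (forall i j, i <= N -> j <= N -> i != k.+1 -> j != k.+1 ->
     rmat g i j <= rmat f i j) ->
  forall i j, i <= N -> j <= N -> rmat g i j <= rmat f i j.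
Proof.
move=> kN ff gg ak h.
have gk : g k = k.+1 -> g k.+1 = k by move=> <-; case: (gg k ltac:(lia)).
have row j : j <= N -> j != k.+1 -> rmat g k.+1 j <= rmat f k.+1 j.
  move=> jN jk; have := h k j ltac:(lia) jN ltac:(lia) jk.
  have := h k.+2 j ltac:(lia) jN ltac:(lia) jk; rewrite !rmatS.
  by case: ak => [|/[dup]/gk]; lia.
have col i : i <= N -> i != k.+1 -> rmat g i k.+1 <= rmat f i k.+1.
  move=> iN ik; have := row i iN ik.
  by have := rmat_sym ff iN (ltnW kN); have := rmat_sym gg iN (ltnW kN); lia.
have dia : rmat g k.+1 k.+1 <= rmat f k.+1 k.+1.
  have := col k ltac:(lia) ltac:(lia).
  have := col k.+2 ltac:(lia) ltac:(lia).
  have := rmat_parity ff (ltnW kN); have := rmat_parity gg (ltnW kN).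
  by rewrite !rmatS; case: ak => [|/[dup]/gk]; lia.
move=> i j iN jN; have [->|ik] := eqVneq i k.+1.
  by have [->//|jk] := eqVneq j k.+1; apply: row.
by have [->|jk] := eqVneq j k.+1; [apply: col|apply: h].
Qed.

End FPF.

(** * The Bruhat order of the symmetric group *)

Section Bruhat.
Variable n : nat.
Local Notation N := (n.*2).
Implicit Types (u v : 'S_N) (k : 'I_N.-1).
Local Open Scope group_scope.
Local Notation S := (simples (n:=n)).

Lemma reflection_tperm t : reflection S t ->
  exists a b : 'I_N, (a < b)%N /\ t = tperm a b.
Proof.
case=> g [_ [[k ->] ->]]; rewrite /simple tpermJ.
set a := g _; set b := g _.
have ab : a != b.
  by rewrite /a /b (inj_eq perm_inj) ltn_ord_neq /=.
have [lt|gt|/val_inj e] := ltngtP a b; first by exists a, b.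
- by exists b, a; rewrite tpermC.
- by rewrite e eqxx in ab.
Qed.

Lemma bruhat_stepE u t : reflection S t -> (ninv u < ninv (u * t))%N ->
  bruhat S u (u * t).
Proof. by move=> rt lt; apply: rt_step; exists t; split; rewrite ?lengthE. Qed.

Lemma simple_reflection k : reflection S (simple k).
Proof. by exists 1, (simple k); rewrite conjg1; split=> //; exists k. Qed.

Lemma step_pos u (a b : 'I_N) : (a < b)%N -> (ninv u < ninv (u * tperm a b))%N ->
  (u^-1 a < u^-1 b)%N.
Proof.
move=> ab lt; rewrite ltnNge; apply/negP => le.
have {le} lt' : (u^-1 b < u^-1 a)%N.
  rewrite ltn_neqAle le andbT; apply/eqP => /val_inj/perm_inj e.
  by move: ab; rewrite e ltnn.
have := @tperm_up n (u * tperm a b) a b ab.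
rewrite invMg tpermV !permM tpermL tpermR -mulgA tperm2 mulg1 => /(_ lt').
by move=> /(ltn_trans lt); rewrite ltnn.
Qed.

Definition upR u k := if (pv u^-1 k < pv u^-1 k.+1)%N then u * simple k else u.

Lemma le_upR u k : bruhat S u (upR u k).
Proof.
rewrite /upR; case: ifP => [up|_]; last exact: rt_refl.
by apply: bruhat_stepE (simple_reflection k) _; rewrite inv_up.
Qed.

Lemma simple_le_upR u k : bruhat S (u * simple k) (upR u k).
Proof.
rewrite /upR; case: ifP => [_|/negbT up]; first exact: rt_refl.
have down : (pv u^-1 k.+1 < pv u^-1 k)%N.
  by rewrite ltn_neqAle eq_sym pos_neq leqNgt.
rewrite -{2}[u](mulgK (simple k)) simpleV.
by apply: bruhat_stepE (simple_reflection k) _; rewrite -mulgA simpleK mulg1 (inv_down down).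
Qed.

(** Passing to the larger element of a coset of a simple reflection is
    monotone: a reflection other than s can be conjugated by s. *)
Lemma upR_mono u v k : bruhat S u v -> bruhat S (upR u k) (upR v k).
Proof.
elim=> {u v} [u v [t [rt -> lt]]|u|u v w _ uv _ vw]; last 2 first.
- exact: rt_refl.
- exact: rt_trans uv vw.
rewrite !lengthE in lt; have step := bruhat_stepE rt lt.
have trivial w : bruhat S (upR u k) w -> bruhat S w (upR (u * t) k) ->
  bruhat S (upR u k) (upR (u * t) k) by apply: rt_trans.
case: (ltnP (pv u^-1 k) (pv u^-1 k.+1)) => [up|down]; last first.
  apply: trivial (le_upR _ _); rewrite /upR ltnNge down /=; exact: step.
have [ts|ts] := eqVneq t (simple k).
  by apply: trivial (le_upR _ _); rewrite /upR up ts; apply: rt_refl.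
apply: trivial (simple_le_upR _ _); rewrite /upR up.
have -> : u * t * simple k = u * simple k * (t ^ simple k).
  by rewrite conjgE simpleV -!mulgA (mulgA (simple k) (simple k)) simpleK mul1g.
apply: bruhat_stepE; first by case: rt => g [s [Ss ->]]; exists (g * simple k), s; rewrite conjgM.
have [a [b [ab tE]]] := reflection_tperm rt.
have pab := step_pos ab; rewrite -tE in pab; have {}pab := pab _ lt.
rewrite tE tpermJ; apply: tperm_up.
  rewrite !val_simple; case: (swP k a); case: (swP k b); try lia.
  move=> bk ak; case/eqP: ts; rewrite tE /simple.
  by congr tperm; apply: val_inj.
by rewrite invMg simpleV !permM -!(permM (simple k) (simple k)) simpleK !perm1.
Qed.

Lemma bruhat_inv u v : bruhat S u v -> bruhat S u^-1 v^-1.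
Proof.
elim=> {u v} [u v [t [rt -> lt]]|u|u v w _ uv _ vw]; last 2 first.
- exact: rt_refl.
- exact: rt_trans uv vw.
rewrite !lengthE in lt.
have -> : (u * t)^-1 = u^-1 * (t^-1 ^ u^-1) by rewrite conjgE invgK invMg mulgA mulVg mul1g.
apply: bruhat_stepE.
  have [a [b [_ tE]]] := reflection_tperm rt; rewrite tE tpermV -tE.
  by case: rt => g [s [Ss ->]]; exists (g * u^-1), s; rewrite conjgM.
by rewrite conjgE invgK !mulgA mulVg mul1g -invMg !invV.
Qed.

Lemma bruhat_simpleR u v k : bruhat S u v ->
  (pv u^-1 k < pv u^-1 k.+1)%N -> (pv v^-1 k < pv v^-1 k.+1)%N ->
  bruhat S (u * simple k) (v * simple k).
Proof. by move=> /(upR_mono k) + uk vk; rewrite /upR uk vk. Qed.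

Lemma bruhat_simpleL u v k : bruhat S u v ->
  (pv u k < pv u k.+1)%N -> (pv v k < pv v k.+1)%N ->
  bruhat S (simple k * u) (simple k * v).
Proof.
move=> uv uk vk; have := bruhat_simpleR (k := k) (bruhat_inv uv).
by rewrite !invgK => /(_ uk vk)/bruhat_inv; rewrite !invMg !invgK simpleV.
Qed.

(** In terms of the product with the reversal, a reflection that increases the
    length moves the larger of two values to the right. *)
Lemma bruhat_rmat u v i j : bruhat S u v -> (i <= N)%N ->
  (rmat (pv (w0 n * v)) i j <= rmat (pv (w0 n * u)) i j)%N.
Proof.
move=> uv iN; elim: uv => {u v} [u v [t [rt -> lt]]|//|u v w _ uv _ vw]; last exact: leq_trans vw uv.
rewrite !lengthE in lt; have [a [b [ab tE]]] := reflection_tperm rt.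
have pab := step_pos ab; rewrite -tE in pab; have {}pab := pab _ lt.
have w0K : (w0 n)^-1 = w0 n by rewrite -[LHS]mulg1 -(w0_mul n) mulKg.
have posE (c : 'I_N) : pv (w0 n * u)^-1 c = (N.-1 - u^-1 c)%N.
  by rewrite invMg w0K pvM pv_w0 ?pvE ?ltn_ord // ltn_ord.
have aN := ltn_ord a; have bN := ltn_ord b.
have uaN := ltn_ord (u^-1 a); have ubN := ltn_ord (u^-1 b).
apply: (@rmat_swap _ _ a b (pv (w0 n * u)^-1 a) (pv (w0 n * u)^-1 b)) => //.
- rewrite !posE; move: pab uaN ubN; move: (nat_of_ord (u^-1 a)) (nat_of_ord (u^-1 b)).
  by move=> x y; lia.
- by rewrite pvVK.
- by rewrite pvVK.
- by rewrite mulgA pvM pvVK // pvE tE tpermL.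
- by rewrite mulgA pvM pvVK // pvE tE tpermR.
- move=> p pi pa pb; have pN : (p < N)%N by lia.
  rewrite mulgA (pvM (w0 n * u) t) (pv_ord (w0 n * u) pN) pvE tE tpermD //.
  + by apply: contra pa => /eqP->; rewrite pvE permK.
  + by apply: contra pb => /eqP->; rewrite pvE permK.
Qed.

End Bruhat.

Lemma rmat_rev N i j : i <= N -> rmat (fun p => N.-1 - p) i j = minn i (N - j).
Proof.
by elim: i => [|i IH] iN; rewrite ?rmat0 ?min0n // rmatS IH; lia.
Qed.

(** Compared with rmat_rev: among the fixed point free involutions, the reversal
    has the largest rank matrix. *)
Lemma rmat_bound N f i j : fpf N f -> i <= N -> j <= N -> rmat f i j <= minn i (N - j).
Proof.
move=> ff iN jN; have b0 i' j' : rmat f i' j' <= i'.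
  by elim: i' => [|i' IH]; rewrite ?rmat0 // rmatS; lia.
have bN : rmat f j N = 0.
  have : forall j', j' <= N -> rmat f j' N = 0; last exact.
  elim=> [|j' IH] jN'; rewrite ?rmat0 // rmatS IH; last by lia.
  by case: (ff j' jN'); lia.
have := rmat_sym ff (leqnn N) jN; have := @rmat_mono f i j N j iN (leqnn j).
by have := b0 i j; lia.
Qed.

Lemma rmat_inj N f g : fpf N f -> fpf N g ->
  (forall i j, i <= N -> j <= N -> rmat f i j = rmat g i j) ->
  forall p, p < N -> f p = g p.
Proof.
move=> ff gg e p pN; have [fN _ _] := ff p pN; have [gN _ _] := gg p pN.
have e1 j : j <= N -> (j <= f p) = (j <= g p).
  by move=> jN; have := e p.+1 j pN jN; rewrite !rmatS (e p j (ltnW pN) jN); lia.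
by have := e1 (f p) (ltnW fN); have := e1 (g p) (ltnW gN); lia.
Qed.

(** * Twisted identities as fixed point free involutions *)

Section Twisted.
Variable n : nat.
Local Notation N := (n.*2).
Local Notation S := (simples (n:=n)).
Implicit Types (x y : twisted n) (k : nat).
Local Open Scope group_scope.

(** A twisted identity [theta (w^-1) * w] times the reversal is the conjugate
    [w^-1 * w0 * w] of a fixed point free involution. *)
Definition arc x : nat -> nat := pv (w0 n * val x).

Lemma arcE x : exists w : 'S_N, arc x = (fun p => pv w (pv (w0 n) (pv w^-1 p))).
Proof.
have [w _ xE] := imsetP (valP x); exists w; rewrite /arc [val x]xE /theta.
by rewrite !mulgA w0_mul mul1g; apply/funext => p; rewrite !pvM.
Qed.

Lemma arc_fpf x : fpf N (arc x).
Proof.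
move=> p pN; have [w ->] := arcE x.
have qN : (pv w^-1 p < N)%N by apply: pv_lt.
have q'N : (N.-1 - pv w^-1 p < N)%N by lia.
rewrite (pv_w0 qN); split.
- exact: pv_lt.
- rewrite (pvV w q'N) (pv_w0 q'N).
  have -> : (N.-1 - (N.-1 - pv w^-1 p) = pv w^-1 p)%N by lia.
  exact: pvVK.
- move=> e; have := pvV w q'N; rewrite e.
  by move: qN; set q := pv _ p; lia.
Qed.

Lemma arc_lt x p : (p < N)%N -> (arc x p < N)%N.
Proof. by case/(arc_fpf x). Qed.
Lemma arcK x p : (p < N)%N -> arc x (arc x p) = p.
Proof. by case/(arc_fpf x). Qed.
Lemma arc_neq x p : (p < N)%N -> arc x p != p.
Proof. by case/(arc_fpf x) => _ _ /eqP. Qed.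
Lemma arc_inj x p q : (p < N)%N -> (q < N)%N -> arc x p = arc x q -> p = q.
Proof. exact: fpf_inj (arc_fpf x). Qed.

Lemma pv_val x p : (p < N)%N -> pv (val x) p = arc x (N.-1 - p).
Proof.
move=> pN; rewrite /arc pvM pv_w0; last by lia.
by rewrite (_ : N.-1 - (N.-1 - p) = p)%N //; lia.
Qed.

Lemma arc_ext x y : (forall p, (p < N)%N -> arc x p = arc y p) -> x = y.
Proof.
move=> e; apply/val_inj/eq_pv => p pN; rewrite !pv_val // e //; lia.
Qed.

Lemma pos_val x p : (p < N)%N -> pv (val x)^-1 p = (N.-1 - arc x p)%N.
Proof.
move=> pN; have aN := arc_lt x pN.
have qN : (N.-1 - arc x p < N)%N by lia.
apply: (@pv_inj _ (val x) _ _ (pv_lt _ pN) qN); rewrite pvVK // pv_val //.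
by rewrite (_ : N.-1 - (N.-1 - arc x p) = arc x p)%N ?arcK //; lia.
Qed.

(** Generators are indexed by natural numbers, those out of range acting
    trivially, so that neighbours of an index need no proof of being in range. *)
Definition star x k : twisted n := oapp (fun o => twisted_star x o) x (insub k).
Local Notation "x ** k" := (star x k) (at level 40, left associativity).

Lemma star_out x k : ~~ (k.+1 < N)%N -> x ** k = x.
Proof. by move=> kN; rewrite /star insubF //; lia. Qed.

Lemma star_ord x (k : 'I_N.-1) : x ** k = twisted_star x k.
Proof. by rewrite /star valK. Qed.

Lemma arc_twisted_star x (k : 'I_N.-1) p : arc (twisted_star x k) p = cj k (arc x) p.
Proof.
rewrite /arc /= /theta !mulgA w0_mul mul1g -(mulgA (simple k)).
by rewrite !pvM !pv_simple /cj !pvM.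
Qed.

Lemma arc_star x k p : (k.+1 < N)%N -> arc (x ** k) p = sw k (arc x (sw k p)).
Proof.
move=> kN; have kN' : (k < N.-1)%N by lia.
by rewrite -[k]/(val (Ordinal kN')) star_ord arc_twisted_star.
Qed.

Lemma starK x k : x ** k ** k = x.
Proof.
case: (boolP (k.+1 < N)%N) => kN; last by rewrite !star_out.
by apply: arc_ext => p pN; rewrite !arc_star // !swK.
Qed.

Lemma star_inj k : injective (star^~ k).
Proof. by move=> x y /= e; rewrite -[x](starK x k) e starK. Qed.

Lemma star_fix x k : (k.+1 < N)%N -> arc x k = k.+1 -> x ** k = x.
Proof.
move=> kN e; have e' : arc x k.+1 = k by rewrite -e arcK // ltnW.
apply: arc_ext => p pN; rewrite arc_star //.
case: (swP k p) => [->|->|pk pk1]; rewrite ?e ?e'.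
- by case: swP; lia.
- by case: swP; lia.
have /eqP a1 : arc x p != k.
  by apply/eqP => h; apply: pk1; rewrite -e -h arcK.
have /eqP a2 : arc x p != k.+1.
  by apply/eqP => h; apply: pk; rewrite -e' -h arcK.
by case: swP.
Qed.

Lemma arc_fix x k : (k.+1 < N)%N -> x ** k = x -> arc x k = k.+1.
Proof.
move=> kN e; have h : arc (x ** k) k = arc x k by rewrite e.
move: h; rewrite arc_star // sw_l.
have h1 := arc_neq x (ltnW kN); have h2 := arc_neq x kN.
case: swP => h3 h4; try lia.
by move=> h5; have := arc_inj kN (ltnW kN) h5; lia.
Qed.

(** A descent of x is an ascent of its involution, and each of the two factors
    of theta(s) x s then removes one inversion. *)
Lemma inv_star x k : (k.+1 < N)%N -> (arc x k < arc x k.+1)%N ->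
  ninv (val x) = (ninv (val (x ** k))).+2.
Proof.
move=> kN asc; have kN' : (k < N.-1)%N by lia.
set o := Ordinal kN'; rewrite -[k]/(val o) star_ord /= theta_simple -mulgA.
have aN := arc_lt x (ltnW kN); have a'N := arc_lt x kN.
rewrite (@inv_down _ (val x) o); last first.
  rewrite [val o]/= !pos_val ?(ltnW kN) //; lia.
congr _.+1; set y := val x * simple o.
have -> : ninv (simple (rev_ord o) * y) = ninv (y^-1 * simple (rev_ord o)).
  by rewrite -invV invMg simpleV.
rewrite -[ninv y]invV; apply: inv_down; rewrite invgK /y !pvM !pv_simple /=.
rewrite !pv_val; try lia.
have -> : (N.-1 - (N.-1 - k.+1).+1 = k)%N by lia.
have -> : (N.-1 - (N.-1 - k.+1) = k.+1)%N by lia.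
have h1 := arc_neq x (ltnW kN); have h2 := arc_neq x kN.
by case: (swP k (arc x k)); case: (swP k (arc x k.+1)); lia.
Qed.

Lemma arc_one p : (p < N)%N -> arc (twisted_one n) p = (N.-1 - p)%N.
Proof. by move=> pN; rewrite /arc /= mulg1 pv_w0. Qed.

Lemma no_ascent x : (forall k, (k.+1 < N)%N -> (arc x k.+1 < arc x k)%N) ->
  x = twisted_one n.
Proof.
move=> dec; apply: arc_ext => p pN; rewrite arc_one //.
have e : (N.-1 - arc x p = p)%N.
  apply: (@incr_id N (fun p => N.-1 - arc x p)%N) => // q qN; last by lia.
  by have := dec q qN; have := arc_lt x (ltnW qN); lia.
by have := arc_lt x pN; lia.
Qed.

Lemma ascent_ex x : x <> twisted_one n ->
  exists2 k, (k.+1 < N)%N & (arc x k < arc x k.+1)%N.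
Proof.
move=> x1; apply: contrapT => nex; apply: x1; apply: no_ascent => k kN.
rewrite ltnNge; apply/negP => le; apply: nex; exists k => //.
rewrite ltn_neqAle le andbT; apply/eqP => e.
by have := arc_inj (ltnW kN) kN e; lia.
Qed.

Lemma inv_even x : ~~ odd (ninv (val x)).
Proof.
have [m] := ubnP (ninv (val x)); elim: m x => // m IH x ltm.
have [->|/eqP/ascent_ex[k kN asc]] := eqVneq x (twisted_one n).
  by rewrite /= inv1.
have e := inv_star kN asc; rewrite e /= negbK; apply: IH.
by move: ltm; rewrite e; lia.
Qed.

(** Half of the length. It is the rank function of the poset, the lengths of
    twisted identities being even. *)
Definition rk x : nat := (ninv (val x))./2.
Definition des x k : bool := (rk (x ** k) < rk x)%N.

Lemma rk_one : rk (twisted_one n) = 0%N.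
Proof. by rewrite /rk /= inv1. Qed.

Lemma inv_rk x : ninv (val x) = (rk x).*2.
Proof. by have := odd_double_half (ninv (val x)); rewrite (negPf (inv_even x)). Qed.

Lemma rk_asc x k : (k.+1 < N)%N -> (arc x k < arc x k.+1)%N ->
  rk x = (rk (x ** k)).+1.
Proof. by move=> kN asc; rewrite /rk (inv_star kN asc). Qed.

Lemma rk_desc x k : (k.+1 < N)%N -> (arc x k.+1 < arc x k)%N -> arc x k <> k.+1 ->
  rk (x ** k) = (rk x).+1.
Proof.
move=> kN desc fx; rewrite -{2}[x](starK x k); apply: rk_asc => //.
rewrite !arc_star //.
have h1 := arc_neq x (ltnW kN); have h2 := arc_neq x kN.
rewrite sw_l sw_r; by case: (swP k (arc x k.+1)); case: (swP k (arc x k)); lia.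
Qed.

Variant star_spec x k : bool -> Prop :=
  | ActDown of (k.+1 < N)%N & (arc x k < arc x k.+1)%N
      & rk x = (rk (x ** k)).+1 : star_spec x k true
  | ActFix of (k.+1 < N)%N -> arc x k = k.+1 & x ** k = x : star_spec x k false
  | ActUp of (k.+1 < N)%N & (arc x k.+1 < arc x k)%N & arc x k <> k.+1
      & rk (x ** k) = (rk x).+1 : star_spec x k false.

Lemma starP x k : star_spec x k (des x k).
Proof.
rewrite /des; case: (boolP (k.+1 < N)%N) => kN; last first.
  rewrite star_out // ltnn; constructor; [by rewrite (negPf kN)|exact: star_out].
case: (ltngtP (arc x k) (arc x k.+1)) => [asc|desc|e].
- have e := rk_asc kN asc; have -> : (rk (x ** k) < rk x)%N by rewrite [X in (_ < X)%N]e.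
  by constructor.
- have [e|/eqP ne] := eqVneq (arc x k) k.+1.
    by rewrite star_fix // ltnn; constructor => //; apply: star_fix.
  have e := rk_desc kN desc ne; have -> : (rk (x ** k) < rk x)%N = false by rewrite e; lia.
  by constructor.
- by have := arc_inj (ltnW kN) kN e; lia.
Qed.

(** * The order in terms of rank matrices *)

Lemma le_bruhat x y : (x <= y)%O = `[< bruhat S (val x) (val y) >].
Proof. by []. Qed.

Lemma lt_rk x y : (x < y)%O -> (rk x < rk y)%N.
Proof.
rewrite lt_neqAle le_bruhat => /andP[xy /asboolP/bruhat_length[/val_inj e|]].
  by rewrite e eqxx in xy.
by rewrite !lengthE !inv_rk; lia.
Qed.

Lemma le_rk x y : (x <= y)%O -> (rk x <= rk y)%N.
Proof. by rewrite le_eqVlt => /predU1P[->//|/lt_rk/ltnW]. Qed.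

(** This comparison of rank matrices will be identified with the order of the
    poset. *)
Definition lem x y := forall i j, (i <= N)%N -> (j <= N)%N ->
  (rmat (arc y) i j <= rmat (arc x) i j)%N.

Lemma le_lem x y : (x <= y)%O -> lem x y.
Proof. by rewrite le_bruhat => /asboolP h i j iN _; apply: bruhat_rmat. Qed.

Lemma lem_off x k i j : i != k.+1 -> j != k.+1 ->
  rmat (arc (x ** k)) i j = rmat (arc x) i j.
Proof.
move=> ik jk; case: (boolP (k.+1 < N)%N) => kN; last by rewrite star_out.
rewrite -[RHS](@rmat_cj k) //; apply: eq_rmat => p _.
by rewrite arc_star.
Qed.

Lemma des_asc x k : des x k -> (k.+1 < N)%N /\ (arc x k < arc x k.+1)%N.
Proof. by case: starP. Qed.

Lemma desN_concave x k : (k.+1 < N)%N -> ~~ des x k -> (arc x k.+1 < arc x k)%N.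
Proof.
move=> kN; case: starP => // e _ _; have {}e := e kN.
by rewrite e -{1}e arcK ?ltnSn // ltnW.
Qed.

Lemma desN_star x k : des x k -> ~~ des (x ** k) k.
Proof. by case: (starP x k) => // _ _ e _; rewrite /des starK e -leqNgt. Qed.

Lemma des_starN x k : ~~ des x k -> x ** k <> x -> des (x ** k) k.
Proof. by case: (starP x k) => // _ _ _ e _ _; rewrite /des starK e. Qed.

(** The three lifting properties of the order on rank matrices: the entries
    outside of row and column k+1 are unchanged, and the remaining ones follow
    by concavity or convexity. *)
Lemma lemM1 x y k : lem x y -> des y k -> ~~ des x k -> lem x (y ** k).
Proof.
move=> xy dy dx; have [kN _] := des_asc dy.
apply: (rmat_le_concave kN (arc_fpf x) (arc_fpf (y ** k)) (desN_concave kN dx)).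
by move=> i j iN jN ik jk; rewrite lem_off //; apply: xy.
Qed.

Lemma lemM2 x y k : lem x y -> des y k -> des x k -> lem (x ** k) (y ** k).
Proof.
move=> xy dy dx; have [kN _] := des_asc dy.
apply: (rmat_le_concave kN (arc_fpf (x ** k)) (arc_fpf (y ** k))).
  exact: desN_concave (desN_star dx).
by move=> i j iN jN ik jk; rewrite !lem_off //; apply: xy.
Qed.

Lemma lem_star x k : des x k -> lem (x ** k) x.
Proof.
move=> dx; have [kN _] := des_asc dx.
apply: (rmat_le_concave kN (arc_fpf (x ** k)) (arc_fpf x)).
  exact: desN_concave (desN_star dx).
by move=> i j iN jN ik jk; rewrite !lem_off.
Qed.

Lemma lemM3 x y k : lem x y -> ~~ des y k -> ~~ des x k -> lem (x ** k) (y ** k).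
Proof.
move=> xy dy dx; case: (boolP (k.+1 < N)%N) => kN; last by rewrite !star_out.
have [-> |/eqP xk] := eqVneq (x ** k) x.
  have [-> //|/eqP yk] := eqVneq (y ** k) y.
  have := lem_star (des_starN dy yk); rewrite starK => h i j iN jN.
  exact: leq_trans (h i j iN jN) (xy i j iN jN).
apply: (rmat_le_convex kN (arc_fpf (x ** k)) (arc_fpf (y ** k))).
  have [yk|/eqP yk] := eqVneq (y ** k) y; first by right; rewrite arc_fix // yk.
  by left; case: (des_asc (des_starN dy yk)).
by move=> i j iN jN ik jk; rewrite !lem_off //; apply: xy.
Qed.

Lemma lem_one x : lem (twisted_one n) x.
Proof.
move=> i j iN jN; rewrite (@eq_rmat (arc (twisted_one n)) (fun p => N.-1 - p)%N) ?rmat_rev //.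
  exact: rmat_bound (arc_fpf x) iN jN.
by move=> p pi; rewrite arc_one //; lia.
Qed.

Lemma lem_anti x y : lem x y -> lem y x -> x = y.
Proof.
move=> xy yx; apply: arc_ext; apply: rmat_inj; try exact: arc_fpf.
by move=> i j iN jN; apply/eqP; rewrite eqn_leq xy ?yx.
Qed.

(** Both factors of theta(s) x s are multiplications that increase the length,
    to which the lifting property of the Bruhat order applies. *)
Lemma bruhat_star x y k : des x k -> des y k ->
  (x ** k <= y ** k)%O -> (x <= y)%O.
Proof.
move=> dx dy; rewrite !le_bruhat => /asboolP h; apply/asboolP.
have [kN ax] := des_asc dx; have [_ ay] := des_asc dy.
have kN' : (k < N.-1)%N by lia.
set o := Ordinal kN'; rewrite -[k]/(val o) !star_ord /= in h.
have key z : (arc z k < arc z k.+1)%N ->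
  let y := theta (simple o) * val z * simple o in
  [/\ (pv y (rev_ord o) < pv y (rev_ord o).+1)%N,
      simple (rev_ord o) * y = val z * simple o
    & (pv (val z * simple o)^-1 o < pv (val z * simple o)^-1 o.+1)%N].
  move=> az y'; rewrite /y' theta_simple.
  have e : simple (rev_ord o) * (simple (rev_ord o) * val z * simple o) = val z * simple o.
    by rewrite !mulgA simpleK mul1g.
  have zN := arc_lt z (ltnW kN); have zN' := arc_lt z kN.
  split=> //; last first.
    rewrite !pos_simple /=; case: (swP k k); case: (swP k k.+1); try lia.
    by rewrite !pos_val // ?(ltnW kN) //; lia.
  rewrite !pvM !pv_simple /=.
  have -> : sw (N.-1 - k.+1) (N.-1 - k.+1) = (N.-1 - k)%N by case: swP; lia.
  have -> : sw (N.-1 - k.+1) (N.-1 - k.+1).+1 = (N.-1 - k.+1)%N by case: swP; lia.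
  rewrite !pv_val; try lia.
  have -> : (N.-1 - (N.-1 - k) = k)%N by lia.
  have -> : (N.-1 - (N.-1 - k.+1) = k.+1)%N by lia.
  have h1 := arc_neq z (ltnW kN); have h2 := arc_neq z kN.
  by case: (swP k (arc z k)); case: (swP k (arc z k.+1)); lia.
have [x1 x2 x3] := key x ax; have [y1 y2 y3] := key y ay.
have := bruhat_simpleL h x1 y1; rewrite x2 y2 => {}h.
have := bruhat_simpleR h x3 y3.
by rewrite -!mulgA simpleK !mulg1.
Qed.

Lemma star_le x k : des x k -> (x ** k <= x)%O.
Proof.
move=> dx; have [kN ax] := des_asc dx; rewrite le_bruhat; apply/asboolP.
have kN' : (k < N.-1)%N by lia.
set o := Ordinal kN'; rewrite -[k]/(val o) star_ord /=.
have e := inv_star kN ax; rewrite -[k]/(val o) star_ord /= in e.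
set y := _ * val x in e *.
have x2 : val x = simple (rev_ord o) * y by rewrite /y theta_simple mulgA simpleK mul1g.
have st1 : bruhat S (y * simple o) (val x * simple o).
  have -> : val x * simple o = y * simple o * (simple (rev_ord o) ^ (y * simple o)).
    by rewrite conjgE mulgA mulgV mul1g {1}x2 !mulgA.
  apply: bruhat_stepE; first by exists (y * simple o), (simple (rev_ord o)); split=> //; exists (rev_ord o).
  rewrite conjgE mulgA mulgV mul1g mulgA -x2.
  have := inv_le_simple (val x * simple o) o.
  by rewrite -mulgA simpleK mulg1 e ltnS.
have xE : val x * simple o * simple o = val x by rewrite -mulgA simpleK mulg1.
apply: rt_trans st1 _.
suff : bruhat S (val x * simple o) (val x * simple o * simple o) by rewrite xE.
apply: bruhat_stepE; first exact: simple_reflection.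
rewrite xE (@inv_down _ (val x) o) //.
have aN := arc_lt x (ltnW kN); have a'N := arc_lt x kN.
by rewrite [val o]/= !pos_val ?(ltnW kN) //; lia.
Qed.

(** The rank matrices determine the order: peel off a common descent on the
    right, or a descent of the larger element alone. *)
Lemma leE x y : (x <= y)%O <-> lem x y.
Proof.
split; first exact: le_lem.
have [m] := ubnP (rk y); elim: m x y => // m IH x y ltm xy.
have [y1|/eqP/ascent_ex[k kN asc]] := eqVneq y (twisted_one n).
  by rewrite (lem_anti xy) //; rewrite y1; apply: lem_one.
have e := rk_asc kN asc; have dy : des y k by rewrite /des [X in (_ < X)%N]e.
have ltm' : (rk (y ** k) < m)%N by lia.
have [dx|dx] := boolP (des x k).
  by apply: (bruhat_star dx dy); apply: IH => //; apply: lemM2.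
by apply: le_trans (star_le dy); apply: IH => //; apply: lemM1.
Qed.

End Twisted.

(** * The action of the simple generators on the graded poset *)

Notation "x ** k" := (star x k) (at level 40, left associativity).

Definition adj (j k : nat) : bool := (k == j.+1) || (j == k.+1).
Definition far (j k : nat) : bool := (j.+1 < k) || (k.+1 < j).

#[global] Opaque star rk arc twisted_one.

Section Action.
Variable n : nat.
Local Notation N := (n.*2).
Local Notation one := (twisted_one n).
Implicit Types (x y z w c : twisted n) (j k s t u : nat).
Local Open Scope order_scope.

Definition cov x y : bool := (x < y) && (rk y == (rk x).+1).

Lemma le_lt x y : x <= y -> (rk x < rk y)%N -> x < y.
Proof. by rewrite le_eqVlt => /predU1P[->|//]; rewrite ltnn. Qed.

Lemma le_eq_rk x y : x <= y -> (rk y <= rk x)%N -> x = y.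
Proof. by rewrite le_eqVlt => /predU1P[//|/lt_rk]; lia. Qed.

Lemma leM1 x y k : x <= y -> des y k -> ~~ des x k -> x <= y ** k.
Proof. by move=> /leE h dy dx; apply/leE/lemM1. Qed.

Lemma leM2 x y k : x <= y -> des y k -> des x k -> x ** k <= y ** k.
Proof. by move=> /leE h dy dx; apply/leE/lemM2. Qed.

Lemma leM3 x y k : x <= y -> ~~ des y k -> ~~ des x k -> x ** k <= y ** k.
Proof. by move=> /leE h dy dx; apply/leE/lemM3. Qed.

Lemma one_le x : one <= x.
Proof. exact/leE/lem_one. Qed.

Lemma des_ex x : x <> one -> exists k, des x k.
Proof. by case/ascent_ex => k kN asc; exists k; rewrite /des (rk_asc kN asc). Qed.

Lemma rk0 x : rk x = 0%N -> x = one.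
Proof.
by move=> x0; apply: contrapT => /des_ex[k]; rewrite /des x0.
Qed.

Lemma des_ok x k : des x k -> (k.+1 < N)%N.
Proof. by case: starP. Qed.

Lemma des_rk x k : des x k -> rk x = (rk (x ** k)).+1.
Proof. by case: starP. Qed.

Lemma star_rk x k :
  [\/ rk (x ** k) = (rk x).+1, x ** k = x | rk x = (rk (x ** k)).+1].
Proof.
by case: (starP x k) => [_ _ e|_ e|_ _ _ e]; [constructor 3|constructor 2|constructor 1].
Qed.

Lemma star_rk_le x k : (rk (x ** k) <= (rk x).+1)%N.
Proof. by case: (star_rk x k) => e; rewrite ?e //; lia. Qed.

Lemma star_lt x k : des x k -> x ** k < x.
Proof. by move=> dx; apply: le_lt (star_le dx) _. Qed.

Lemma star_gt x k : (rk x < rk (x ** k))%N -> x < x ** k.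
Proof. by move=> h; rewrite -{1}[x](starK x k) star_lt // /des starK. Qed.

Lemma star_ge x k : ~~ des x k -> x <= x ** k.
Proof.
case: (starP x k) => // [_ ->//|_ _ _ e _]; apply/ltW/star_gt.
by rewrite e.
Qed.

Lemma cov_des x k : des x k -> cov (x ** k) x.
Proof. by move=> dx; rewrite /cov star_lt // (des_rk dx) eqxx. Qed.

Lemma cov_star x k : rk (x ** k) = (rk x).+1 -> cov x (x ** k).
Proof. by move=> e; rewrite /cov star_gt // e ?eqxx. Qed.

Lemma cov_lt x y : cov x y -> x < y. Proof. by case/andP. Qed.
Lemma cov_rk x y : cov x y -> rk y = (rk x).+1. Proof. by case/andP=> _ /eqP. Qed.

(** Multiplication by s is order preserving except on the covers that it
    exchanges. *)
Lemma lift x y k : cov x y -> x ** k <> y -> x ** k < y ** k.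
Proof.
move=> /andP[xy /eqP rxy] ne; have xny : x ** k != y ** k.
  by apply/eqP => /star_inj e; rewrite e ltxx in xy.
rewrite lt_neqAle xny /=.
have [dy|dy] := boolP (des y k).
  have [dx|dx] := boolP (des x k); first exact: leM2 (ltW xy) dy dx.
  case: ne; have h := leM1 (ltW xy) dy dx.
  by rewrite (le_eq_rk h) ?starK //; have := des_rk dy; lia.
have [dx|dx] := boolP (des x k); last exact: leM3 (ltW xy) dy dx.
exact: le_trans (star_le dx) (le_trans (ltW xy) (star_ge dy)).
Qed.

(** Gradedness of the poset: by the lifting properties, a coatom found below a
    descent of y is transported to y. *)
Lemma coatom_ex x y : x < y -> exists2 c, x <= c & cov c y.
Proof.
have [m] := ubnP (rk y); elim: m x y => // m IH x y ltm xy.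
have [y1|/eqP/des_ex[k dy]] := eqVneq y one.
  by have := lt_rk xy; rewrite y1 rk_one.
have ry := des_rk dy.
have [dx|dx] := boolP (des x k); last first.
  by exists (y ** k); [exact: leM1 (ltW xy) dy dx|exact: cov_des].
have le1 := leM2 (ltW xy) dy dx.
have lt1 : x ** k < y ** k.
  rewrite lt_neqAle le1 andbT; apply/eqP => /star_inj e.
  by rewrite e ltxx in xy.
have [|c' xc cy] := IH _ _ _ lt1; first by lia.
have [dc|dc] := boolP (des c' k).
  exists (y ** k); last exact: cov_des.
  apply: le_trans (ltW (cov_lt cy)); rewrite -[x](starK x k) -[c'](starK c' k).
  by apply: leM3 (desN_star dc) (desN_star dx); apply: leM1 (desN_star dx).
have xc' : x <= c' ** k by rewrite -[x](starK x k); apply: leM3 xc dc (desN_star dx).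
case: (starP c' k) (dc) => // [_ e _|_ _ _ e _].
  exists (y ** k); last exact: cov_des.
  by apply: le_trans (ltW (cov_lt cy)); rewrite -e.
exists (c' ** k) => //; rewrite /cov; apply/andP; split; last first.
  by apply/eqP; have := cov_rk cy; lia.
apply: le_lt; last by have := cov_rk cy; lia.
by rewrite -[y](starK y k); apply: leM3 (ltW (cov_lt cy)) (desN_star dy) dc.
Qed.

Lemma coversP x y : covers x y <-> cov x y.
Proof.
split=> [[xy e]|xy].
  have [c xc cy] := coatom_ex xy.
  have : (x <= c <= y)%O by rewrite xc ltW // cov_lt.
  have inb : [set z | x <= z <= y]%classic c -> [set x; y]%classic c by rewrite e.
  move=> /inb[|] /= ce; first by rewrite -ce.
  by move: (cov_lt cy); rewrite ce ltxx.
split; first exact: cov_lt.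
apply/seteqP; split=> z /=; last first.
  by case=> ->; rewrite lexx ltW // cov_lt.
rewrite !le_eqVlt => /andP[/predU1P[->|xz] /predU1P[->|zy]]; try by [left|right].
by have := lt_rk xz; have := lt_rk zy; have := cov_rk xy; lia.
Qed.

(** * Coxeter relations and stabilizers *)

Lemma star_far x j k : far j k -> x ** j ** k = x ** k ** j.
Proof.
move=> jk.
case: (boolP (j.+1 < N)%N) => jN; last by rewrite !(star_out _ jN).
case: (boolP (k.+1 < N)%N) => kN; last by rewrite !(star_out _ kN).
have swC p : sw j (sw k p) = sw k (sw j p).
  by move: jk; rewrite /far; case: (swP k p); case: (swP j p) => ? ?; subst; do ?case: swP; lia.
by apply: arc_ext => p pN; rewrite !arc_star // swC swC.
Qed.

Lemma braid_succ x k : (k.+2 < N)%N ->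
  x ** k ** k.+1 ** k = x ** k.+1 ** k ** k.+1.
Proof.
move=> kN; have sw3 p : sw k (sw k.+1 (sw k p)) = sw k.+1 (sw k (sw k.+1 p)).
  by case: (swP k p); case: (swP k.+1 p) => *; do 4?case: swP; lia.
by apply: arc_ext => p pN; rewrite !arc_star //; [rewrite !sw3|lia..].
Qed.

Lemma braid x j k : adj j k -> (j.+1 < N)%N -> (k.+1 < N)%N ->
  x ** j ** k ** j = x ** k ** j ** k.
Proof. by case/orP=> /eqP-> *; rewrite braid_succ. Qed.

Lemma adjC j k : adj j k = adj k j.
Proof. by rewrite /adj orbC. Qed.
Lemma farC j k : far j k = far k j.
Proof. by rewrite /far orbC. Qed.

(** Adjacent generators never act equally, as seen by comparing the two
    involutions at the three points that they move. *)
Lemma star_adj x j k : adj j k -> (j.+1 < N)%N -> (k.+1 < N)%N -> x ** j <> x ** k.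
Proof.
wlog -> : j k / k = j.+1 => [wl|_ jN kN e].
  case/orP=> /eqP-> jN kN; first by apply: wl => //; rewrite /adj eqxx.
  by move/esym; apply: wl => //; rewrite /adj eqxx.
have j2N : (j.+2 < N)%N by lia.
have e' p : arc (x ** j) p = arc (x ** j.+1) p by rewrite e.
have := e' j; have := e' j.+1; have := e' j.+2; rewrite !arc_star //.
have -> : sw j j.+2 = j.+2 by case: swP; lia.
have -> : sw j.+1 j = j by case: swP; lia.
rewrite !sw_l !sw_r.
have j0N : (j < N)%N by lia.
have := arc_neq x j0N; have := arc_neq x jN; have := arc_neq x j2N.
have := arcK x j0N; have := arcK x jN; have := arcK x j2N.
move: (arc x) => f k0 k1 k2 n0 n1 n2.
have a1 : f j = j.+1 -> f j.+1 = j by move=> <-.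
have a2 : f j = j.+2 -> f j.+2 = j by move=> <-.
have a3 : f j.+1 = j.+2 -> f j.+2 = j.+1 by move=> <-.
have b1 : f j <> f j.+1 by move=> h; have := k1; rewrite -h k2; lia.
have b2 : f j <> f j.+2 by move=> h; have := k0; rewrite -h k2; lia.
case: (swP j (f j.+2)); case: (swP j.+1 (f j.+1)); case: (swP j (f j));
  case: (swP j.+1 (f j.+2)); case: (swP j (f j.+1)); case: (swP j.+1 (f j)); lia.
Qed.

(** Generators j and k with the same downward effect exchange the two parallel
    arcs (j, k) and (j+1, k+1) for (j, k+1) and (j+1, k). *)
Lemma star_coincide x j k : des x j -> x ** j = x ** k -> j <> k ->
  arc x j = k /\ arc x j.+1 = k.+1.
Proof.
move=> dj e jk; have [jN asc] := des_asc dj.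
have kN : (k.+1 < N)%N.
  apply: contrapT => /negP kN; move: dj; rewrite /des e star_out // ltnn //.
have jk' : far j k.
  rewrite /far; apply: contrapT => h; apply: (star_adj (x := x) _ jN kN e).
  by rewrite /adj; lia.
have e' p : arc (x ** j) p = arc (x ** k) p by rewrite e.
have := e' j; have := e' j.+1; rewrite !arc_star // sw_l sw_r.
have -> : sw k j = j by move: jk'; rewrite /far; case: swP; lia.
have -> : sw k j.+1 = j.+1 by move: jk'; rewrite /far; case: swP; lia.
have := arc_neq x (ltnW jN); have := arc_neq x jN; move: jk'; rewrite /far.
by case: (swP j (arc x j)); case: (swP k (arc x j.+1)); case: (swP j (arc x j.+1)); case: (swP k (arc x j)); lia.
Qed.

Lemma star_coincide_adj x s t u : adj s t -> adj u t -> s <> u -> des x s ->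
  x ** s = x ** u ->
  [/\ x ** s ** t = x ** s, x ** t ** s = x ** t & x ** t ** u = x ** t].
Proof.
move=> st ut su dx e; have [sN _] := des_asc dx.
have [a1 a2] := star_coincide dx e su.
have aN1 : (arc x s.+1 < N)%N by apply: arc_lt; lia.
have a3 : arc x u = s by rewrite -a1 arcK // ltnW.
have a4 : arc x u.+1 = s.+1 by rewrite -a2 arcK.
have uN : (u.+1 < N)%N by rewrite -a2.
have tN : (t.+1 < N)%N by move: st ut; rewrite /adj; lia.
have [[te ue]|[te se]] : (t = s.+1 /\ u = s.+2) \/ (t = u.+1 /\ s = u.+2).
  by move: st ut; rewrite /adj; lia.
- move: a1 a2 a3 a4 aN1; subst t u => a1 a2 a3 a4 aN1; split; apply: star_fix => //; rewrite arc_star //.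
  + by rewrite sw_r a1; case: swP; lia.
  + by have -> : sw s.+1 s = s; [case: swP; lia|rewrite a1 sw_r].
  + by rewrite sw_r a2; case: swP; lia.
- move: a1 a2 a3 a4 aN1; subst t s => a1 a2 a3 a4 aN1; split; apply: star_fix => //; rewrite arc_star //.
  + by have -> : sw u.+2 u.+1 = u.+1; [case: swP; lia|rewrite a4; case: swP; lia].
  + by rewrite sw_r a4; case: swP; lia.
  + by have -> : sw u.+1 u = u; [case: swP; lia|rewrite a3 sw_r].
Qed.

Lemma des_fix_adj x s t u : adj s t -> adj u t -> s <> u ->
  (s.+1 < N)%N -> (u.+1 < N)%N -> x ** s = x -> x ** u = x -> des x t.
Proof.
move=> st ut su sN uN fs fu; have a1 := arc_fix sN fs; have a2 := arc_fix uN fu.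
have a3 : arc x s.+1 = s by rewrite -a1 arcK // ltnW.
have a4 : arc x u.+1 = u by rewrite -a2 arcK // ltnW.
have tN : (t.+1 < N)%N by move: st ut; rewrite /adj; lia.
rewrite /des [X in (_ < X)%N](@rk_asc _ x t) //.
have [[te ue]|[te se]] : (t = s.+1 /\ s.+2 = u) \/ (t = u.+1 /\ u.+2 = s).
  by move: st ut; rewrite /adj; lia.
- by rewrite te a3 ue a2; lia.
- by rewrite te a4 se a1; lia.
Qed.

Lemma des_far x k u : far u k -> des x u -> rk (x ** k) = (rk x).+1 ->
  des (x ** k) u.
Proof.
move=> uk dx e; rewrite /des e -star_far //.
by have := star_rk_le (x ** u) k; have := des_rk dx; lia.
Qed.

(** This and the next lemma concern the second step along an orbit under two
    adjacent generators. If s fixed both x and x t, the braid relation would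
    give x t = x. *)
Lemma up2 x s t : adj s t -> (s.+1 < N)%N -> (t.+1 < N)%N ->
  ~~ des x s -> rk (x ** t) = (rk x).+1 -> rk (x ** t ** s) = (rk (x ** t)).+1.
Proof.
move=> st sN tN dx up; have cx := cov_star up.
have ne : x ** s <> x ** t by apply: star_adj.
have lt := lt_rk (lift cx ne); have ge := le_rk (star_ge dx).
case: (star_rk (x ** t) s) => // e; last by lia.
have xs : x ** s = x.
  by case: (star_rk x s) => // e'; move: lt ge; rewrite e; lia.
have := braid x st sN tN; rewrite xs e starK => h1.
by move: up; rewrite h1; lia.
Qed.

Lemma down2 x s t : adj s t -> (s.+1 < N)%N -> (t.+1 < N)%N ->
  des x t -> (rk (x ** s) <= rk x)%N -> des (x ** t) s.
Proof.
move=> st sN tN dx le; have cx := cov_des dx.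
have ne : x ** t ** s <> x.
  by move=> h; apply: (@star_adj x _ _ st sN tN); rewrite -[in LHS]h starK.
have lt := lt_rk (lift cx ne); have rx := des_rk dx.
rewrite /des; case: (star_rk (x ** t) s) => e; try lia.
have xs : x ** s = x.
  by case: (star_rk x s) => // e'; move: lt le; rewrite e; lia.
have := braid x st sN tN; rewrite xs e starK => h1.
by move: rx; rewrite h1; lia.
Qed.

(** The orbit of a lowest point that both generators move is a hexagon. *)
Lemma hexagon x s t : adj s t -> (s.+1 < N)%N -> (t.+1 < N)%N ->
  rk (x ** s) = (rk x).+1 -> rk (x ** t) = (rk x).+1 ->
  [/\ rk (x ** s ** t) = (rk x).+2, rk (x ** t ** s) = (rk x).+2
    & rk (x ** s ** t ** s) = (rk x).+3].
Proof.
move=> st sN tN us ut.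
have ds : ~~ des x s by rewrite /des us; lia.
have dt : ~~ des x t by rewrite /des ut; lia.
have st' : adj t s by rewrite adjC.
have e1 : rk (x ** s ** t) = (rk x).+2 by rewrite (up2 st') // us.
have e2 : rk (x ** t ** s) = (rk x).+2 by rewrite (up2 st) // ut.
split=> //.
have c1 : cov (x ** t) (x ** s ** t).
  rewrite /cov e1 ut eqxx andbT; apply: lift; first exact: cov_star.
  by move/esym; apply: star_adj.
have ne : x ** t ** s <> x ** s ** t.
  move=> h; have := braid x st sN tN; rewrite -h starK => /(congr1 (fun y => y ** t)).
  by rewrite !starK => h'; move: e2; rewrite -h'; lia.
have := lt_rk (lift c1 ne); have := star_rk_le (x ** s ** t) s; lia.
Qed.

Lemma spm_star w k : des w k -> special_partial_matching w (fun x => x ** k).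
Proof.
move=> dw; split.
- move=> x xw; have [dx|dx] := boolP (des x k).
    exact: le_trans (star_le dx) xw.
  by rewrite -[w](starK w k); exact: leM3 (leM1 xw dw dx) (desN_star dw) dx.
- by move=> x _; rewrite starK.
- exact/coversP/cov_des.
- move=> x _; case: (star_rk x k) => e; [constructor 3|constructor 2|constructor 1] => //.
    exact/coversP/cov_star.
  by apply/coversP/cov_des; rewrite /des [X in (_ < X)%N]e.
- by move=> x y _ _ /coversP xy ne; apply: lift.
Qed.

Lemma twisted_pircon : pircon (twisted n).
Proof.
move=> x [y yx]; split; first exact: finite_finset.
have [|k dx] := @des_ex x; last by exists (fun x => x ** k); apply: spm_star.
by move=> x1; move: yx; rewrite x1 => /lt_rk; rewrite rk_one.
Qed.

End Action.

(** * Elements are determined by their coatoms *)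

(** Arithmetic on ranks: the facts on the order and on the graph of generators
    are dropped, as case analysis on them is costly. *)
Ltac rklia :=
  repeat match goal with
  | H : is_true (cov _ _) |- _ => clear H
  | H : is_true (des _ _) |- _ => clear H
  | H : is_true (~~ des _ _) |- _ => clear H
  | H : is_true (adj _ _) |- _ => clear H
  | H : is_true (far _ _) |- _ => clear H
  | H : is_true (~~ far _ _) |- _ => clear H
  | H : is_true (Order.lt _ _) |- _ => clear H
  | H : is_true (Order.le _ _) |- _ => clear H
  | H : ~ (@eq (twisted _) _ _) |- _ => clear H
  | H : forall _, _ |- _ => clear H
  | H : @eq (twisted _) _ _ |- _ => clear H
  end; lia.

Section Coatoms.
Variable n : nat.
Local Notation N := (n.*2).
Local Notation one := (twisted_one n).
Implicit Types (x y z w c : twisted n) (j k s t u : nat).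
Local Open Scope order_scope.

Lemma down3 x s u : adj s u -> des x s -> des (x ** s) u -> des (x ** s ** u) s ->
  des x u.
Proof.
move=> su d1 d2 d3; have b := braid x su (des_ok d1) (des_ok d2).
have r1 := des_rk d1; have r2 := des_rk d2; have r3 := des_rk d3.
rewrite /des; case: (star_rk x u) => e; last by rklia.
  rewrite b in r3; have := star_rk_le (x ** u ** s) s.
  by have := star_rk_le (x ** u ** s ** u) u; rewrite !starK; rklia.
by move: r3; rewrite b e; rklia.
Qed.

Lemma star_adj2 x s t : adj s t -> (s.+1 < N)%N -> (t.+1 < N)%N ->
  x ** s ** t <> x ** t ** s.
Proof.
move=> st sN tN h; have := braid x st sN tN; rewrite h starK.
move=> /(congr1 (fun y => y ** t)); rewrite !starK -h => /(congr1 (fun y => y ** t)).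
by rewrite starK => /esym; apply: star_adj.
Qed.

Lemma des_hexagon w s t : adj s t -> des w s -> des w t -> des (w ** s ** t) s.
Proof.
move=> st ds dt; have sN := des_ok ds; have tN := des_ok dt.
have ts : adj t s by rewrite adjC.
have rs := des_rk ds; have rt := des_rk dt.
have d2 : des (w ** s) t by apply: (down2 ts tN sN ds); lia.
have d3 : des (w ** t) s by apply: (down2 st sN tN dt); lia.
have rst := des_rk d2; have rts := des_rk d3.
have c0 : cov (w ** s) w by apply: cov_des.
have ne1 : w ** s ** t <> w.
  by move=> e; apply: (@star_adj _ w _ _ st sN tN); rewrite -[LHS](starK _ t) e.
have c1 : cov (w ** s ** t) (w ** t) by rewrite /cov (lift c0 ne1); apply/eqP; lia.
have ne2 : w ** s ** t ** s <> w ** t.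
  by move=> e; apply: (star_adj2 (x := w) st sN tN); rewrite -e starK.
by have := lt_rk (lift c1 ne2); rewrite /des; lia.
Qed.

(** Suppose that c = x s is the only coatom of x. Then every descent u of c is
    adjacent to s. Going down along u, and once more if c u is fixed by s, the
    lifting property yields a second coatom of x or a descent of x adjacent to
    s. *)
Lemma unique_coatom x c : cov c x -> (forall c', cov c' x -> c' = c) ->
  (rk x <= 2)%N.
Proof.
move=> cx un; rewrite leqNgt; apply/negP => x3; have rc := cov_rk cx.
have [|s ds] := @des_ex _ x; first by move=> x1; rewrite x1 rk_one in x3.
have sN := des_ok ds.
have xs : x ** s = c by apply/un/cov_des.
have cs : c ** s = x by rewrite -xs starK.
have noS z : cov z x -> rk (z ** s) = rk c -> False.
  by move=> /un->; rewrite cs; rklia.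
have notD u : adj u s -> des x u -> False.
  move=> us du; have := un _ (cov_des du); rewrite -xs; apply: star_adj => //.
  exact: des_ok du.
have adjD v : des c v -> adj v s.
  move=> dv; apply: contrapT => nadj.
  have vs : far v s.
    have : v != s by apply/eqP => e; have := desN_star ds; rewrite xs -e dv.
    by move: nadj; rewrite /adj /far; rklia.
  have dxv : des x v by rewrite -cs; apply: des_far => //; rewrite cs; rklia.
  have := un _ (cov_des dxv) => e; move: dv; rewrite /des -{1}e starK; rklia.
have [|u du] := @des_ex _ c; first by move=> c1; rewrite c1 rk_one in rc; rklia.
have uN := des_ok du; have us := adjD u du.
have [h hE] : {h | h = c ** u} by exists (c ** u).
have rh := des_rk du; rewrite -?hE in rh.
have hu : h ** u = c by rewrite hE starK.
have ch : cov h c by rewrite hE; apply: cov_des.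
have hdu : ~~ des h u by rewrite hE; apply: desN_star.
have [e|hs|e] := star_rk h s.
- have ne : h ** s <> c by rewrite -hu; apply: star_adj; rewrite // adjC.
  have lt := lift ch ne; rewrite cs in lt.
  by apply: ne; apply: un; rewrite /cov lt; apply/eqP; rklia.
- have [|v dv] := @des_ex _ h; first by move=> h1; rewrite h1 rk_one in rh; rklia.
  have vN := des_ok dv; have rhv := des_rk dv; have [k kE] : {k | k = h ** v} by exists (h ** v).
  rewrite -?kE in rhv.
  have kv : k ** v = h by rewrite kE starK.
  have ck : cov k h by rewrite kE; apply: cov_des.
  have vs' : v <> s by move=> e; move: dv; rewrite /des e hs ltnn.
  have vu' : v <> u by move=> e; move: dv; rewrite e (negPf hdu).
  have [vu|vu] := boolP (far v u).
  + have dcv : des c v by rewrite -hu; apply: des_far => //; rewrite hu; rklia.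
    have vs := adjD v dcv.
    have dks : des k s.
      have ne : k ** s <> h by move=> /(congr1 (fun y => y ** s)); rewrite starK hs => e; rewrite e in rhv; rklia.
      have := lt_rk (lift ck ne); rewrite hs => lt.
      rewrite /des; case: (star_rk k s) => e; try rklia.
      have := braid h vs vN sN; rewrite -?kE e hs kv -?kE => e'.
      by rewrite e in e'; rewrite -e' in rhv; rklia.
    have [l lE] : {l | l = k ** s} by exists (k ** s).
    have rl := des_rk dks; rewrite -?lE in rl.
    have ls : l ** s = k by rewrite lE starK.
    have kuv : k ** u ** v = c by rewrite -(star_far _ vu) kv hu.
    have rku : rk (k ** u) = (rk k).+1.
      by have := star_rk_le (k ** u) v; have := star_rk_le k u; rewrite kuv; rklia.
    have [e|lu|e] := star_rk l u.
    * have su : adj s u by rewrite adjC.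
      have us1 : rk (l ** s) = (rk l).+1 by rewrite ls; rklia.
      have [_ _ r3] := hexagon su sN uN us1 e.
      rewrite ls in r3.
      have ne1 : k ** u <> h.
        by move=> e1; move: kuv; rewrite e1 -?kE => e2; rewrite -e2 in rc rh; rklia.
      have c1 : cov (k ** u) c.
        by rewrite /cov -{1}hu (lift ck ne1) /=; apply/eqP; rklia.
      have ne2 : k ** u ** s <> c by move=> e2; move: r3 (noS c cx); rewrite e2 cs; have := congr1 (@rk n) (congr1 (fun y => y ** s) e2); rewrite starK cs; rklia.
      have lt := lift c1 ne2; rewrite cs in lt.
      by apply: ne2; apply: un; rewrite /cov lt; apply/eqP; rklia.
    * have lv : l ** v = l.
        by have := braid h vs vN sN; rewrite -?kE -?lE hs -?kE -?lE => ->.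
      have := @des_fix_adj _ l u s v us vs (not_eq_sym vu') uN vN lu lv.
      by rewrite lE (negPf (desN_star dks)).
    * have [y yE] : {y | y = k ** u} by exists (k ** u).
      have dys : des y s.
        apply: (@down3 _ u s us); first by rewrite /des yE starK rku.
          by rewrite yE starK.
        by rewrite yE starK -?lE /des e.
      have xE : x = y ** s ** v ** s ** v.
        have sv : adj s v by rewrite adjC.
        by rewrite -(braid (y ** s) sv sN vN) starK yE kuv cs.
      apply: (notD v vs); rewrite /des {1}xE starK.
      have := star_rk_le (y ** s ** v) s; have := star_rk_le (y ** s) v.
      by have := des_rk dys; rewrite {1}yE; rklia.
  + have {}vu : adj v u by move: vu; rewrite /adj /far; rklia.
    have vs : far v s by move: vu us vs'; rewrite /adj /far; rklia.
    have ks : k ** s = k by rewrite kE (star_far _ vs) hs.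
    have [e|ku|e] := star_rk k u.
    * have r3 : rk (k ** u ** s) = (rk (k ** u)).+1.
        by apply: up2 => //; [rewrite adjC|rewrite /des ks ltnn].
      have ne1 : k ** u <> h by rewrite -kv; apply: star_adj => //; rewrite adjC.
      have c1 : cov (k ** u) c.
        by rewrite /cov -{1}hu (lift ck ne1) /=; apply/eqP; rklia.
      have ne2 : k ** u ** s <> c.
        by move=> /(congr1 (fun y => rk (y ** s))); rewrite starK cs; rklia.
      have lt := lift c1 ne2; rewrite cs in lt.
      by apply: ne2; apply: un; rewrite /cov lt; apply/eqP; rklia.
    * by apply: (@star_adj _ k _ _ us uN sN); rewrite ku ks.
    * have dcv : des c v.
        apply: (@down3 _ u v _ du) => //; first by rewrite adjC.
          by rewrite -hE.
        by rewrite -hE -kE /des e.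
      by have := adjD v dcv; move: vs; rewrite /adj /far; rklia.
- apply: (notD u us); apply: (@down3 _ s u _ ds); first by rewrite adjC.
    by rewrite xs.
  by rewrite xs -?hE /des e.
Qed.

(** Two elements with the same coatoms and a common descent s agree, as s
    exchanges one of them with a coatom of both. *)
Lemma coatoms_common_des x y s : (forall c, cov c x <-> cov c y) ->
  des x s -> des y s -> x = y.
Proof.
move=> K dx dy; apply: contrapT => ne.
have cy : cov (x ** s) y by apply/K/cov_des.
have := @lift _ _ _ s cy; rewrite starK => /(_ ne)/lt_rk.
by have := cov_rk cy; have := des_rk dy; have := des_rk dx; rklia.
Qed.

Section TwoElements.

Let same x y := [/\ forall c, cov c x <-> cov c y, x <> y & (3 <= rk x)%N].

Let same_rk x y : same x y -> rk y = rk x.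
Proof.
case=> K _ r3; have [|s ds] := @des_ex _ x; first by move=> x1; rewrite x1 rk_one in r3.
by rewrite (cov_rk (cov_des ds)); apply/cov_rk/K/cov_des.
Qed.

Let same_sym x y : same x y -> same y x.
Proof.
by move=> h; have r := same_rk h; case: h => K ne r3; split; [move=> c; split=> /K|move/esym|rewrite r].
Qed.

Let desN x y s : same x y -> des x s -> ~~ des y s.
Proof. by case=> K ne _ dx; apply/negP => /(coatoms_common_des K dx). Qed.

Let des_other x y s t : same x y -> des x s -> des y t -> x ** s <> y ** t ->
  des (x ** s) t.
Proof.
move=> xy dx dy ne; have [K neq _] := xy; have r := same_rk xy.
have cy : cov (x ** s) y by apply/K/cov_des.
have ne' : x ** s ** t <> y by move=> e; apply: ne; rewrite -e starK.
have := lt_rk (lift cy ne'); have := des_rk dx; have := des_rk dy.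
by rewrite /des; rklia.
Qed.

(** Otherwise t is a descent of x s, hence s t leads down from x by two steps
    and t is a descent of x; but x and y have no common descent. *)
Let far_eq x y s t : same x y -> des x s -> des y t -> far s t -> x ** s = y ** t.
Proof.
move=> xy dx dy st; apply: contrapT => /(des_other xy dx dy) d.
have := desN (same_sym xy) dy; rewrite /des -leqNgt => le.
have := star_rk_le (x ** t ** s) s; rewrite starK -(star_far _ st).
by have := des_rk dx; have := des_rk d; rklia.
Qed.

(** If x s and y t differ, then x and y are the two upper elements of a hexagon
    under s and t, below its top x t = y s. *)
Let adj_hex x y s t : same x y -> des x s -> des y t -> adj s t ->
  x ** s <> y ** t -> x ** t = y ** s /\ rk (x ** t) = (rk x).+1.
Proof.
move=> xy dx dy st ne; have [K neq _] := xy; have r := same_rk xy.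
have yx := same_sym xy; have ts : adj t s by rewrite adjC.
have sN := des_ok dx; have tN := des_ok dy.
have dxt := des_other xy dx dy ne; have dys := des_other yx dy dx (not_eq_sym ne).
have cyx : cov (y ** t) x by apply/K/cov_des.
have ne' : y ** t ** s <> x by move=> e; apply: ne; rewrite -e starK.
have rx := des_rk dx; have ry := des_rk dy; have rxt := des_rk dxt; have rys := des_rk dys.
have c2 : cov (y ** t ** s) (x ** s).
  by rewrite /cov (lift cyx ne'); apply/eqP; rklia.
have e : y ** t ** s ** t = x ** s.
  apply: contrapT => /(lift c2)/lt_rk lt; have := desN xy dx.
  by rewrite (down3 ts dy dys) // /des; rklia.
have e' : y ** s ** t = x.
  by apply: (@star_inj _ s); rewrite (braid y st sN tN) e.
have {}e' : x ** t = y ** s by rewrite -e' starK.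
split=> //; have := desN yx dy; case: (star_rk x t) => // ex; last by rewrite /des ex; rklia.
move=> _; have yE : y = x ** s by rewrite -ex e' starK.
by move: rx r; rewrite yE; rklia.
Qed.

(** The lowest point of this hexagon has no descent u adjacent to t and
    commuting with s. Let h be its image under such a u. Either t is a descent
    of h, which makes u a descent of x and contradicts star_coincide_adj, or h s
    t is a coatom of y, hence of x, and its product with s is too high. *)
Let hex_false x y s t u : same x y -> des x s -> des y t -> adj s t ->
  x ** s <> y ** t -> des (x ** s ** t) u -> far u s -> adj u t -> False.
Proof.
move=> xy dx dy st ne du us ut; have [K neq _] := xy; have r := same_rk xy.
have yx := same_sym xy; have ts : adj t s by rewrite adjC.
have sN := des_ok dx; have tN := des_ok dy; have uN := des_ok du.
have [xt_ys r1] := adj_hex xy dx dy st ne.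
have dxt := des_other xy dx dy ne; have dys := des_other yx dy dx (not_eq_sym ne).
have rx := des_rk dx; have ry := des_rk dy; have rxt := des_rk dxt; have rys := des_rk dys.
have [g gE] : {g | g = x ** s ** t} by exists (x ** s ** t).
have gt : g ** t = x ** s by rewrite gE starK.
rewrite -gE in du rxt.
have gts : g ** t ** s = x by rewrite gt starK.
have gs : g ** s = y ** t.
  by rewrite gE (braid x st sN tN) xt_ys starK.
have gst : g ** s ** t = y by rewrite gs starK.
have [h hE] : {h | h = g ** u} by exists (g ** u).
have rg := des_rk du; rewrite -?gE -?hE in rg.
have hu : h ** u = g by rewrite hE starK.
have dhs : ~~ des h s.
  apply/negP => d; have : des g s.
    rewrite -hu; apply: des_far => //; first by rewrite farC.
    by rewrite hu; rklia.
  by rewrite /des gs; move: rg rxt; rewrite -?gE; rklia.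
have hs : rk (h ** s) = (rk h).+1.
  case: (star_rk h s) => // e; last by move: dhs; rewrite /des e; rklia.
  have : g ** s = g by rewrite -hu (star_far _ us) e.
  by rewrite gs => e'; move: rxt; rewrite -?gE -e'; rklia.
have chg : cov h g by rewrite hE; apply: cov_des.
have hsu : h ** s ** u = y ** t by rewrite -(star_far _ us) hu.
have hneq : h ** s <> g.
  by move=> e; move: hsu; rewrite e -?hE => e1; rewrite -e1 in ry; move: rxt; rewrite -?gE; rklia.
have [dht|dht] := boolP (des h t).
  have [k kE] : {k | k = h ** t} by exists (h ** t).
  have rh := des_rk dht; rewrite -?kE in rh.
  have kt : k ** t = h by rewrite kE starK.
  have tu : adj t u by rewrite adjC.
  have su : far s u by rewrite farC.
  have xE : x = k ** u ** t ** s ** u.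
    by rewrite -gts -hu -kt (braid k tu tN uN) (star_far _ us).
  have dxu : des x u.
    rewrite /des {1}xE starK; have := star_rk_le (k ** u ** t) s.
    have := star_rk_le (k ** u) t; have := star_rk_le k u.
    by move: rxt; rewrite -?gE; rklia.
  have ne2 : x ** u <> y ** t.
    rewrite {1}xE starK -hsu -kt -(star_far _ us).
    by move=> /star_inj; apply: star_adj2 => //; rewrite adjC.
  have [xt_yu _] := adj_hex xy dxu dy ut ne2.
  have e : (x ** t) ** s = (x ** t) ** u by rewrite {1}xt_ys xt_yu !starK.
  have d : des (x ** t) s by rewrite /des xt_ys starK -xt_ys r1; rklia.
  have su' : s <> u by move=> e'; move: us; rewrite e' /far; rklia.
  have [_] := star_coincide_adj st ut su' d e; rewrite !starK => e1 _.
  by move: dx; rewrite /des e1 ltnn.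
have [z zE] : {z | z = h ** s ** t} by exists (h ** s ** t).
have rz : rk z = (rk h).+2 by rewrite zE (up2 ts) // hs.
have c1 : cov (h ** s) (g ** s).
  by rewrite /cov (lift chg hneq) gs; apply/eqP; move: rxt; rewrite -?gE; rklia.
have ne2 : h ** s ** t <> g ** s.
  by rewrite gs -hsu; apply: star_adj => //; rewrite adjC.
have cz : cov z x.
  have := lift c1 ne2; rewrite gst -zE => lt; apply/K; rewrite /cov lt.
  by apply/eqP; move: rxt; rewrite -?gE; rklia.
have ne3 : z ** s <> x.
  move=> e; have : z = g ** t by rewrite gt -e starK.
  by rewrite zE => /star_inj.
have := lt_rk (lift cz ne3); rewrite zE (braid h st sN tN).
case: (star_rk h t) => e; last by move: dht; rewrite /des e; rklia.
  have [_ _] := hexagon st sN tN hs e; rewrite (braid h st sN tN) => ->.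
  by move: rxt; rewrite -?gE; rklia.
by rewrite e -?zE rz; move: rxt; rewrite -?gE; rklia.
Qed.

Let adj_eq x y s t : same x y -> des x s -> des y t -> adj s t -> x ** s = y ** t.
Proof.
move=> xy dx dy st; apply: contrapT => ne; have [K neq r3] := xy.
have r := same_rk xy.
have yx := same_sym xy; have ts : adj t s by rewrite adjC.
have sN := des_ok dx; have tN := des_ok dy.
have [xt_ys r1] := adj_hex xy dx dy st ne.
have dxt := des_other xy dx dy ne; have dys := des_other yx dy dx (not_eq_sym ne).
have rx := des_rk dx; have rxt := des_rk dxt.
have ry := des_rk dy; have rys := des_rk dys.
have [g gE] : {g | g = x ** s ** t} by exists (x ** s ** t).
rewrite -?gE in rxt.
have gt : g ** t = x ** s by rewrite gE starK.
have gs : g ** s = y ** t by rewrite gE (braid x st sN tN) xt_ys starK.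
have gE' : g = y ** t ** s by rewrite -gs starK.
have [|u du] := @des_ex _ g; first by move=> g1; rewrite g1 rk_one in rxt; rklia.
have us' : u <> s by move=> e; move: du; rewrite /des e gs; rklia.
have ut' : u <> t by move=> e; move: du; rewrite /des e gt; rklia.
have [us|us] := boolP (far u s).
  have [ut|ut] := boolP (far u t).
    have dxu : des x u.
      rewrite -[x](starK x s) -gt; apply: des_far => //; last by rewrite gt starK; rklia.
      by apply: des_far => //; rewrite gt; rklia.
    have := desN xy dxu; rewrite -{1}[y](starK y t) -gs.
    rewrite des_far //; last by rewrite gs starK; rklia.
    by apply: des_far => //; rewrite gs; rklia.
  rewrite gE in du; apply: (hex_false xy dx dy st ne du us); move: ut; rewrite /adj /far; rklia.
have {}us : adj u s by move: us; rewrite /adj /far; rklia.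
have ut : far u t by move: us st ut'; rewrite /adj /far; rklia.
by rewrite gE' in du; apply: (hex_false yx dy dx ts (not_eq_sym ne) du ut us).
Qed.

(** By symmetry, x s = y t has a descent commuting with s and adjacent to t; it
    is a descent of x, and two distinct neighbours of t now act equally on x. *)
Let adj_false x y s t : same x y -> des x s -> des y t -> adj s t -> False.
Proof.
wlog wl : x y s t / exists u, [/\ des (x ** s) u, far u s & ~~ far u t] => [wl|] xy dx dy st.
  have [K neq r3] := xy; have e := adj_eq xy dx dy st; have rx := des_rk dx.
  have yx := same_sym xy; have ry := des_rk dy.
  have [|u du] := @des_ex _ (x ** s); first by move=> c1; rewrite c1 rk_one in rx; rklia.
  have us' : u <> s by move=> e'; move: du; rewrite e' (negPf (desN_star dx)).
  have ut' : u <> t by move=> e'; move: du; rewrite e' e (negPf (desN_star dy)).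
  have [us|us] := boolP (far u s); last first.
    have {}us : adj u s by move: us; rewrite /adj /far; rklia.
    apply: (wl y x t s) => //; last by rewrite adjC.
    by exists u; rewrite -e; split=> //; move: us st ut'; rewrite /adj /far; rklia.
  have [ut|ut] := boolP (far u t); last by apply: (wl x y s t) => //; exists u.
  have dxu : des x u by rewrite -[x](starK x s); apply: des_far => //; rewrite starK; rklia.
  have := desN xy dxu; rewrite -{1}[y](starK y t) -e des_far //.
  by rewrite e starK; rklia.
case: wl => u [du us ut]; have [K neq r3] := xy; have e := adj_eq xy dx dy st.
have rx := des_rk dx; have ry := des_rk dy.
have us' : u <> s by move=> e'; move: us; rewrite e' /far; rklia.
have ut' : u <> t by move=> e'; move: du; rewrite e' e (negPf (desN_star dy)).
have {}ut : adj u t by move: ut; rewrite /adj /far; rklia.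
have dxu : des x u by rewrite -[x](starK x s); apply: des_far => //; rewrite starK; rklia.
have e2 := adj_eq xy dxu dy ut.
have [e3 _ _] := star_coincide_adj st ut (not_eq_sym us') dx (etrans e (esym e2)).
by move: ry; rewrite -{1}[y](starK y t) -e e3; rklia.
Qed.

(** For a pair of counterexamples, any two descents s of x and t of y commute
    and x s = y t. A descent u of this common coatom c is adjacent to both s and
    t. Let h be c u. Either h s or h t is a coatom of x and y other than c, for
    which s and t cannot both be descents, or s and t fix h, which makes u a
    descent of h. *)
Lemma coatoms_inj x y : (3 <= rk x)%N -> (forall c, cov c x <-> cov c y) -> x = y.
Proof.
move=> r3 K; apply: contrapT => neq; have xy : same x y by [].
have yx := same_sym xy; have r := same_rk xy.
have [|s dx] := @des_ex _ x; first by move=> x1; rewrite x1 rk_one in r3.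
have [|t dy] := @des_ex _ y; first by move=> y1; rewrite -r y1 rk_one in r3.
have sN := des_ok dx; have tN := des_ok dy.
have st' : s <> t by move=> e; move: (desN xy dx); rewrite e dy.
have st : far s t.
  by apply: contrapT => h; apply: (adj_false xy dx dy); move: h; rewrite /adj /far; rklia.
have e := far_eq xy dx dy st.
have [c cE] : {c | c = x ** s} by exists (x ** s).
have rx := des_rk dx; rewrite -?cE in rx.
have ry := des_rk dy; rewrite -e -?cE in ry.
have cs : c ** s = x by rewrite cE starK.
have ct : c ** t = y by rewrite cE e starK.
have [|u du] := @des_ex _ c; first by move=> c1; rewrite c1 rk_one in rx; rklia.
have uN := des_ok du.
have us' : u <> s by move=> e'; move: du; rewrite e' cE (negPf (desN_star dx)).
have ut' : u <> t by move=> e'; move: du; rewrite e' cE e (negPf (desN_star dy)).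
have dxF : des x u -> False.
  move=> dxu; have [ut|ut] := boolP (far u t); last first.
    by apply: (adj_false xy dxu dy); move: ut; rewrite /adj /far; rklia.
  by have := desN xy dxu; rewrite -ct des_far // ct; rklia.
have dyF : des y u -> False.
  move=> dyu; have [us|us] := boolP (far u s); last first.
    by apply: (adj_false yx dyu dx); move: us; rewrite /adj /far; rklia.
  by have := desN yx dyu; rewrite -cs des_far // cs; rklia.
have us : adj u s.
  apply: contrapT => us; apply: dxF; rewrite -cs; apply: des_far => //; last by rewrite cs.
  by move: us; rewrite /adj /far; rklia.
have ut : adj u t.
  apply: contrapT => ut; apply: dyF; rewrite -ct; apply: des_far => //; last by rewrite ct; rklia.
  by move: ut; rewrite /adj /far; rklia.
have su : adj s u by rewrite adjC.
have tu : adj t u by rewrite adjC.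
have ts : far t s by rewrite farC.
have [h hE] : {h | h = c ** u} by exists (c ** u).
have rc := des_rk du; rewrite -?hE in rc.
have hu : h ** u = c by rewrite hE starK.
have hdu : ~~ des h u by rewrite hE; apply: desN_star.
have chc : cov h c by rewrite hE; apply: cov_des.
have dhs : ~~ des h s.
  apply/negP => d; apply: dxF; apply: (down3 su dx); first by rewrite -cE.
  by rewrite -?cE -?hE.
have dht : ~~ des h t.
  apply/negP => d; apply: dyF; apply: (down3 tu dy); first by rewrite -e -?cE.
  by rewrite -e -?cE -?hE.
(* a coatom of x other than c has both descents s and t *)
have both z : cov z x -> z <> c -> des z s /\ des z t.
  move=> zx zc; have zy : cov z y by apply/K.
  have ne1 : z ** s <> x by move=> e'; apply: zc; rewrite cE -e' starK.
  have ne2 : z ** t <> y by move=> e'; apply: zc; rewrite cE e -e' starK.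
  have := lt_rk (lift zx ne1); have := lt_rk (lift zy ne2); have := cov_rk zx.
  by rewrite -e -cE /des => r1 r2 r4; split; rklia.
have upF s' t' : adj u s' -> adj u t' -> s' <> t' -> (s'.+1 < N)%N ->
    cov (h ** s') x -> h ** s' <> c -> far t' s' -> ~~ des h t' ->
    des (h ** s') s' -> des (h ** s') t' -> False.
  move=> us1 ut1 st1 s'N zx zc ts1 dt' ds1 dt1.
  have rz := cov_rk zx; have r1 := des_rk dt1.
  have cz : cov h (h ** s') by apply: cov_star; have := des_rk ds1; rewrite starK; rklia.
  have eq : h ** t' = h ** s'.
    apply: contrapT => ne; have := lt_rk (lift cz ne).
    by have := star_rk h t'; move: dt'; rewrite /des; rklia.
  have eq' : h ** s' ** s' = h ** s' ** t' by rewrite starK -eq starK.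
  have s'u : adj s' u by rewrite adjC.
  have t'u : adj t' u by rewrite adjC.
  have [e1 _ _] := star_coincide_adj s'u t'u st1 ds1 eq'.
  rewrite starK in e1; move: rc; rewrite -hu e1; rklia.
case: (star_rk h s) => hs; last by move: dhs; rewrite /des hs; rklia.
  have ne : h ** s <> c by rewrite -hu; apply: star_adj.
  have zx : cov (h ** s) x.
    by have := lift chc ne; rewrite cs => lt; rewrite /cov lt; apply/eqP; rklia.
  have [d1 d2] := both _ zx ne.
  exact: (upF s t us ut st' sN zx ne ts dht d1 d2).
case: (star_rk h t) => ht; last by move: dht; rewrite /des ht; rklia.
  have ne : h ** t <> c by rewrite -hu; apply: star_adj.
  have zx : cov (h ** t) x.
    by have := lift chc ne; rewrite ct => lt; apply/K; rewrite /cov lt; apply/eqP; rklia.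
  have [d1 d2] := both _ zx ne.
  by move: d1; rewrite /des (star_far _ ts) hs ltnn.
by move: hdu; rewrite (des_fix_adj su tu st' sN tN hs ht).
Qed.

End TwoElements.

End Coatoms.

(** * Partial matchings of lower sets *)

Section Matchings.
Variable n : nat.
Local Notation one := (twisted_one n).
Implicit Types (x y z w c d : twisted n) (k : nat) (I : twisted n -> Prop)
  (M N : twisted n -> twisted n).
Local Open Scope order_scope.

(** Special partial matchings of an arbitrary lower set, so as to include the
    multiplications as matchings of the whole poset. *)
Definition pmatch I M : Prop :=
  [/\ forall x y, I y -> x <= y -> I x,
      forall x, I x -> I (M x),
      forall x, I x -> M (M x) = x,
      forall x, I x -> [\/ cov x (M x), M x = x | cov (M x) x]
    & forall x y, I y -> cov x y -> M x <> y -> M x < M y].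

Lemma spm_pmatch w M : special_partial_matching w M -> pmatch (fun x => x <= w) M.
Proof.
case=> h1 h2 h3 h4 h5; split=> //.
- by move=> x y yw xy; apply: le_trans xy yw.
- move=> x /h4[] => [/coversP e|e|/coversP e];
    [by constructor 3|by constructor 2|by constructor 1].
- move=> x y yw xy; apply: h5 => //; last exact/coversP.
  by apply: le_trans yw; apply/ltW/cov_lt.
Qed.

Lemma star_pmatch k : pmatch (fun _ => True) (fun x : twisted n => x ** k).
Proof.
split=> // [x _|x _|x y _ xy]; [exact: starK| |exact: lift].
case: (star_rk x k) => e; [constructor 1|by constructor 2|constructor 3].
  exact: cov_star.
by apply: cov_des; rewrite /des [X in (_ < X)%N]e.
Qed.

(** The identity is included among the matchings in order to compare other ones
    with it. *)
Lemma id_pmatch : pmatch (fun _ => True) (@id (twisted n)).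
Proof. by split=> // [x _|x y _ /cov_lt//]; constructor 2. Qed.

Section Theory.
Variables (I : twisted n -> Prop) (M : twisted n -> twisted n).
Hypothesis IM : pmatch I M.

Lemma pm_le x y : I y -> x <= y -> I x.
Proof. by case: IM => h _ _ _ _; apply: h. Qed.
Lemma pm_cov x y : I y -> cov x y -> I x.
Proof. by move=> Iy /cov_lt/ltW; apply: pm_le. Qed.
Lemma pm_in x : I x -> I (M x). Proof. by case: IM => _ h _ _ _; apply: h. Qed.
Lemma pmK x : I x -> M (M x) = x. Proof. by case: IM => _ _ h _ _; apply: h. Qed.
Lemma pm_tri x : I x -> [\/ cov x (M x), M x = x | cov (M x) x].
Proof. by case: IM => _ _ _ h _; apply: h. Qed.
Lemma pm_lift x y : I y -> cov x y -> M x <> y -> M x < M y.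
Proof. by case: IM => _ _ _ _ h; apply: h. Qed.

Lemma pm_rk x : I x -> [\/ rk (M x) = (rk x).+1, M x = x | rk x = (rk (M x)).+1].
Proof.
by move/pm_tri=> [/cov_rk e|e|/cov_rk e]; [constructor 1|constructor 2|constructor 3].
Qed.

Lemma pm_rk_le x : I x -> (rk (M x) <= (rk x).+1)%N.
Proof. by move/pm_rk=> [e|->|e]; lia. Qed.

Lemma pm_up x : I x -> rk (M x) = (rk x).+1 -> cov x (M x).
Proof. by move/pm_tri=> [//|->|/cov_rk]; lia. Qed.

Lemma pm_down x : I x -> rk x = (rk (M x)).+1 -> cov (M x) x.
Proof. by move/pm_tri=> [/cov_rk|->|//]; lia. Qed.

(** The coatoms of M x in terms of M on the coatoms of x: with the uniqueness of
    elements with given coatoms, this propagates information upwards. *)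
Lemma pm_coatoms x c : I x -> rk (M x) = (rk x).+1 ->
  cov c (M x) <-> c = x \/ exists y, [/\ cov y x, rk (M y) = (rk y).+1 & c = M y].
Proof.
move=> Ix up; have IMx := pm_in Ix; split=> [cMx|[->|[y [yx uy ->]]]].
- have [->|/eqP cx] := eqVneq c x; [by left|right].
  have Ic := pm_cov IMx cMx; have rc := cov_rk cMx.
  have ne : M c <> M x by move=> e; apply: cx; rewrite -(pmK Ic) e pmK.
  have lt := pm_lift IMx cMx ne; rewrite pmK // in lt; have rlt := lt_rk lt.
  have rMc : rk c = (rk (M c)).+1 by case: (pm_rk Ic) => e //; rewrite ?e in rlt; lia.
  exists (M c); split; last by rewrite pmK.
    by rewrite /cov lt; apply/eqP; lia.
  by rewrite pmK.
- exact: pm_up.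
- have Iy := pm_cov Ix yx; have ry := cov_rk yx.
  have ne : M y <> x by move=> e; move: up; rewrite -e pmK // e; lia.
  by rewrite /cov (pm_lift Ix yx ne); apply/eqP; lia.
Qed.

(** Otherwise x would be the only coatom of M x. *)
Lemma pm_not_up x : I x -> (2 <= rk x)%N ->
  (forall y, cov y x -> (rk (M y) <= rk y)%N) -> rk (M x) <> (rk x).+1.
Proof.
move=> Ix x2 h up.
have := @unique_coatom _ (M x) x (pm_up Ix up).
rewrite up => /(_ _) lt.
suff : ((rk x).+1 <= 2)%N by lia.
by apply: lt => c /(pm_coatoms _ Ix up)[//|[y [/h]]]; lia.
Qed.

End Theory.

(** A matching is determined by its restriction to the elements of rank at most
    one: coatoms propagate the information upwards. *)
Lemma pm_agree I M J N : pmatch I M -> pmatch J N ->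
  (forall x, I x -> J x -> (rk x <= 1)%N -> M x = N x) ->
  forall x, I x -> J x -> M x = N x.
Proof.
move=> IM JN base x; have [m] := ubnP (rk x); elim: m x => // m IH x ltm Ix Jx.
case: (leqP (rk x) 1) => [|x2]; first exact: base.
have IHc y : cov y x -> M y = N y.
  move=> yx; have Iy := pm_cov IM Ix yx; have Jy := pm_cov JN Jx yx.
  by apply: IH => //; have := cov_rk yx; lia.
have down I' J' M' N' : pmatch I' M' -> pmatch J' N' -> I' x -> J' x ->
    (forall y, cov y x -> M' y = N' y) -> cov (M' x) x -> M' x = N' x.
  move=> h1 h2 I'x J'x e c; have := e _ c; rewrite (pmK h1) // => e'.
  by rewrite [in RHS]e' (pmK h2 (pm_cov h2 J'x c)).
have fix_up I' J' M' N' : pmatch I' M' -> pmatch J' N' -> I' x -> J' x ->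
    (forall y, cov y x -> M' y = N' y) -> cov x (M' x) -> N' x <> x.
  move=> h1 h2 I'x J'x e c fx; apply: (pm_not_up h1 I'x x2); last exact: cov_rk.
  move=> y yx; rewrite e //; have := pm_lift h2 J'x yx; rewrite fx.
  have ry := cov_rk yx; have := pm_rk_le h2 (pm_cov h2 J'x yx).
  have [e'|/eqP ne _ /(_ ne)/lt_rk] := eqVneq (N' y) x; last by lia.
  by move: (pmK h2 (pm_cov h2 J'x yx)); rewrite e' fx => e''; rewrite e'' in ry; lia.
have IHc' y : cov y x -> N y = M y by move/IHc.
case: (pm_tri IM Ix) => [uM|fM|dM]; last exact: (down I J).
  case: (pm_tri JN Jx) => [uN|fN|dN]; last by apply/esym/(down J I).
    apply: coatoms_inj; first by rewrite (cov_rk uM); lia.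
    move=> c; rewrite (pm_coatoms IM _ Ix (cov_rk uM)) (pm_coatoms JN _ Jx (cov_rk uN)).
    split=> -[->|[y [yx uy ->]]]; [by left|right|by left|right]; exists y.
      by rewrite -(IHc y).
    by rewrite (IHc y).
  by case: (fix_up I J M N).
case: (pm_tri JN Jx) => [uN|fN|dN]; last by apply/esym/(down J I).
  by case: (fix_up J I N M).
by rewrite fM fN.
Qed.

(** Commutation of a matching with a globally defined matching N also only has
    to be checked in rank at most one. It is stated at the elements that N does
    not move upwards, so as to remain in the domain of M. *)
Lemma pm_commute I M N : pmatch I M -> pmatch (fun _ => True) N ->
  (forall x, I x -> (rk x <= 1)%N -> (rk (N x) <= rk x)%N -> M (N x) = N (M x)) ->
  forall x, I x -> (rk (N x) <= rk x)%N -> M (N x) = N (M x).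
Proof.
move=> IM TN base x; have [m] := ubnP (rk x); elim: m x => // m IH x ltm Ix.
case: (leqP (rk x) 1) => [|x2]; first exact: base.
have NK y : N (N y) = y by exact: (pmK TN).
have liftN y z : cov y z -> N y <> z -> N y < N z by exact: (pm_lift TN).
have liftM y z : I z -> cov y z -> M y <> z -> M y < M z by exact: (pm_lift IM).
have rN y : [\/ rk (N y) = (rk y).+1, N y = y | rk y = (rk (N y)).+1].
  exact: (pm_rk TN).
have rN_le y : (rk (N y) <= (rk y).+1)%N by exact: (pm_rk_le TN).
have Ilt y : y < x -> I y by move/ltW; apply: (pm_le IM).
have IHx y : y < x -> (rk (N y) <= rk y)%N -> M (N y) = N (M y).
  by move=> yx; apply: IH; [have := lt_rk yx; lia|exact: Ilt].
have MK y : I y -> M (M y) = y by exact: (pmK IM).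
have belowN y : y < x -> (rk (N y) <= rk y)%N -> I (N y).
  move=> yx; case: (rN y) => [|->|down] le; [lia|exact: Ilt|].
  exact: Ilt (lt_trans (cov_lt (pm_down TN _ down)) yx).
have IMx := pm_in IM Ix; have MKx := MK x Ix.
case: (rN x) => [->|fx _|dx _]; first by lia.
- have downN c : cov c x -> N c < x.
    move=> cx; have [e|/eqP ne] := eqVneq (N c) x; last by rewrite -fx; apply: liftN.
    by have := cov_rk cx; rewrite -(NK c) e fx; lia.
  have fixN c : cov c x -> (rk (N c) <= rk c)%N.
    by move=> cx; have := cov_rk cx; have := lt_rk (downN c cx); lia.
  rewrite fx; case: (pm_tri IM Ix) => [uM|->|dM]; last 2 first.
  + by rewrite fx.
  + have := IHx _ (cov_lt dM) (fixN _ dM); rewrite MKx fx => e.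
    by rewrite -[RHS](MK _ (Ilt _ (downN _ dM))) e.
  have rM := cov_rk uM.
  case: (rN (M x)) => [up|//|down].
    case: (pm_not_up TN _ _ _ up) => //; first by lia.
    move=> c /(pm_coatoms IM _ Ix rM)[->|[d [dx ud ->]]]; first by rewrite fx.
    rewrite -(IHx _ (cov_lt dx) (fixN _ dx)).
    by have := pm_rk_le IM (Ilt _ (downN _ dx)); have := fixN _ dx; lia.
  have cN : cov (N (M x)) (M x) by exact: (pm_down TN).
  case/(pm_coatoms IM _ Ix rM): cN => [e|[d [dx ud e]]].
    by move: rM; rewrite -(NK (M x)) e fx; lia.
  have e2 : N (M d) = M x by rewrite -e NK.
  have e3 : N d = x.
    by rewrite -[LHS](MK _ (Ilt _ (downN _ dx))) (IHx _ (cov_lt dx) (fixN _ dx)) e2.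
  by have := lt_rk (downN _ dx); rewrite e3; lia.
have cyx : cov (N x) x by exact: (pm_down TN).
have [y yE] : {y | y = N x} by exists (N x).
have Ny : N y = x by rewrite yE NK.
rewrite -yE in cyx dx *.
have Iy := Ilt y (cov_lt cyx); have ry := cov_rk cyx.
have MKy := MK y Iy.
(* y is not matched downwards by M when x is not *)
have not_down : rk x <> (rk (M x)).+1 -> rk y <> (rk (M y)).+1.
  move=> nx dy; have zy := pm_down IM Iy dy; have rz := cov_rk zy.
  have zx := lt_trans (cov_lt zy) (cov_lt cyx).
  have neM : M x <> y by move=> e; apply: nx; rewrite e.
  case: (rN (M y)) => [up|fz|down].
  - have ne : N (M y) <> y.
      by move=> e; have := NK (M y); rewrite e Ny => e'; rewrite -e' in rz; lia.
    have lt : N (M y) < x by rewrite -Ny; apply: liftN.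
    have := IHx _ lt; rewrite NK MKy => /(_ ltac:(lia)) e.
    have e1 : M (N (M y)) = x by rewrite -Ny [in RHS]e NK.
    have := MK _ (Ilt _ lt); rewrite e1 => e2.
    by move: neM nx; rewrite e2 up; lia.
  - have := IHx _ zx; rewrite fz => /(_ (leqnn _)); rewrite MKy Ny => e.
    by move: ry; rewrite e; lia.
  - have := IHx _ zx; rewrite MKy Ny => /(_ ltac:(lia)) e.
    have Inz : I (N (M y)).
      apply: Ilt; apply: le_lt; last by lia.
      apply: ltW; apply: lt_trans zx; exact: cov_lt (pm_down TN _ down).
    by have := pm_rk_le IM Inz; rewrite e; lia.
case: (pm_tri IM Ix) => [uM|fM|dM].
- have rM := cov_rk uM.
  have ne : M y <> x by move=> e; move: rM ry; rewrite -e MKy; lia.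
  have lt := liftM _ _ Ix cyx ne.
  have lowN c : cov c x -> c <> y -> cov (N c) y.
    move=> cx cy; have nec : N c <> x by move=> e; apply: cy; rewrite -(NK c) e yE.
    have := liftN _ _ cx nec; rewrite -yE => lt'; rewrite /cov lt'.
    have := cov_rk cx; have := lt_rk lt'; have := rN c; have := rN_le (N c); rewrite NK.
    by move=> ? ? ? ?; apply/eqP; lia.
  case: (pm_tri IM Iy) => [uy|fy|dy].
  + have ry' := cov_rk uy; have IMy := pm_in IM Iy.
    have neN : N y <> M y by rewrite Ny => e; apply: ne.
    have ltN := liftN _ _ uy neN; rewrite Ny in ltN.
    have rN1 : rk (N (M y)) = (rk (M y)).+1.
      by have := rN_le (M y); have := lt_rk ltN; lia.
    suff : M x = N (M y) by move=> ->; rewrite NK.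
    apply: coatoms_inj; first by lia.
    move=> c; rewrite (pm_coatoms IM _ Ix rM) (pm_coatoms TN _ _ rN1) //.
    split=> [[->|[c' [cx uc ->]]]|[->|[d [dMy ud ->]]]].
    * by right; exists y; rewrite Ny.
    * have [->|/eqP cy] := eqVneq c' y; [by left|right].
      have dy := lowN _ cx cy; have rd := cov_rk dy; have rc := cov_rk cx.
      have {}e : M (N c') = N (M c') by apply: (IHx _ (cov_lt cx)); lia.
      have Id := Ilt _ (lt_trans (cov_lt dy) (cov_lt cyx)).
      have rd1 : rk (M (N c')) = (rk (N c')).+1.
        have := pm_rk_le IM Id; have := rN_le (N (M c')); rewrite NK e; lia.
      exists (M (N c')); split.
      - by apply/(pm_coatoms IM _ Iy ry'); right; exists (N c').
      - by rewrite e NK uc -e rd1; lia.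
      - by rewrite e NK.
    * by right; exists y.
    * case/(pm_coatoms IM _ Iy ry'): dMy => [dy|[d' [dy' ud' dE]]].
        by left; rewrite dy.
      rewrite -dE in ud'; right; have rd' := cov_rk dy'.
      have d'x := lt_trans (cov_lt dy') (cov_lt cyx).
      have upd' : rk (N d') = (rk d').+1.
        case: (leqP (rk (N d')) (rk d')) => h; last by have := rN_le d'; lia.
        have := pm_rk_le IM (belowN _ d'x h); rewrite (IHx _ d'x h) -dE ud; lia.
      have ne' : N d' <> y.
        by move=> e; have := NK d'; rewrite e Ny => e'; rewrite -e' in rd'; lia.
      have lt' : N d' < x by rewrite -Ny; apply: liftN.
      have e : M (N d') = N d.
        have := IHx _ lt'; rewrite NK => /(_ ltac:(lia)).
        by rewrite dE => ->; rewrite NK.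
      by exists (N d'); split=> //; [rewrite /cov lt'; apply/eqP; lia|rewrite e ud; lia].
  + case: (pm_not_up IM Ix x2 _ rM) => c cx.
    have [->|/eqP cy] := eqVneq c y; first by rewrite fy.
    rewrite leqNgt; apply/negP => uc.
    have dy := lowN _ cx cy; have rd := cov_rk dy; have rc := cov_rk cx.
    have e : M (N c) = N (M c) by apply: (IHx _ (cov_lt cx)); lia.
    have Id := Ilt _ (lt_trans (cov_lt dy) (cov_lt cyx)).
    have ned : M (N c) <> y.
      by move=> e'; have := MK _ Id; rewrite e' fy => e2; rewrite -e2 in rd; lia.
    have := lt_rk (liftM _ _ Iy dy ned); rewrite fy.
    by have := rN_le (N (M c)); rewrite NK -e; lia.
  + by case: (not_down _ (cov_rk dy)); lia.
- rewrite fM -yE; case: (pm_tri IM Iy) => [uy|//|dy].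
    have ne : M y <> x.
      by move=> e; have := MKy; rewrite e fM => e'; rewrite -e' in ry; lia.
    by have := lt_rk (liftM _ _ Ix cyx ne); rewrite fM (cov_rk uy); lia.
  by case: (not_down _ (cov_rk dy)); rewrite fM; lia.
- have [e|/eqP ne] := eqVneq (M x) y; first by rewrite e Ny -e MKx.
  have rd := cov_rk dM.
  have ne' : N (M x) <> x by move=> e; apply: ne; rewrite -[LHS]NK e yE.
  have lt := liftN _ _ dM ne'; rewrite -yE in lt.
  have := IHx _ (cov_lt dM); rewrite MKx -yE => /(_ ltac:(have := lt_rk lt; lia)) e.
  by rewrite -e MK //; apply: Ilt; apply: lt_trans lt (cov_lt cyx).
Qed.

End Matchings.

(** * Elements of rank one and two *)

Section Atoms.
Variable n : nat.
Local Notation N := (n.*2).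
Local Notation one := (twisted_one n).
Local Notation mid := (n.-1).
Implicit Types (x y z w c d g : twisted n) (i j k s : nat).
Local Open Scope order_scope.

(** The index of the generator theta(s_k). *)
Definition rev k := (N.-1 - k.+1)%N.

Lemma star_asc x k : (k.+1 < N)%N -> (arc x k < arc x k.+1)%N -> des x k.
Proof. by move=> kN h; rewrite /des [X in (_ < X)%N](rk_asc kN h). Qed.

Lemma star_one_mid : one ** mid = one.
Proof.
case: (boolP (mid.+1 < N)%N) => kN; last exact: star_out.
by apply: star_fix => //; rewrite arc_one; lia.
Qed.

Lemma star_one_up k : (k.+1 < N)%N -> k <> mid -> rk (one ** k) = 1%N.
Proof. by move=> kN km; rewrite rk_desc ?rk_one // !arc_one; lia. Qed.

Lemma star_one_rev k : (k.+1 < N)%N -> one ** rev k = one ** k.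
Proof.
move=> kN; have rN : ((rev k).+1 < N)%N by rewrite /rev; lia.
apply: arc_ext => p pN; rewrite !arc_star //.
have s1 : (sw k p < N)%N by case: swP; lia.
have s2 : (sw (rev k) p < N)%N by case: swP; rewrite /rev; lia.
rewrite !arc_one //; rewrite /rev in s2 *.
by case: (swP k p); case: (swP (N.-1 - k.+1) p) => *; case: swP; case: swP; lia.
Qed.

(** The mirror images k and rev k act equally on the minimum, whence the
    restriction on j. *)
Lemma atomP x : rk x = 1%N -> exists2 j, (j < mid)%N & x = one ** j.
Proof.
move=> x1; have [|k dk] := @des_ex _ x; first by move=> e; rewrite e rk_one in x1.
have e : x ** k = one by apply: rk0; have := des_rk dk; lia.
have xE : x = one ** k by rewrite -e starK.
have kN := des_ok dk.
have km : k <> mid by move=> km; rewrite xE km star_one_mid rk_one in x1.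
case: (ltnP k mid) => h; first by exists k.
by exists (rev k); [rewrite /rev; lia|rewrite star_one_rev].
Qed.

Lemma rk_atom j : (j < mid)%N -> rk (one ** j) = 1%N.
Proof. by move=> jm; apply: star_one_up; lia. Qed.

Lemma atom_des j k : (j < mid)%N -> des (one ** j) k -> k = j \/ k = rev j.
Proof.
move=> jm dk; have e : one ** j ** k = one.
  by apply: rk0; have := des_rk dk; rewrite rk_atom //; lia.
have [->|/eqP kj] := eqVneq k j; first by left.
have dj : des (one ** j) j by rewrite /des starK rk_one rk_atom.
right; have e' : one ** j ** j = one ** j ** k by rewrite starK e.
have [] := star_coincide dj e' (not_eq_sym kj).
have jN : (j.+1 < N)%N by lia.
rewrite arc_star // sw_l arc_one //; case: swP; rewrite /rev; lia.
Qed.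

Lemma atom_inj i j : (i < mid)%N -> (j < mid)%N -> one ** i = one ** j -> i = j.
Proof.
move=> im jm e; have : des (one ** i) j by rewrite e /des starK rk_one rk_atom.
by case/(atom_des im) => [->//|]; rewrite /rev; lia.
Qed.

Lemma atoms_far_rev i j : (i < mid)%N -> (j < mid)%N -> i <> j ->
  one ** i ** rev j = one ** j ** i.
Proof.
move=> im jm ij; rewrite star_far ?star_one_rev //; first by lia.
by rewrite /far /rev; lia.
Qed.

(** A descent of g is a descent of at most one of the two atoms, and it sends
    the other one to g. *)
Lemma rank2P g i j : (i < mid)%N -> (j < mid)%N -> i <> j -> rk g = 2%N ->
  one ** i <= g -> one ** j <= g -> g = one ** i ** j \/ g = one ** j ** i.
Proof.
move=> im jm ij g2 ig jg.
have [|s ds] := @des_ex _ g; first by move=> e; rewrite e rk_one in g2.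
have rs := des_rk ds.
have below k : (k < mid)%N -> one ** k <= g -> ~~ des (one ** k) s -> g = one ** k ** s.
  move=> km kg nd; rewrite -[LHS](starK g s); congr (_ ** s); apply/esym/le_eq_rk.
    exact: leM1.
  by rewrite rk_atom //; lia.
have [di|ni] := boolP (des (one ** i) s).
  have nj : ~~ des (one ** j) s.
    apply/negP => /(atom_des jm); have := atom_des im di; rewrite /rev; lia.
  rewrite (below j) //; case: (atom_des im di) => ->; first by right.
  by left; rewrite atoms_far_rev //; apply: not_eq_sym.
have [dj|nj] := boolP (des (one ** j) s).
  rewrite (below i) //; case: (atom_des jm dj) => ->; first by left.
  by right; rewrite atoms_far_rev.
by case: ij; apply: atom_inj => //; apply: (@star_inj _ s); rewrite -!below.
Qed.

Lemma star_mid_far i : (i.+1 < mid)%N -> one ** i ** mid = one ** i.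
Proof. by move=> im; rewrite star_far ?star_one_mid // /far im. Qed.

Lemma adj_atom_up j k : (j < mid)%N -> adj j k -> (k.+1 < N)%N ->
  rk (one ** j ** k) = 2%N.
Proof.
move=> jm jk kN; have jN : (j.+1 < N)%N by lia.
have kj : adj k j by rewrite adjC.
have nd : ~~ des one k by rewrite /des rk_one.
have up : rk (one ** j) = (rk one).+1 by rewrite rk_one rk_atom.
by rewrite (up2 kj kN jN nd up) up rk_one.
Qed.

Lemma atom_fixed j k : (j < mid)%N -> (k.+1 < N)%N -> one ** j ** k = one ** j ->
  k = mid /\ (j.+1 < mid)%N.
Proof.
move=> jm kN e.
have kj : k <> j by move=> kj; have := rk_atom jm; rewrite -e kj starK rk_one.
have [jk|jk] := boolP (far j k); last first.
  have jk' : adj j k by move: jk kj; rewrite /far /adj; lia.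
  by have := adj_atom_up jm jk' kN; rewrite e rk_atom.
have : one ** k = one by apply: (@star_inj _ j); rewrite -star_far.
have [km _|/eqP km e'] := eqVneq k mid; last by have := star_one_up kN km; rewrite e' rk_one.
by split=> //; move: jk; rewrite /far; lia.
Qed.

(** A generator other than the middle one that moves the atom upwards provides
    a second coatom, namely its own atom. *)
Lemma rank2_unique g j : (j < mid)%N -> rk g = 2%N ->
  (forall c, cov c g -> c = one ** j) -> j.+1 = mid /\ g = one ** j ** mid.
Proof.
move=> jm g2 un.
have [|s ds] := @des_ex _ g; first by move=> e; rewrite e rk_one in g2.
have sN := des_ok ds; have e := un _ (cov_des ds).
have gE : g = one ** j ** s by rewrite -e starK.
have sj : s <> j by move=> sj; rewrite gE sj starK rk_one in g2.
have notcov k : (k.+1 < N)%N -> rk (one ** k) = 1%N -> one ** k < g -> one ** k = one ** j.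
  by move=> kN k1 lt; apply: un; rewrite /cov lt k1 g2.
have [fjs|fjs] := boolP (far j s).
  rewrite star_far // in gE.
  have [sm|/eqP sm] := eqVneq s mid; first by rewrite gE sm star_one_mid rk_atom in g2.
  have s1 := star_one_up sN sm.
  have lt : one ** s < g.
    by rewrite gE; apply: star_gt; rewrite -gE g2 s1.
  by rewrite gE (notcov s) // starK rk_one in g2.
have js : adj j s by move: fjs; rewrite /far /adj; lia.
have jN : (j.+1 < N)%N by lia.
have [sm|/eqP sm] := eqVneq s mid; last first.
  have s1 := star_one_up sN sm.
  have c1 : cov one (one ** j) by apply: cov_star; rewrite rk_one rk_atom.
  have ne : one ** s <> one ** j by apply: star_adj => //; rewrite adjC.
  by case: (ne); apply: notcov => //; rewrite gE; apply: lift c1 ne.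
by rewrite gE sm; split=> //; move: js; rewrite sm /adj; lia.
Qed.

End Atoms.

(** * The symmetry of the Coxeter graph *)

Section Flip.
Variable n : nat.
Local Notation N := (n.*2).
Local Notation one := (twisted_one n).
Implicit Types (x y z w : twisted n) (k : nat) (M : twisted n -> twisted n).

Lemma flip_subproof x : theta (val x) \in iota_set n.
Proof.
have [w _ xE] := imsetP (valP x); apply/imsetP; exists (theta w); first by rewrite inE.
rewrite [val x]xE thetaM; congr (_ * _)%g; congr theta.
have w0V : (w0 n)^-1%g = w0 n by rewrite -[LHS]mulg1 -(w0_mul n) mulKg.
by rewrite /theta !invMg w0V mulgA.
Qed.

(** The automorphism theta itself, which exchanges the generators k and rev k. *)
Definition flip x : twisted n :=
  exist (fun v => v \in iota_set n) _ (flip_subproof x).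

Lemma arc_flip x p : (p < N)%N -> arc (flip x) p = (N.-1 - arc x (N.-1 - p))%N.
Proof.
move=> pN; rewrite -pv_val //.
have -> : arc (flip x) p = pv (w0 n) (pv (val x) p).
  by rewrite -pvM; congr (pv _ p); rewrite /= /theta !mulgA w0_mul mul1g.
by rewrite pv_w0 // pv_lt.
Qed.

Lemma flipK x : flip (flip x) = x.
Proof.
apply: arc_ext => p pN; rewrite !arc_flip //; last by lia.
have -> : (N.-1 - (N.-1 - p) = p)%N by lia.
by have := arc_lt x pN; lia.
Qed.

Lemma flip_one : flip one = one.
Proof. by apply: arc_ext => p pN; rewrite arc_flip // !arc_one; lia. Qed.

Lemma flip_star x k : (k.+1 < N)%N -> flip (x ** k) = flip x ** rev n k.
Proof.
move=> kN; have rN : ((rev n k).+1 < N)%N by rewrite /rev; lia.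
apply: arc_ext => p pN; rewrite arc_flip // !arc_star // arc_flip; last first.
  by case: swP; lia.
have -> : (N.-1 - sw (rev n k) p = sw k (N.-1 - p))%N.
  by rewrite /rev; case: swP; case: swP; lia.
have aN : (arc x (sw k (N.-1 - p)) < N)%N by apply: arc_lt; case: swP; lia.
move: (arc x _) aN => a aN.
by rewrite /rev; case: (swP k a); case: swP; lia.
Qed.

Lemma des_flip x k : des x k -> des (flip x) (rev n k).
Proof.
move=> /des_asc[kN asc]; have rN : ((rev n k).+1 < N)%N by rewrite /rev; lia.
apply: star_asc => //; rewrite !arc_flip //; last by lia.
rewrite /rev; have -> : (N.-1 - (N.-1 - k.+1) = k.+1)%N by lia.
have -> : (N.-1 - (N.-1 - k.+1).+1 = k)%N by lia.
by have := arc_lt x kN; lia.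
Qed.

Lemma rev_rev k : (k.+1 < N)%N -> rev n (rev n k) = k.
Proof. by rewrite /rev; lia. Qed.

Lemma desN_flip x k : (k.+1 < N)%N -> ~~ des x k -> ~~ des (flip x) (rev n k).
Proof. by move=> kN; apply: contra => /des_flip; rewrite flipK rev_rev. Qed.

Lemma rk_flip x : rk (flip x) = rk x.
Proof.
have [m] := ubnP (rk x); elim: m x => // m IH x ltm.
have [->|/eqP/des_ex[k dk]] := eqVneq x one; first by rewrite flip_one.
have := des_rk dk; rewrite (des_rk (des_flip dk)) -flip_star ?(des_ok dk) // => e.
by rewrite IH //; lia.
Qed.

Lemma le_flip x y : (x <= y)%O -> (flip x <= flip y)%O.
Proof.
have [m] := ubnP (rk y); elim: m x y => // m IH x y ltm xy.
have [y1|/eqP/des_ex[k dy]] := eqVneq y one.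
  by rewrite (_ : x = y) //; apply: le_eq_rk; rewrite // y1 rk_one.
have kN := des_ok dy; have ltm' : (rk (y ** k) < m)%N by have := des_rk dy; lia.
have dfy := desN_flip kN (desN_star dy).
have [dx|dx] := boolP (des x k).
  have := IH _ _ ltm' (leM2 xy dy dx).
  have dfx := desN_flip kN (desN_star dx).
  by move=> /leM3/(_ dfy dfx); rewrite -!flip_star // !starK.
apply: le_trans (IH _ _ ltm' (leM1 xy dy dx)) _.
by rewrite flip_star //; apply: star_le; apply: des_flip.
Qed.

Lemma lt_flip x y : (x < y)%O -> (flip x < flip y)%O.
Proof. by move=> xy; apply: le_lt (le_flip (ltW xy)) _; rewrite !rk_flip lt_rk. Qed.

Lemma cov_flip x y : cov x y -> cov (flip x) (flip y).
Proof. by case/andP=> xy e; rewrite /cov lt_flip // !rk_flip. Qed.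

Lemma spm_flip w M : special_partial_matching w M ->
  special_partial_matching (flip w) (fun x => flip (M (flip x))).
Proof.
have dual x y : (x <= flip y)%O -> (flip x <= y)%O by move/le_flip; rewrite flipK.
case=> h1 h2 h3 h4 h5; split.
- by move=> x /dual xw; apply/le_flip/h1.
- by move=> x /dual xw; rewrite flipK h2 // flipK.
- by apply/coversP/cov_flip; rewrite flipK; apply/coversP.
- move=> x /dual/h4[/coversP/cov_flip|e|/coversP/cov_flip]; rewrite ?flipK => *.
  + by constructor 1; apply/coversP.
  + by constructor 2; rewrite e flipK.
  + by constructor 3; apply/coversP.
- move=> x y /dual xw /dual yw /coversP/cov_flip/coversP xy ne.
  by apply/lt_flip/h5 => // e; apply: ne; rewrite e flipK.
Qed.

End Flip.

(** * Counting in rank matrices *)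

Lemma rmat_full f i j : (forall q, q < i -> j <= f q) -> rmat f i j = i.
Proof.
elim: i => [|i IH] h; first by rewrite rmat0.
by rewrite rmatS IH => [|q qi]; [have := h i (ltnSn i); lia|apply: h; lia].
Qed.

Lemma rmat_le f i j : rmat f i j <= i.
Proof. by elim: i => [|i IH]; rewrite ?rmat0 // rmatS; lia. Qed.

Lemma rmat_all f m j : rmat f m j = m -> forall q, q < m -> j <= f q.
Proof.
elim: m => // m IH; rewrite rmatS => e q.
have le := rmat_le f m j.
rewrite ltnS leq_eqVlt => /predU1P[->|qm]; first by lia.
by apply: IH => //; lia.
Qed.

Lemma rmat_one f m j : (rmat f m j).+1 = m ->
  exists p, [/\ p < m, f p < j & forall q, q < m -> q <> p -> j <= f q].
Proof.
elim: m => // m IH; rewrite rmatS; case: (leqP j (f m)) => fm e.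
  have [|p [pm fp hp]] := IH; first by lia.
  exists p; split=> // [|q]; first by lia.
  by rewrite ltnS leq_eqVlt => /predU1P[->//|]; apply: hp.
exists m; split=> // q; rewrite ltnS leq_eqVlt => /predU1P[->//|qm] _.
by apply: (@rmat_all f m j) => //; lia.
Qed.

Lemma rmat_two f m j : (rmat f m j).+2 = m ->
  exists p p', [/\ p < p' < m, f p < j, f p' < j
                 & forall q, q < m -> q <> p -> q <> p' -> j <= f q].
Proof.
elim: m => // m IH; rewrite rmatS; case: (leqP j (f m)) => fm e.
  have [|p [p' [pm fp fp' hp]]] := IH; first by lia.
  exists p, p'; split=> // [|q]; first by lia.
  by rewrite ltnS leq_eqVlt => /predU1P[->//|]; apply: hp.
have [|p [pm fp hp]] := @rmat_one f m j; first by lia.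
exists p, m; split=> // [|q]; first by lia.
by rewrite ltnS leq_eqVlt => /predU1P[->//|qm] qp _; apply: hp.
Qed.

Lemma rmat_total N f j : fpf N f -> j <= N -> rmat f N j = N - j.
Proof.
move=> ff jN; have e : forall j', j' <= N -> rmat f j' N = 0.
  elim=> [|j' IH] jN'; rewrite ?rmat0 // rmatS IH; last by lia.
  by case: (ff j' jN'); lia.
by have := rmat_sym ff (leqnn N) jN; rewrite e //; lia.
Qed.

Lemma rmat_j1 N f i j : fpf N f -> i <= N -> j < N -> rmat f i j <= (rmat f i j.+1).+1.
Proof.
move=> ff iN jN; have := rmat_sym ff iN (ltnW jN); have := rmat_sym ff iN jN.
by rewrite rmatS; lia.
Qed.

(** * Two elements of rank three without common upper cover *)

Section Mixed.
Variables (n h : nat).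
Local Notation N := (n.*2).
Local Notation one := (twisted_one n).
Local Notation mid := (n.-1).
(* The matching under study sends the minimum to the atom of h+1. On the atom of
   h it acts from the left and on the atom of h+2 from the right, so that it is
   not a multiplication by a generator. The letters A, B, C stand for h, h+1 and
   h+2 in products. *)
Hypothesis hm : h.+2 < mid.
Implicit Types (x y z w c d g : twisted n) (j k s : nat).

(** A step up from x stays below w as soon as a few entries of row k+1 allow it,
    those of the column following by symmetry. *)
Lemma lem_step x w k : k.+1 < N -> k.+1 < arc x k.+1 ->
  (forall j, arc x k.+1 < j -> j <= arc x k -> rmat (arc w) k.+1 j <= rmat (arc x) k j) ->
  lem x w -> lem (x ** k) w.
Proof.
move=> kN kx hj xw; have aN := arc_lt x (ltnW kN).
have row j : j <= N -> j != k.+1 -> rmat (arc w) k.+1 j <= rmat (arc (x ** k)) k.+1 j.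
  move=> jN jk; have -> : rmat (arc (x ** k)) k.+1 j = rmat (cj k (arc x)) k.+1 j.
    by apply: eq_rmat => p _; rewrite arc_star.
  rewrite rmat_cj_row //; have := xw k.+1 j (ltnW kN) jN; rewrite !rmatS.
  case: (leqP j (arc x k.+1)) => h1; first by lia.
  case: (leqP j (arc x k)) => h2; last by lia.
  by have := hj j h1 h2; rewrite rmatS; lia.
have ff := arc_fpf (x ** k); have gg := arc_fpf w.
have col i : i <= N -> i != k.+1 -> rmat (arc w) i k.+1 <= rmat (arc (x ** k)) i k.+1.
  move=> iN ik; have := row i iN ik.
  by have := rmat_sym ff iN (ltnW kN); have := rmat_sym gg iN (ltnW kN); lia.
move=> i j iN jN; have [->|ik] := eqVneq i k.+1; last first.
  by have [->|jk] := eqVneq j k.+1; [exact: col|rewrite lem_off //; exact: xw].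
have [->|jk] := eqVneq j k.+1; last exact: row.
have := col k ltac:(lia) ltac:(lia); rewrite !rmatS.
have -> : arc (x ** k) k = arc x k.+1.
  by rewrite arc_star // sw_l; case: swP; lia.
by lia.
Qed.

Local Notation A := (one ** h).
Local Notation AB := (one ** h ** h.+1).
Local Notation F := (one ** h ** h.+1 ** h.+2).
Local Notation F' := (one ** h.+2 ** h.+1 ** h).
Local Notation C := (one ** h.+2).

Ltac sw_cases := (repeat match goal with |- context [sw ?k ?q] =>
  lazymatch q with context [sw] => fail | context [arc] => fail
  | _ => case: (swP k q) => *; try lia end end); try lia.

Lemma arcA q : q <= h.+3 -> arc A q = N.-1 - sw h q.
Proof. by move=> qh; rewrite arc_star ?arc_one; sw_cases. Qed.

Lemma arcAB q : q <= h.+3 -> arc AB q = N.-1 - sw h (sw h.+1 q).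
Proof.
move=> qh; rewrite arc_star; last by lia.
rewrite arcA; last by sw_cases.
by sw_cases.
Qed.

Lemma arcC q : q <= h.+3 -> arc C q = N.-1 - sw h.+2 q.
Proof. by move=> qh; rewrite arc_star ?arc_one; sw_cases. Qed.

Lemma arcF p : p < N -> arc F p =
  if (h <= p) && (p <= h.+2) then N.-2 - p else if p == h.+3 then N.-1 - h else
  if (N <= p + h.+4) && (p + h.+2 <= N) then N.-2 - p else
  if p == N.-1 - h then h.+3 else N.-1 - p.
Proof.
move=> pN; rewrite !arc_star; try lia.
rewrite arc_one; last by sw_cases.
by sw_cases; repeat (case: ifP => *; try lia).
Qed.

Lemma arcF' p : p < N -> arc F' p =
  if (h.+1 <= p) && (p <= h.+3) then N - p else if p == h then N - h.+4 else
  if (N <= p + h.+3) && (p + h.+1 <= N) then N - p else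
  if p == N - h.+4 then h else N.-1 - p.
Proof.
move=> pN; rewrite !arc_star; try lia.
rewrite arc_one; last by sw_cases.
by sw_cases; repeat (case: ifP => *; try lia).
Qed.

Lemma arcCB q : q <= h.+3 -> arc (C ** h.+1) q = N.-1 - sw h.+2 (sw h.+1 q).
Proof.
move=> qh; rewrite arc_star; last by lia.
rewrite arcC; last by sw_cases.
by sw_cases.
Qed.

Lemma rk_AB : rk AB = 2.
Proof. by apply: adj_atom_up; rewrite /adj ?eqxx; lia. Qed.

Lemma rk_F : rk F = 3.
Proof.
have e2 : arc AB h.+2 = N.-1 - h by rewrite arcAB; sw_cases.
have e3 : arc AB h.+3 = N.-1 - h.+3 by rewrite arcAB; sw_cases.
by rewrite rk_desc ?rk_AB // ?e2 ?e3; lia.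
Qed.

Lemma rk_F' : rk F' = 3.
Proof.
have e2 : rk (C ** h.+1) = 2 by apply: adj_atom_up; rewrite /adj ?eqxx ?orbT; lia.
have e3 : arc (C ** h.+1) h = N.-1 - h by rewrite arcCB; sw_cases.
have e4 : arc (C ** h.+1) h.+1 = N.-1 - h.+3 by rewrite arcCB; sw_cases.
by rewrite rk_desc ?e2 // ?e3 ?e4; lia.
Qed.

(** The two properties alpha and beta hold above F and F' respectively, and
    alpha characterizes the elements above F. Multiples of F' and F by one
    generator do not have them. *)
Definition alpha x := exists t, [/\ N.-1 - h <= t, t < N & h.+3 <= arc x t].
Definition beta x := exists q, q <= h /\ arc x q < N.-1 - h.+2.

Lemma rmat_alphaN x : ~ alpha x -> rmat (arc x) h.+3 (N.-1 - h) = h.+1.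
Proof.
move=> na; have tot : rmat (arc x) N (N.-1 - h) = h.+1.
  by rewrite (rmat_total (arc_fpf x)); lia.
have hN : h.+3 <= N by lia.
have up : forall p, h.+3 <= p -> p < N -> arc x p < N.-1 - h.
  move=> p hp pN; rewrite ltnNge; apply/negP => le; apply: na.
  by exists (arc x p); rewrite arcK //; split=> //; apply: arc_lt.
have : forall m, h.+3 <= m -> m <= N -> rmat (arc x) h.+3 (N.-1 - h) = rmat (arc x) m (N.-1 - h).
  elim=> // m IH; rewrite leq_eqVlt => /predU1P[<-//|hm'] mN.
  by rewrite [RHS]rmatS -(IH hm' (ltnW mN)); have := up m hm' mN; lia.
by move=> e; rewrite (e N).
Qed.

Lemma rmat_alpha x : alpha x -> rmat (arc x) h.+3 (N.-1 - h) <= h.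
Proof.
case=> t [tl tN le]; have pN := arc_lt x tN.
have tot : rmat (arc x) N (N.-1 - h) = h.+1.
  by rewrite (rmat_total (arc_fpf x)); lia.
have : rmat (arc x) (arc x t).+1 (N.-1 - h) <= h.+1.
  by apply: leq_trans (_ : _ <= rmat (arc x) N (N.-1 - h)) _; [apply: rmat_mono|rewrite tot].
rewrite rmatS arcK // tl addn1 ltnS; apply: leq_trans.
by apply: rmat_mono.
Qed.

Lemma rmat_F : rmat (arc F) h.+3 (N.-1 - h) <= h.
Proof.
rewrite !rmatS !arcF; try lia.
by have := rmat_le (arc F) h (N.-1 - h); repeat (case: ifP => *; try lia).
Qed.

Lemma rmat_F' : rmat (arc F') h.+1 (N.-1 - h.+2) <= h.
Proof.
rewrite !rmatS !arcF'; try lia.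
by have := rmat_le (arc F') h (N.-1 - h.+2); repeat (case: ifP => *; try lia).
Qed.

Lemma le_F_alpha x : (F <= x)%O -> alpha x.
Proof.
move=> /le_lem Fx; apply: contrapT => /rmat_alphaN.
by have := Fx h.+3 (N.-1 - h) ltac:(lia) ltac:(lia); have := rmat_F; lia.
Qed.

Lemma le_F'_beta x : (F' <= x)%O -> beta x.
Proof.
move=> /le_lem Fx; apply: contrapT => nb.
have := Fx h.+1 (N.-1 - h.+2) ltac:(lia) ltac:(lia); have := rmat_F'.
rewrite [X in _ -> X <= _ -> _]rmat_full; first by lia.
by move=> q qh; rewrite leqNgt; apply/negP => lt; apply: nb; exists q.
Qed.

(** F is reached from the minimum by three steps up, each of which stays below
    x by lem_step. *)
Lemma alpha_le_F x : alpha x -> (F <= x)%O.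
Proof.
move=> /rmat_alpha ax; have ff := arc_fpf x.
have a1 : rmat (arc x) h.+3 (N.-1 - h.+1) <= h.+1.
  have e : (N.-1 - h.+1).+1 = N.-1 - h by lia.
  have := rmat_j1 ff (_ : h.+3 <= N) (_ : N.-1 - h.+1 < N) => /(_ ltac:(lia) ltac:(lia)).
  by rewrite e; lia.
have a2 : rmat (arc x) h.+3 (N.-1 - h.+2) <= h.+2.
  have e : (N.-1 - h.+2).+1 = N.-1 - h.+1 by lia.
  have := rmat_j1 ff (_ : h.+3 <= N) (_ : N.-1 - h.+2 < N) => /(_ ltac:(lia) ltac:(lia)).
  by rewrite e; lia.
have bound i j : i <= h.+3 -> N.-1 - h.+2 <= j -> j <= N.-1 - h ->
    rmat (arc x) i j <= h + (N.-1 - h - j).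
  move=> ih j1 j2; apply: leq_trans (rmat_mono _ ih (leqnn j)) _.
  have [->|e1] := eqVneq j (N.-1 - h); first by lia.
  have [->|e2] := eqVneq j (N.-1 - h.+1); first by lia.
  have -> : j = N.-1 - h.+2 by lia.
  lia.
have fullh y j : (forall q, q < h -> arc y q = N.-1 - q) -> j <= N.-1 - h -> rmat (arc y) h j = h.
  by move=> e jh; apply: rmat_full => q qh; rewrite e //; lia.
have oneh q : q < h -> arc one q = N.-1 - q by move=> qh; apply: arc_one; lia.
have Ah q : q < h -> arc A q = N.-1 - q by move=> qh; rewrite arcA; sw_cases.
have ABh q : q < h -> arc AB q = N.-1 - q by move=> qh; rewrite arcAB; sw_cases.
apply/leE/lem_step; first by lia.
- by rewrite arcAB; sw_cases.
- move=> j; have -> : arc AB h.+3 = N.-1 - h.+3 by rewrite arcAB; sw_cases.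
  have -> : arc AB h.+2 = N.-1 - h by rewrite arcAB; sw_cases.
  move=> j1 j2; apply: leq_trans (bound _ _ _ _ _) _; try lia.
  rewrite !rmatS (fullh _ _ ABh) //.
  have -> : arc AB h = N.-1 - h.+1 by rewrite arcAB; sw_cases.
  have -> : arc AB h.+1 = N.-1 - h.+2 by rewrite arcAB; sw_cases.
  by lia.
apply: lem_step; first by lia.
- by rewrite arcA; sw_cases.
- move=> j; have -> : arc A h.+2 = N.-1 - h.+2 by rewrite arcA; sw_cases.
  have -> : arc A h.+1 = N.-1 - h by rewrite arcA; sw_cases.
  move=> j1 j2; apply: leq_trans (bound _ _ _ _ _) _; try lia.
  rewrite !rmatS (fullh _ _ Ah) //.
  have -> : arc A h = N.-1 - h.+1 by rewrite arcA; sw_cases.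
  by lia.
apply: lem_step; first by lia.
- by rewrite arc_one; lia.
- move=> j; rewrite !arc_one; try lia.
  move=> j1 j2; apply: leq_trans (bound _ _ _ _ _) _; try lia.
  by rewrite (fullh _ _ oneh) //; lia.
exact: lem_one.
Qed.

Lemma betaN_star_F s : s.+1 < N -> ~ beta (F ** s).
Proof.
move=> sN [q [qh]]; rewrite arc_star // arcF; last by case: swP; lia.
by case: (swP s q) => [e|e|e1 e2]; repeat (case: ifP => ?; try lia); sw_cases.
Qed.

Lemma alphaN_star_F' s : s.+1 < N -> ~ alpha (F' ** s).
Proof.
move=> sN [t [tl tN]]; rewrite arc_star // arcF'; last by case: swP; lia.
by case: (swP s t) => [e|e|e1 e2]; repeat (case: ifP => ?; try lia); sw_cases.
Qed.

Lemma des_F_F' s : des F s -> des F' s -> False.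
Proof.
move=> /des_asc[sN +] /des_asc[_]; rewrite !arcF ?arcF'; try lia.
by repeat (case: ifP => ?; try lia).
Qed.

(** Such a g is the product of F or of F' with a descent of g, but these
    products are not above the other element. *)
Lemma no_rank4 g : rk g = 4 -> (F <= g)%O -> (F' <= g)%O -> False.
Proof.
move=> g4 Fg F'g; have [|s ds] := @des_ex _ g; first by move=> e; rewrite e rk_one in g4.
have sN := des_ok ds; have rs := des_rk ds.
have [dF|dF] := boolP (des F s).
  have [dF'|dF'] := boolP (des F' s); first exact: des_F_F' dF dF'.
  apply: (alphaN_star_F' sN); suff -> : F' ** s = g by apply: le_F_alpha.
  by rewrite (le_eq_rk (leM1 F'g ds dF')) ?starK // rk_F'; lia.
apply: (betaN_star_F sN); suff -> : F ** s = g by apply: le_F'_beta.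
by rewrite (le_eq_rk (leM1 Fg ds dF)) ?starK // rk_F; lia.
Qed.

(** * Matchings of mixed type *)

Section MixedMatching.
Variables (w : twisted n) (M : twisted n -> twisted n).
Hypothesis wM : special_partial_matching w M.
Hypotheses (M1 : M one = one ** h.+1)
  (Aw : (A <= w)%O) (MA : M A = one ** h.+1 ** h)
  (Cw : (C <= w)%O) (MC : M C = C ** h.+1).

Let IM := spm_pmatch wM.

(** The generators for which M commutes with the multiplication on the minimum
    and on the atoms: the two excluded ones move down the atom of h+2 and the
    atom of h, on the side where M does not follow them. *)
Definition good k := (k != h.+2) && (k != rev n h).

(** The lifting property puts the image above the atoms of h+1 and of j. *)
Lemma mixed_atom j : j < mid -> (one ** j <= w)%O -> j <> h.+1 ->
  M (one ** j) = one ** h.+1 ** j \/ M (one ** j) = one ** j ** h.+1.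
Proof.
move=> jm jw jh; have hm' : h.+1 < mid by lia.
have c1 : cov one (one ** j) by apply: cov_star; rewrite rk_one rk_atom.
have ne : M one <> one ** j by rewrite M1 => /(atom_inj hm' jm) /esym.
have lt := pm_lift IM jw c1 ne; rewrite M1 in lt.
have := lt_rk lt; rewrite rk_atom // => r1.
have := pm_rk_le IM jw; rewrite rk_atom // => r2.
have r3 : rk (M (one ** j)) = 2 by lia.
apply: rank2P => //; [exact/not_eq_sym|exact: ltW|].
by apply/ltW/cov_lt/(pm_up IM jw); rewrite r3 rk_atom.
Qed.

(** The general commutation principle leaves the minimum and the atoms to be
    checked. *)
Lemma mixed_commute k x : good k -> (x <= w)%O -> rk (x ** k) <= rk x ->
  M (x ** k) = M x ** k.
Proof.
move=> /andP[/eqP g1 /eqP g2] xw.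
case: (boolP (k.+1 < N)) => kN; last by rewrite !(star_out _ kN).
have key := @pm_commute _ _ M (fun y => y ** k) IM (star_pmatch n k).
move=> le; suff base : forall x, (x <= w)%O -> rk x <= 1 -> rk (x ** k) <= rk x ->
    M (x ** k) = M x ** k by exact: (key base x xw le).
move=> {le x xw key} x xw x1 /=.
have hm1 : h.+1 < mid by lia.
case: (posnP (rk x)) => [/rk0->|x0].
  rewrite rk_one => e; have km : k = mid.
    apply: contrapT => km; by rewrite (star_one_up kN km) in e.
  by rewrite km star_one_mid M1 star_mid_far //; lia.
have [|j jm xE] := @atomP _ x; first by lia.
rewrite xE in xw *; rewrite rk_atom // => le.
have far_comm : far j h.+1 -> M (one ** j) = one ** h.+1 ** j.
  move=> jh; have jh' : j <> h.+1 by move: jh; rewrite /far; lia.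
  by case: (mixed_atom jm xw jh') => ->; rewrite ?(star_far _ jh).
have [e|fx|e] := star_rk (one ** j) k; first by rewrite e rk_atom in le.
  rewrite fx; move: fx => /(atom_fixed jm kN)[km jm'].
  rewrite km; have [-> |/eqP jh] := eqVneq j h.+1.
    by rewrite -M1 (pmK IM (one_le w)) star_one_mid.
  have fm i y : i.+1 < mid -> y ** i ** mid = y ** mid ** i.
    by move=> im; rewrite star_far // /far im.
  by case: (mixed_atom jm xw jh) => ->; rewrite fm ?star_mid_far //; lia.
have : des (one ** j) k by rewrite /des [X in _ < X]e.
case/(atom_des jm) => kE.
  rewrite kE starK M1.
  have [->|/eqP jh] := eqVneq j h.+1; first by rewrite -M1 (pmK IM (one_le w)).
  have [/far_comm->|jh'] := boolP (far j h.+1); first by rewrite starK.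
  have -> : j = h by move: jh'; rewrite /far; lia.
  by rewrite MA starK.
have jN : j.+1 < N by lia.
have -> : one ** j ** k = one by rewrite kE -(star_one_rev jN) starK.
rewrite M1 kE; have [->|/eqP jh] := eqVneq j h.+1.
  by rewrite -{2}M1 (pmK IM (one_le w)) star_one_rev //; lia.
have revK y : y ** rev n j ** rev n j = y by apply: starK.
rewrite -[LHS](revK); congr (_ ** _); rewrite atoms_far_rev //; last exact/not_eq_sym.
have [jf|jh'] := boolP (far j h.+1); first by rewrite (far_comm jf) star_far.
have -> : j = h.+2.
  have jh2 : j <> h by move=> ej; apply: g2; rewrite kE ej.
  by move: jh' jh jh2; rewrite /far; lia.
by rewrite MC.
Qed.

Lemma goodP k : k <> h.+2 -> k <> N.-2 - h -> good k.
Proof. by rewrite /good /rev => k1 k2; lia. Qed.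

(** M sends a coatom of F to F'. If F were in the domain of M, then M F would
    have rank four and lie above F and F'. *)
Lemma mixed_not_F : ~ (F <= w)%O.
Proof.
move=> Fw; have hN : h.+4 < N by lia.
pose AC := A ** h.+2.
have ACE : AC = C ** h by rewrite /AC star_far // /far ltnSn.
have cA : cov A AB by apply: cov_star; rewrite rk_AB rk_atom //; lia.
have cAB : cov AB F by apply: cov_star; rewrite rk_AB rk_F.
have rAC : rk AC = 2.
  have e2 : arc A h.+2 = N.-1 - h.+2 by rewrite arcA; sw_cases.
  have e3 : arc A h.+3 = N.-1 - h.+3 by rewrite arcA; sw_cases.
  by rewrite rk_desc ?rk_atom ?e2 ?e3; lia.
have cAC : cov AC F.
  have ne : AC <> AB by apply: star_adj; rewrite /adj ?eqxx ?orbT //; lia.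
  by rewrite /cov (lift cA ne) rAC rk_F.
have ACw := le_trans (ltW (cov_lt cAC)) Fw.
have MAC : M AC = F'.
  have ACh : AC ** h = C by rewrite ACE starK.
  have gh : good h by apply: goodP; lia.
  have := mixed_commute gh ACw; rewrite ACh MC rAC rk_atom; last by lia.
  by move=> ->; rewrite ?starK.
have FF' : M AC <> F.
  rewrite MAC => e; have := arcF (p := h) ltac:(lia); rewrite -e arcF'; last by lia.
  by repeat (case: ifP => ?; try lia).
have lt := pm_lift IM Fw cAC FF'; rewrite MAC in lt.
have := lt_rk lt; rewrite rk_F' => r1.
have := pm_rk_le IM Fw; rewrite rk_F => r2.
have r4 : rk (M F) = 4 by lia.
apply: (no_rank4 r4 _ (ltW lt)).
by apply/ltW/cov_lt/(pm_up IM Fw); rewrite r4 rk_F.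
Qed.

(** Suppose that all good descents act on w as M does. As w is not above F, the
    last h+1 points are matched to all but two of the first h+3 points. These
    two are not matched together, by commutation of M with a generator at one of
    them. Then an ascent of the involution among the first points and another
    one among the middle points are good descents with the same effect on w;
    this forces parallel arcs between them, contrary to the description of w. *)
Lemma mixed_descent : exists k, [/\ des w k, M w <> w ** k
  & forall x, (x <= w)%O -> M (x ** k) = M x ** k].
Proof.
have na : ~ alpha w by move=> /alpha_le_F; apply: mixed_not_F.
have hN : h.+3 + h.+3 < N by lia.
apply: contrapT => nex.
have H k : good k -> des w k -> w ** k = M w.
  move=> gk dk; apply: contrapT => ne; apply: nex; exists k.
  split=> // [/esym//|x xw].
  case: (leqP (rk (x ** k)) (rk x)) => le; first exact: mixed_commute.
  have xkw : (x ** k <= w)%O by case: (spm_star dk) => h1 _ _ _ _; apply: h1.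
  have := mixed_commute gk xkw; rewrite starK => /(_ (ltnW le)) ->.
  by rewrite starK.
have nA : ~ forall q, q <= h -> N.-1 - h <= arc w q.
  move=> full; have := le_lem Aw (i := h.+1) (j := N.-1 - h) ltac:(lia) ltac:(lia).
  rewrite [X in X <= _]rmat_full // rmatS arcA; last by lia.
  by rewrite sw_l; have := rmat_le (arc A) h (N.-1 - h); lia.
have nC : ~ forall q, q < h.+3 -> N.-1 - h.+2 <= arc w q.
  move=> full; have := le_lem Cw (i := h.+3) (j := N.-1 - h.+2) ltac:(lia) ltac:(lia).
  rewrite [X in X <= _]rmat_full // rmatS arcC; last by lia.
  by rewrite sw_l; have := rmat_le (arc C) h.+2 (N.-1 - h.+2); lia.
have [|p [p' [pp' zp zp' zq]]] := @rmat_two (arc w) h.+3 (N.-1 - h).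
  by rewrite rmat_alphaN.
have pN : p < N by lia. have p'N : p' < N by lia.
have asc a : a <= h.+1 -> arc w a < arc w a.+1 -> des w a /\ w ** a = M w.
  move=> ah lt; have da : des w a by apply: star_asc => //; lia.
  by split=> //; apply: H => //; apply: goodP; lia.
(* an ascent among the first points, as not all the first ones are matched to the last ones *)
have [a [ah az aE]] : exists a, [/\ a <= h.+1, arc w a < arc w a.+1
    & a = p /\ p' <> p.+1 \/ a = p' /\ p' = p.+1].
  have [e|ne] := eqVneq p' p.+1; last first.
    exists p; split; [lia| |by left; split=> //; apply/eqP].
    by have := zq p.+1; lia.
  have [e2|ne2] := eqVneq p h.+1.
    by case: nA => q qh; apply: zq; lia.
  exists p'; split; [lia| |by right].
  by have := zq p'.+1; lia.
have [da Ma] := asc a ah az.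
have wN q : q < N -> arc w (arc w q) = q by apply: arcK.
have [zpp'|zpp'] := eqVneq (arc w p) p'.
  have IMw : (w <= w)%O by [].
  case: aE => -[aE e]; subst a.
  - (* the arc (p, p') with p' > p + 1 *)
    have v_le : (w ** p <= w)%O by apply: star_le.
    have Mv : M (w ** p) = w by rewrite Ma (pmK IM).
    have g1 : good p.+1 by apply: goodP; lia.
    have v1 : arc (w ** p) p.+1 = p'.
      by rewrite arc_star; [rewrite sw_r zpp'; case: swP; lia|lia].
    have zp1 : N.-1 - h <= arc w p.+1 by apply: zq; lia.
    have notfix : w ** p.+1 <> w by move=> /arc_fix; lia.
    have [e2|ne2] := eqVneq p' p.+2.
      have fx : w ** p ** p.+1 = w ** p by apply: star_fix; lia.
      have := mixed_commute g1 v_le; rewrite fx Mv => /(_ (leqnn _)).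
      by move/esym.
    have zp2 : N.-1 - h <= arc w p.+2 by apply: zq; lia.
    have v2 : arc (w ** p) p.+2 = arc w p.+2.
      rewrite arc_star; last by lia.
      have -> : sw p p.+2 = p.+2 by case: swP; lia.
      by case: swP; lia.
    have dv : des (w ** p) p.+1 by apply: star_asc; rewrite ?v1 ?v2; lia.
    have := mixed_commute g1 v_le; rewrite Mv => /(_ ltac:(have := des_rk dv; lia)) e3.
    have le : (w ** p.+1 <= w)%O.
      by rewrite -e3; apply: (pm_in IM); apply: le_trans (star_le dv) v_le.
    have dw : des w p.+1.
      have [e4|//|e4] := star_rk w p.+1; first by have := le_rk le; lia.
      by rewrite /des [X in _ < X]e4.
    have := H _ g1 dw; rewrite -Ma; apply: star_adj; rewrite /adj ?eqxx ?orbT //; lia.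
  - (* the arc (p, p + 1) *)
    have fp : w ** p = w by apply: star_fix; lia.
    have gp : good p by apply: goodP; lia.
    have := mixed_commute gp IMw; rewrite fp => /(_ (leqnn _)); rewrite -Ma => fM.
    have pa : adj p p' by rewrite e /adj eqxx.
    have := @braid _ w p p' pa ltac:(lia) ltac:(lia).
    rewrite fp -fM starK => e3.
    by move: da; rewrite /des e3 ltnn.
(* both exceptional first points are matched to middle points *)
have mid1 : h.+3 <= arc w p.
  rewrite leqNgt; apply/negP => lt; have := zq _ lt; rewrite wN // => h1.
  have : arc w p != p by apply: arc_neq.
  by move: zpp'; lia.
have mid2 : h.+3 <= arc w p'.
  rewrite leqNgt; apply/negP => lt; have := zq _ lt; rewrite wN // => h1.
  have : arc w p' != p' by apply: arc_neq.
  have : arc w p' != p by apply/eqP => e; move: zpp'; rewrite -e wN // eqxx.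
  by lia.
have toU (y : nat) : h.+3 <= y -> y < N -> arc w y < h.+3 -> y < N.-1 - h -> arc w y = p \/ arc w y = p'.
  move=> y1 yN y2 y3; apply: contrapT => ne; have := zq (arc w y) y2; rewrite wN //.
  by move: ne; lia.
have [c [c1 c2 zc]] : exists c : nat, [/\ h.+3 <= c, c.+1 < N.-1 - h & arc w c < arc w c.+1].
  apply: contrapT => nc.
  have dec (d v : nat) : h.+3 <= v -> v + d.+1 < N.-1 - h -> arc w (v + d.+1) < arc w v.
    move=> v1; elim: d => [|d IHd] lt.
      rewrite addn1 ltnNge; apply/negP => le; apply: nc; exists v; split=> //; first by lia.
      have : arc w v != arc w v.+1 by apply/eqP => /arc_inj; lia.
      by lia.
    apply: leq_ltn_trans (IHd _); last by lia.
    rewrite leqNgt; apply/negP => gt; apply: nc; exists (v + d.+1); split; [lia|lia|].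
    by rewrite -[(v + d.+1).+1]addnS.
  have [q [qU qz]] : exists q, (q = p \/ q = p') /\ arc w q < N.-1 - h.+2.
    apply: contrapT => nq; apply: nC => q qh.
    have [e|/eqP np] := eqVneq q p; first by rewrite leqNgt; apply/negP => lt; apply: nq; exists q; auto.
    have [e|/eqP np'] := eqVneq q p'; first by rewrite leqNgt; apply/negP => lt; apply: nq; exists q; auto.
    by have := zq q qh np np'; lia.
  have qN : q < N by case: qU => ->.
  have v1 : h.+3 <= arc w q by case: qU => ->.
  have vq := wN q qN; set v := arc w q in qz v1 vq.
  have below (y : nat) : v < y -> y < N.-1 - h -> arc w y < q.
    move=> vy yh; have := dec (y - v.+1) v v1; rewrite vq.
    have -> : v + (y - v.+1).+1 = y by lia.
    by apply.
  have y1 := below (N.-1 - h.+2) qz ltac:(lia).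
  have y2 := below (N.-1 - h.+1) ltac:(lia) ltac:(lia).
  have qh : q < h.+3 by case: qU; lia.
  have := toU (N.-1 - h.+2) ltac:(lia) ltac:(lia) ltac:(lia) ltac:(lia).
  have := toU (N.-1 - h.+1) ltac:(lia) ltac:(lia) ltac:(lia) ltac:(lia).
  have : arc w (N.-1 - h.+2) != arc w (N.-1 - h.+1) by apply/eqP => /arc_inj; lia.
  by lia.
have dc : des w c by apply: star_asc => //; lia.
have Mc : w ** c = M w by apply: H => //; apply: goodP; lia.
have [] := star_coincide da (etrans Ma (esym Mc)); first by lia.
move=> e1 e2; case: aE => -[aE e]; subst a; have := zq p.+1; have := zq p'.+1; lia.
Qed.

End MixedMatching.
End Mixed.

(** * Classification of the special partial matchings *)

Section Classification.
Variable n : nat.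
Local Notation N := (n.*2).
Local Notation one := (twisted_one n).
Local Notation mid := (n.-1).
Implicit Types (x y z w c d g : twisted n) (j k s : nat) (M : twisted n -> twisted n).

Lemma spm_rk w M : special_partial_matching w M -> rk w = (rk (M w)).+1.
Proof. by case=> _ _ /coversP/cov_rk. Qed.

Lemma agree_des w M k : special_partial_matching w M ->
  (forall x, (x <= w)%O -> M x = x ** k) -> des w k.
Proof. by move=> /spm_rk e h; rewrite /des -h // [X in _ < X]e. Qed.

Lemma agree_base w M k : special_partial_matching w M -> M one = one ** k ->
  (forall j, j < mid -> (one ** j <= w)%O -> M (one ** j) = one ** j ** k) ->
  des w k /\ forall x, (x <= w)%O -> M x = x ** k.
Proof.
move=> wM M1 Ma; suff h x : (x <= w)%O -> M x = x ** k.
  by split=> //; apply: agree_des wM h.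
move=> xw; apply: (pm_agree (spm_pmatch wM) (star_pmatch n k)) => // {xw}x xw _.
rewrite leq_eqVlt => /predU1P[/atomP[j jm xE]|]; first by rewrite xE Ma // -xE.
by rewrite ltnS leqn0 => /eqP/rk0->.
Qed.

(** A matching that fixes the minimum is the multiplication by the middle
    generator, as it is not the identity. *)
Lemma fixed_min w M : special_partial_matching w M -> M one = one ->
  des w mid /\ forall x, (x <= w)%O -> M x = x ** mid.
Proof.
move=> wM M1; have IM := spm_pmatch wM.
have atom j : j < mid -> (one ** j <= w)%O ->
    M (one ** j) = one ** j \/
    [/\ j.+1 = mid & M (one ** j) = one ** j ** mid].
  move=> jm jw; case: (pm_tri IM jw) => [up|fx|down]; [right|by left|].
    have r := cov_rk up; rewrite rk_atom // in r.
    apply: rank2_unique => // c /(pm_coatoms IM _ jw (cov_rk up))[//|[y [yj uy _]]].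
    have /rk0 y1 : rk y = 0 by have := cov_rk yj; rewrite rk_atom //; lia.
    by move: uy; rewrite y1 M1; lia.
  have /rk0 e : rk (M (one ** j)) = 0 by have := cov_rk down; rewrite rk_atom //; lia.
  have := pmK IM jw; rewrite e M1 => e'.
  by have := rk_atom jm; rewrite -e' rk_one.
have notid : ~ forall j, j < mid -> (one ** j <= w)%O -> M (one ** j) = one ** j.
  move=> fx; have : M w = w; last by have := spm_rk wM => /[swap] ->; lia.
  apply: (pm_agree IM (id_pmatch n)) => // x xw _.
  rewrite leq_eqVlt => /predU1P[/atomP[j jm xE]|]; first by rewrite xE fx // -xE.
  by rewrite ltnS leqn0 => /eqP/rk0->.
have [j [jm jw Mj]] : exists j, [/\ j < mid, (one ** j <= w)%O & M (one ** j) <> one ** j].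
  apply: contrapT => nex; apply: notid => j jm jw; apply: contrapT => ne.
  by apply: nex; exists j.
apply: agree_base => //; first by rewrite star_one_mid.
move=> j' jm' jw'; case: (atom j' jm' jw') => [e|[]//].
case: (atom j jm jw) => [//|[j1 ej]].
have [jj|/eqP jj] := eqVneq j' j; first by rewrite jj.
by rewrite e star_mid_far //; lia.
Qed.

(** If the minimum is sent to the atom of i, then every other atom is
    sent either to its product with i or to the product of the atom of i
    with its own generator. If all choices agree, M is the multiplication by i
    or by its mirror image. Otherwise the two neighbours of i behave
    differently, and the mixed case applies, up to the symmetry of the graph. *)
Lemma classify w M : special_partial_matching w M -> exists2 k, des w k &
  (forall x, (x <= w)%O -> M x = x ** k) \/
  (M w <> w ** k /\ forall x, (x <= w)%O -> M (x ** k) = M x ** k).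
Proof.
move=> wM; have IM := spm_pmatch wM.
have [up|M1|down] := pm_tri IM (one_le w); last by have := cov_rk down; rewrite rk_one.
  have [|i im M1] := @atomP _ (M one); first by rewrite (cov_rk up) rk_one.
  have type j : j < mid -> (one ** j <= w)%O -> j <> i ->
      M (one ** j) = one ** i ** j \/ M (one ** j) = one ** j ** i.
    move=> jm jw ji.
    have c1 : cov one (one ** j) by apply: cov_star; rewrite rk_one rk_atom.
    have ne : M one <> one ** j by rewrite M1 => /(atom_inj im jm) /esym.
    have lt := pm_lift IM jw c1 ne; rewrite M1 in lt.
    have := lt_rk lt; rewrite rk_atom // => r1.
    have := pm_rk_le IM jw; rewrite rk_atom // => r2.
    apply: rank2P => //; [exact/not_eq_sym|lia|exact: ltW|].
    by apply/ltW/cov_lt/(pm_up IM jw); rewrite rk_atom //; lia.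
  have Mi : M (one ** i) = one by rewrite -M1 (pmK IM (one_le w)).
  have iN : i.+1 < N by lia.
  have typeF j : j < mid -> (one ** j <= w)%O -> far j i ->
      M (one ** j) = one ** i ** j /\ M (one ** j) = one ** j ** i.
    move=> jm jw ji; have ne : j <> i by move: ji; rewrite /far; lia.
    by case: (type j jm jw ne) => ->; rewrite (star_far _ ji).
  have [R|nR] := pselect (forall j, j < mid -> (one ** j <= w)%O -> M (one ** j) = one ** j ** i).
    by have [di h] := agree_base wM M1 R; exists i => //; left.
  have [L|nL] := pselect (forall j, j < mid -> (one ** j <= w)%O -> j <> i -> M (one ** j) = one ** i ** j).
    have [||di h] := @agree_base w M (rev n i) wM; last by exists (rev n i) => //; left.
      by rewrite star_one_rev.
    move=> j jm jw; have [-> |/eqP ji] := eqVneq j i.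
      by rewrite Mi -(star_one_rev iN) starK.
    by rewrite (L j jm jw ji) atoms_far_rev.
  have [a [am aw aR]] : exists a, [/\ a < mid, (one ** a <= w)%O & M (one ** a) <> one ** a ** i].
    apply: contrapT => nex; apply: nR => j jm jw; apply: contrapT => ne.
    by apply: nex; exists j.
  have [b [bm bw bi bL]] : exists b, [/\ b < mid, (one ** b <= w)%O, b <> i & M (one ** b) <> one ** i ** b].
    apply: contrapT => nex; apply: nL => j jm jw ji; apply: contrapT => ne.
    by apply: nex; exists j.
  have ai : a <> i by move=> e; apply: aR; rewrite e Mi starK.
  have aL : M (one ** a) = one ** i ** a by case: (type a am aw ai).
  have bR : M (one ** b) = one ** b ** i by case: (type b bm bw bi).
  have af : ~~ far a i by apply/negP => /(typeF a am aw)[].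
  have bf : ~~ far b i by apply/negP => /(typeF b bm bw)[].
  have ab : a <> b by move=> e; apply: aR; rewrite e.
  have [e|e] : (i = a.+1 /\ b = a.+2) \/ (i = b.+1 /\ a = b.+2).
      by move: af bf ai bi ab; rewrite /far; lia.
    case: e => ei eb; subst i b.
    have [k [dk ne cM]] := mixed_descent bm wM M1 aw aL bw bR.
    by exists k => //; right.
  case: e => ei ea; subst i a.
  pose w' := flip w; pose M' x := flip (M (flip x)).
  have w'M' : special_partial_matching w' M' by apply: spm_flip.
  have fo j : j.+1 < N -> flip (one ** j) = one ** rev n j.
    by move=> jN; rewrite flip_star // flip_one.
  have fj j : j < mid -> flip (one ** j) = one ** j.
    by move=> jm; rewrite fo ?star_one_rev //; lia.
  have fjk j k : j < mid -> k < mid -> j <> k -> flip (one ** j ** k) = one ** k ** j.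
    move=> jm km jk; rewrite flip_star; last by lia.
    by rewrite fj // atoms_far_rev.
  have M'1 : M' one = one ** b.+1 by rewrite /M' flip_one M1 fj.
  have b'w : (one ** b <= w')%O by rewrite -fj //; apply: le_flip.
  have a'w : (one ** b.+2 <= w')%O by rewrite -fj //; apply: le_flip.
  have M'b : M' (one ** b) = one ** b.+1 ** b by rewrite /M' fj // bR fjk //; lia.
  have M'a : M' (one ** b.+2) = one ** b.+2 ** b.+1 by rewrite /M' fj // aL fjk //; lia.
  have [k [dk ne cM]] := mixed_descent am w'M' M'1 b'w M'b a'w M'a.
  have kN := des_ok dk; have rN : (rev n k).+1 < N by rewrite /rev; lia.
  have fr x : flip (x ** rev n k) = flip x ** k by rewrite flip_star // rev_rev.
  exists (rev n k); first by rewrite -[w]flipK; apply: des_flip.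
  right; split=> [e|x xw].
    by apply: ne; rewrite /M' /w' flipK e fr.
  have := cM (flip x) (le_flip xw); rewrite /M' -fr !flipK -fr.
  by move=> /(congr1 (@flip n)); rewrite !flipK.
by have [dm h] := fixed_min wM M1; exists mid => //; left.
Qed.

End Classification.

(** * Elementary pairs of matchings *)

Section Near.
Variable n : nat.
Local Notation N := (n.*2).
Local Notation one := (twisted_one n).
Implicit Types (x y z w c d g u v : twisted n) (j k s t : nat)
  (M K L : twisted n -> twisted n).
Local Open Scope order_scope.

(** Pairs of matchings for which all the orbits and the relations between the
    recursions are explicit. In the second case, the inequality makes the orbit
    of w a square. *)
Definition near w M K : Prop :=
  [\/ forall x, x <= w -> M x = K x,
      M w <> K w /\ (forall x, x <= w -> M (K x) = K (M x))
    | exists s t, [/\ adj s t, des w s /\ des w t,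
        forall x, x <= w -> M x = x ** s & forall x, x <= w -> K x = x ** t]].

Lemma near_sym w M K : near w M K -> near w K M.
Proof.
case=> [h|[ne h]|[s [t [st [ds dt] hM hK]]]].
- by constructor 1 => x /h.
- by constructor 2; split=> [/esym//|x /h].
- by constructor 3; exists t, s; rewrite adjC.
Qed.

Inductive near_path w : (twisted n -> twisted n) -> (twisted n -> twisted n) -> Prop :=
  | NearNil M of special_partial_matching w M : near_path w M M
  | NearCons M K L of special_partial_matching w M & near w M K & near_path w K L :
      near_path w M L.

Lemma near_path_trans w M K L : near_path w M K -> near_path w K L -> near_path w M L.
Proof. by elim=> [//|{}M K' {}K sM h _ IH] /IH; apply: NearCons. Qed.

Lemma near_path1 w M K : special_partial_matching w M -> special_partial_matching w K ->
  near w M K -> near_path w M K.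
Proof. by move=> sM sK h; apply: NearCons sM h (NearNil sK). Qed.

Lemma near_star w s t : des w s -> des w t -> s <> t ->
  (far s t -> w ** s <> w ** t) -> near w (fun x => x ** s) (fun x => x ** t).
Proof.
move=> ds dt st ne; have [fst|fst] := boolP (far s t).
  by constructor 2; split=> [|x _]; [exact: ne|rewrite star_far // farC].
by constructor 3; exists s, t; split=> //; move: fst; rewrite /far /adj; lia.
Qed.

(** Two descents with the same effect on w can be joined through a third one,
    unless w has rank one. *)
Lemma star_path w s t : des w s -> des w t ->
  near_path w (fun x => x ** s) (fun x => x ** t).
Proof.
move=> ds dt; have sS := spm_star ds; have sT := spm_star dt.
have [->|/eqP st] := eqVneq s t; first exact: NearNil.
have [e|/eqP ne] := eqVneq (w ** s) (w ** t); last first.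
  by apply: near_path1 => //; apply: near_star.
have [as1 _] := star_coincide ds e st.
have [[b [db bs bt]]|nb] := pselect (exists b, [/\ des w b, b <> s & b <> t]).
  have ne : w ** s <> w ** b.
    by move=> e'; have [as2 _] := star_coincide ds e' (not_eq_sym bs); apply: bt; rewrite -as1 -as2.
  apply: (near_path_trans (K := fun x => x ** b)).
    by apply: near_path1 sS (spm_star db) _; apply: near_star => //; apply: not_eq_sym.
  apply: near_path1 (spm_star db) sT _; apply: near_star => // _; rewrite -e.
  exact: not_eq_sym.
have rw := des_rk ds; have vs : w ** s ** s = w by apply: starK.
have vt : w ** s ** t = w by rewrite e starK.
have r0 : rk (w ** s) = 0%N.
  apply: contrapT => r0; have [|u du] := @des_ex _ (w ** s).
    by move=> e0; apply: r0; rewrite e0 rk_one.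
  have us : u <> s by move=> e0; move: du; rewrite e0 (negPf (desN_star ds)).
  have ut : u <> t by move=> e0; move: du; rewrite e0 e (negPf (desN_star dt)).
  have duF : ~ des w u by move=> d; apply: nb; exists u.
  have aus : adj s u.
    have [f|f] := boolP (far u s); last by move: f us; rewrite /far /adj; lia.
    by case: duF; rewrite -vs; apply: des_far => //; rewrite vs.
  have aut : adj t u.
    have [f|f] := boolP (far u t); last by move: f ut; rewrite /far /adj; lia.
    by case: duF; rewrite -vt; apply: des_far => //; rewrite vt.
  have [e1 _ _] := star_coincide_adj aus aut st ds e.
  by move: du; rewrite /des e1 ltnn.
apply: near_path1 => //; constructor 1 => x xw.
have v1 := rk0 r0; have [x0|x1] := posnP (rk x).
  by rewrite (rk0 x0) -v1 vs vt.
by rewrite (le_eq_rk xw) //; lia.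
Qed.

Lemma near_connected w M K : special_partial_matching w M ->
  special_partial_matching w K -> near_path w M K.
Proof.
have half L : special_partial_matching w L ->
    exists2 k, des w k & near w L (fun x => x ** k).
  move=> /classify[k dk h]; exists k => //; case: h => [h|[ne h]].
    by constructor 1.
  by constructor 2.
move=> sM sK; have [s ds nM] := half M sM; have [t dt nK] := half K sK.
apply: near_path_trans (near_path1 sM (spm_star ds) nM) _.
apply: near_path_trans (star_path ds dt) _.
by apply: near_path1 (spm_star dt) sK (near_sym nK).
Qed.

(** * Ranks of orbits and strict coherence *)

Lemma path_rk x (c : seq (twisted n)) : path <%O x c -> (rk x + size c <= rk (last x c))%N.
Proof.
elim: c x => [|y c IH] x /=; first by rewrite addn0.
by move=> /andP[/lt_rk xy /IH]; lia.
Qed.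

Lemma chain_le (O : set (twisted n)) b : (forall x y, O x -> O y -> (rk y <= rk x + b)%N) ->
  forall j, chain_of_length O j -> (j <= b)%N.
Proof.
move=> h j [c [sz srt inO]]; case: c sz srt inO => [//|x c] /= [<-] srt inO.
have h1 := h _ _ (inO x (mem_head _ _)) (inO _ (mem_last x c)).
by rewrite -(leq_add2l (rk x)); exact: leq_trans (path_rk srt) h1.
Qed.

(** The rank picks a longest chain, which exists only for bounded lengths; hence
    the bound b. *)
Lemma rankP (O : set (twisted n)) b x : O x -> (forall j, chain_of_length O j -> (j <= b)%N) ->
  (rank O <= b)%N /\ forall j, chain_of_length O j -> (j <= rank O)%N.
Proof.
move=> Ox hb; have c0 : chain_of_length O 0.
  by exists [:: x]; split=> // y; rewrite inE => /eqP->.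
have ex : exists j, `[< chain_of_length O j >] by exists 0%N; apply/asboolP.
have bd j : `[< chain_of_length O j >] -> (j <= b)%N by move/asboolP/hb.
have [m /asboolP cm mmax] := ex_maxnP ex bd.
have : [set r | chain_of_length O r /\ forall j, chain_of_length O j -> (j <= r)%N]%classic (rank O).
  apply: (xgetPex 0%N); exists m; split=> // j cj; apply: mmax; exact/asboolP.
by case=> cr rmax; split=> //; apply: hb.
Qed.

Lemma chain2 (O : set (twisted n)) x y : O x -> O y -> x < y -> chain_of_length O 1.
Proof.
move=> Ox Oy xy; exists [:: x; y]; split=> //=; first by rewrite xy.
by move=> z; rewrite !inE => /orP[] /eqP->.
Qed.

Lemma chain3 (O : set (twisted n)) x y z : O x -> O y -> O z -> x < y -> y < z ->
  chain_of_length O 2.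
Proof.
move=> Ox Oy Oz xy yz; exists [:: x; y; z]; split=> //=; first by rewrite xy yz.
by move=> ?; rewrite !inE => /or3P[] /eqP->.
Qed.

Lemma chain4 (O : set (twisted n)) x y z v : O x -> O y -> O z -> O v ->
  x < y -> y < z -> z < v -> chain_of_length O 3.
Proof.
move=> Ox Oy Oz Ov xy yz zv; exists [:: x; y; z; v]; split=> //=; first by rewrite xy yz zv.
by move=> ?; rewrite !inE => /or4P[] /eqP->.
Qed.

Lemma hexagon_rk x y s t :
  [\/ y = x, y = x ** s | y = x ** t] \/
  [\/ y = x ** s ** t, y = x ** t ** s | y = x ** s ** t ** s] ->
  (rk y <= rk x + 3)%N.
Proof.
have r := star_rk_le; have := r _ x s; have := r _ x t.
have := r _ (x ** s) t; have := r _ (x ** t) s; have := r _ (x ** s ** t) s.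
by move=> r1 r2 r3 r4 r5 [[->|->|->]|[->|->|->]]; lia.
Qed.

Lemma chain_rk x y v s t :
  [\/ y = x, y = x ** t | y = x ** t ** s] ->
  [\/ v = x, v = x ** t | v = x ** t ** s] -> (rk v <= rk y + 2)%N.
Proof.
have r := star_rk_le; have := r _ x t; have := r _ (x ** t) s.
have := r _ (x ** t) t; have := r _ (x ** t ** s) s; rewrite !starK.
by move=> r1 r2 r3 r4 [->|->|->] [->|->|->]; lia.
Qed.

Section Orbits.
Variables (w : twisted n) (M K : twisted n -> twisted n).
Hypotheses (sM : special_partial_matching w M) (sK : special_partial_matching w K).
Let IM := spm_pmatch sM.
Let IK := spm_pmatch sK.
Local Notation orbit := (spm_orbit M K).

Lemma orbit_refl u : orbit u u. Proof. by exists [::]. Qed.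

Lemma orbitM u x : orbit u x -> orbit u (M x).
Proof. by case=> a ->; exists (true :: a). Qed.

Lemma orbitK u x : orbit u x -> orbit u (K x).
Proof. by case=> a ->; exists (false :: a). Qed.

Lemma orbit_ind u (Q : twisted n -> Prop) : u <= w -> Q u ->
  (forall x, x <= w -> Q x -> Q (M x) /\ Q (K x)) -> forall x, orbit u x -> x <= w /\ Q x.
Proof.
move=> uw Qu hQ x [a ->]; elim: a => [//|b a [le Qa]] /=.
have [QM QK] := hQ _ le Qa.
by case: b; split=> //; [exact: (pm_in IM)|exact: (pm_in IK)].
Qed.

Lemma orbit_le u x : u <= w -> orbit u x -> x <= w.
Proof. by move=> uw /(orbit_ind (Q := fun _ => True) uw)[]. Qed.

Lemma orbit_sym u x : u <= w -> orbit u x -> orbit x u.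
Proof.
move=> uw; suff h y : orbit y u -> y <= w -> orbit (M y) u /\ orbit (K y) u.
  by case/(orbit_ind (Q := fun y => orbit y u) uw (orbit_refl u)) => // y yw /h; apply.
move=> [a ->] yw; split.
  by exists (rcons a true); rewrite -cats1 foldr_cat /= (pmK IM).
by exists (rcons a false); rewrite -cats1 foldr_cat /= (pmK IK).
Qed.

Lemma orbit_trans u x y : orbit u x -> orbit x y -> orbit u y.
Proof. by case=> a -> [b ->]; exists (b ++ a); rewrite foldr_cat. Qed.

(** Elements of an orbit are at bounded distance as soon as they are from one
    another reachable by boundedly many steps. *)
Lemma orbit_bound u b : u <= w ->
  (forall x y, orbit u x -> orbit x y -> (rk y <= rk x + b)%N) ->
  (rank (orbit u) <= b)%N /\ forall j, chain_of_length (orbit u) j -> (j <= rank (orbit u))%N.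
Proof.
move=> uw h; apply: (rankP (orbit_refl u)); apply: chain_le => x y ux uy.
by apply: h => //; apply: orbit_trans uy; apply: orbit_sym.
Qed.

Lemma orbit_moved u : u <= w -> (forall x, orbit u x -> x <> M x /\ x <> K x) ->
  chain_of_length (orbit u) 1.
Proof.
move=> uw h; have [ne _] := h u (orbit_refl u).
have uM := orbitM (orbit_refl u).
case: (pm_tri IM uw) => [/cov_lt lt|/esym//|/cov_lt lt].
  exact: chain2 (orbit_refl u) uM lt.
exact: chain2 uM (orbit_refl u) lt.
Qed.

Let ww : w <= w. Proof. by []. Qed.
Let Mw : M w < w. Proof. by case: sM => _ _ []. Qed.
Let rM x : x <= w -> (rk (M x) <= (rk x).+1)%N. Proof. exact: (pm_rk_le IM). Qed.
Let rK x : x <= w -> (rk (K x) <= (rk x).+1)%N. Proof. exact: (pm_rk_le IK). Qed.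

Lemma chainlike_fixed u : chain_like_orbit M K (orbit u) ->
  exists2 x, orbit u x & M x = x \/ K x = x.
Proof. by case=> _ [x [ux _ fx]] _; exists x. Qed.

(** Orbits have at most two elements, and the orbit of w has rank one. *)
Lemma strict_eqon : (forall x, x <= w -> M x = K x) -> strictly_coherent w M K.
Proof.
move=> e.
have two u x : u <= w -> spm_orbit M K u x -> x <= w /\ (x = u \/ x = M u).
  move=> uw; apply: (orbit_ind (Q := fun x => x = u \/ x = M u) uw); first by left.
  move=> y yw [->|->]; rewrite -!e ?(pm_in IM) //; first by split; right.
  by rewrite (pmK IM) //; split; left.
have bound u : u <= w -> forall x y, spm_orbit M K u x -> spm_orbit M K x y -> (rk y <= rk x + 1)%N.
  move=> uw x y /(two u x uw)[xw _] /(two x y xw)[_ [->|->]]; first by lia.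
  by have := rM xw; lia.
have [t1 t2] := orbit_bound ww (bound w ww).
have rkw : rank (spm_orbit M K w) = 1%N.
  have := t2 1%N (chain2 (orbitM (orbit_refl w)) (orbit_refl w) Mw); lia.
move=> u uw; rewrite rkw; have [u1 u2] := orbit_bound uw (bound u uw); split.
  case=> _ /(orbit_moved uw)/u2 u3.
  by have -> : rank (spm_orbit M K u) = 1%N by lia.
move=> /chainlike_fixed[x ux fx].
have fMx : M x = x by case: fx => //; rewrite -e //; apply: orbit_le ux.
have xw := orbit_le uw ux.
have [|u3 _] := @orbit_bound u 0 uw.
  move=> y z uy yz; have xz : spm_orbit M K x z.
    by apply: orbit_trans yz; apply: orbit_trans uy; apply: orbit_sym.
  have xy : spm_orbit M K x y.
    by apply: orbit_trans uy; apply: orbit_sym.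
  by case: (two x z xw xz) => _; case: (two x y xw xy) => _; rewrite fMx => -[]-> []->; lia.
by have -> : rank (spm_orbit M K u) = 0%N by lia.
Qed.

(** Orbits have at most four elements and the orbit of w is a square, of rank
    two. A chain-like orbit contains a fixed point, and has rank at most one. *)
Lemma strict_commute : M w <> K w -> (forall x, x <= w -> M (K x) = K (M x)) ->
  strictly_coherent w M K.
Proof.
move=> ne cMK.
have four u x : u <= w -> spm_orbit M K u x ->
    x <= w /\ [\/ x = u, x = M u, x = K u | x = M (K u)].
  move=> uw; apply: (orbit_ind (Q := fun x => [\/ x = u, x = M u, x = K u | x = M (K u)]) uw); first by constructor 1.
  have Muw := pm_in IM uw; have Kuw := pm_in IK uw.
  have MKK : M (M (K u)) = K u by rewrite (pmK IM).
  have KMK : K (M (K u)) = M u by rewrite cMK // (pmK IK).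
  have MM : M (M u) = u by rewrite (pmK IM).
  have KK : K (K u) = u by rewrite (pmK IK).
  move=> y yw [->|->|->|->]; rewrite ?MKK ?KMK ?MM ?KK -?cMK //; split;
    by [constructor 1|constructor 2|constructor 3|constructor 4].
have bound u : u <= w -> forall x y, spm_orbit M K u x -> spm_orbit M K x y -> (rk y <= rk x + 2)%N.
  move=> uw x y /(four u x uw)[xw _] /(four x y xw)[_ [->|->|->|->]].
  + by lia. + by have := rM xw; lia. + by have := rK xw; lia.
  + by have := rM (pm_in IK xw); have := rK xw; lia.
have [t1 t2] := orbit_bound ww (bound w ww).
have rkw : rank (spm_orbit M K w) = 2%N.
  have cK : cov (K w) w by case: sK => _ _ /coversP.
  have ne' : M (K w) <> w by move=> e; apply: ne; rewrite -[RHS](pmK IM (pm_in IK ww)) e.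
  have lt := pm_lift IM ww cK ne'.
  have oM := orbitM (orbit_refl w).
  have := t2 2%N (chain3 (orbitM (orbitK (orbit_refl w))) oM (orbit_refl w) lt Mw); lia.
move=> u uw; rewrite rkw; have [u1 u2] := orbit_bound uw (bound u uw); split.
  case=> _ /(orbit_moved uw)/u2 u3.
  by case: (rank _) u1 u3 => [|[|[|]]].
move=> /chainlike_fixed[x ux fx]; have xw := orbit_le uw ux.
have [z zx] : exists z, forall y, spm_orbit M K x y -> y = x \/ y = z /\ (rk x <= rk z + 1 /\ rk z <= rk x + 1)%N.
  case: fx => fx.
    exists (K x) => y /(four x y xw)[_]; rewrite cMK // fx => h.
    have : (rk x <= rk (K x) + 1)%N by have := rK (pm_in IK xw); rewrite (pmK IK) //; lia.
    by have := rK xw; case: h => ->; auto => ? ?; right; split=> //; lia.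
  exists (M x) => y /(four x y xw)[_]; rewrite fx => h.
  have : (rk x <= rk (M x) + 1)%N by have := rM (pm_in IM xw); rewrite (pmK IM) //; lia.
  by have := rM xw; case: h => ->; auto => ? ?; right; split=> //; lia.
have [|u3 _] := @orbit_bound u 1 uw.
  move=> y v uy yv; have xy : spm_orbit M K x y.
    by apply: orbit_trans uy; apply: orbit_sym.
  have xv := orbit_trans xy yv.
  by case: (zx y xy) => [->|[-> ?]]; case: (zx v xv) => [->|[-> ?]]; lia.
by case: (rank _) u3 => [|[|]].
Qed.

(** The orbit of w is a hexagon, of rank three. A dihedral orbit is a hexagon as
    well, while the chain-like ones are chains of rank two by the braid
    relation. *)
Lemma strict_adj s t : adj s t -> des w s -> des w t ->
  (forall x, x <= w -> M x = x ** s) -> (forall x, x <= w -> K x = x ** t) ->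
  strictly_coherent w M K.
Proof.
move=> st ds dt hM hK.
have sN := des_ok ds; have tN := des_ok dt.
have ts : adj t s by rewrite adjC.
have orbS u x : u <= w -> spm_orbit M K u x -> spm_orbit M K u (x ** s).
  by move=> uw ux; rewrite -hM ?(orbit_le uw ux) //; apply: orbitM.
have orbT u x : u <= w -> spm_orbit M K u x -> spm_orbit M K u (x ** t).
  by move=> uw ux; rewrite -hK ?(orbit_le uw ux) //; apply: orbitK.
have six u x : u <= w -> spm_orbit M K u x -> x <= w /\
    ([\/ x = u, x = u ** s | x = u ** t] \/
     [\/ x = u ** s ** t, x = u ** t ** s | x = u ** s ** t ** s]).
  move=> uw; apply: (orbit_ind (Q := fun x => [\/ x = u, x = u ** s | x = u ** t] \/
     [\/ x = u ** s ** t, x = u ** t ** s | x = u ** s ** t ** s]) uw).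
    by left; constructor 1.
  move=> y yw; rewrite hM // hK //; have b := braid u st sN tN.
  case=> [[->|->|->]|[->|->|->]]; rewrite ?starK; split.
  + by left; constructor 2. + by left; constructor 3. + by left; constructor 1.
  + by right; constructor 1. + by right; constructor 2. + by left; constructor 1.
  + by right; constructor 3. + by left; constructor 2. + by left; constructor 3.
  + by right; constructor 3; rewrite b. + by right; constructor 1.
  + by right; constructor 2; rewrite b starK.
have bound u : u <= w -> forall x y, spm_orbit M K u x -> spm_orbit M K x y -> (rk y <= rk x + 3)%N.
  move=> uw x y /(six u x uw)[xw _] /(six x y xw)[_]; apply: hexagon_rk.
have [t1 t2] := orbit_bound ww (bound w ww).
have rkw : rank (spm_orbit M K w) = 3%N.
  have d1 := des_hexagon st ds dt.
  have d2 : des (w ** s) t.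
    by apply: (down2 ts tN sN ds); have := des_rk dt; lia.
  have o0 := orbit_refl w.
  have c3 := chain4 (orbS _ _ ww (orbT _ _ ww (orbS _ _ ww o0)))
    (orbT _ _ ww (orbS _ _ ww o0)) (orbS _ _ ww o0) o0
    (star_lt d1) (star_lt d2) (star_lt ds).
  by apply/eqP; rewrite eqn_leq t1 (t2 _ c3).
move=> u uw; rewrite rkw; have [u1 u2] := orbit_bound uw (bound u uw); split.
  case=> _ moved.
  have [g ug gmin] : exists2 g, spm_orbit M K u g & forall x, spm_orbit M K u x -> (rk g <= rk x)%N.
    have ex : exists j, `[< exists2 g, spm_orbit M K u g & rk g = j >].
      by exists (rk u); apply/asboolP; exists u => //; apply: orbit_refl.
    have [m /asboolP[g ug gm] mmin] := ex_minnP ex.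
    by exists g => // x ux; rewrite gm; apply: mmin; apply/asboolP; exists x.
  have gw := orbit_le uw ug; have [m1 m2] := moved g ug.
  rewrite hM // in m1; rewrite hK // in m2.
  have us : rk (g ** s) = (rk g).+1.
    by case: (star_rk g s) => // e; [rewrite e in m1|have := gmin _ (orbS _ _ uw ug); lia].
  have ut : rk (g ** t) = (rk g).+1.
    by case: (star_rk g t) => // e; [rewrite e in m2|have := gmin _ (orbT _ _ uw ug); lia].
  have [h1 h2 h3] := hexagon st sN tN us ut.
  have l1 : g < g ** s by apply: star_gt; rewrite us.
  have l2 : g ** s < g ** s ** t by apply: star_gt; rewrite h1 us.
  have l3 : g ** s ** t < g ** s ** t ** s by apply: star_gt; rewrite h1 h3.
  have o1 := orbS _ _ uw ug; have o2 := orbT _ _ uw o1; have o3 := orbS _ _ uw o2.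
  have := u2 3%N (chain4 ug o1 o2 o3 l1 l2 l3) => u3.
  by have -> : rank (spm_orbit M K u) = 3%N by apply/eqP; rewrite eqn_leq u1 u3.
move=> /chainlike_fixed[x ux fx]; have xw := orbit_le uw ux.
have [s' [t' [st' [sN' tN'] fs orb3 [oS oT]]]] : exists s' t', [/\ adj s' t',
    (s'.+1 < N)%N /\ (t'.+1 < N)%N, x ** s' = x,
    forall y, spm_orbit M K x y -> [\/ y = x, y = x ** t' | y = x ** t' ** s']
    & spm_orbit M K u (x ** t') /\ spm_orbit M K u (x ** t' ** s')].
  case: fx; rewrite ?hM ?hK // => fx; [exists s, t|exists t, s]; split=> //.
  - move=> y /(six x y xw)[_]; rewrite fx.
    case=> [[->|->|->]|[->|->|->]]; by [constructor 1|constructor 2|constructor 3].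
  - by split; [exact: orbT|apply/orbS/orbT].
  - move=> y /(six x y xw)[_]; rewrite (braid x st sN tN) fx.
    case=> [[->|->|->]|[->|->|->]]; by [constructor 1|constructor 2|constructor 3].
  - by split; [exact: orbS|apply/orbT/orbS].
have nt : x ** t' <> x by rewrite -{2}fs => e; apply: (@star_adj _ x _ _ st' sN' tN').
have mono : x < x ** t' /\ x ** t' < x ** t' ** s' \/ x ** t' < x /\ x ** t' ** s' < x ** t'.
  case: (star_rk x t') => // e; [left|right].
    have up := up2 st' sN' tN' _ e; rewrite /des fs ltnn in up.
    by split; apply: star_gt; [rewrite e|rewrite up].
  have d1 : des x t' by rewrite /des [X in (_ < X)%N]e.
  have d2 : des (x ** t') s' by apply: (down2 st' sN' tN' d1); rewrite fs.
  by split; apply: star_lt.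
have c2 : chain_of_length (spm_orbit M K u) 2.
  by case: mono => -[a b]; [exact: chain3 ux oS oT a b|exact: chain3 oT oS ux b a].
have [|u3 _] := @orbit_bound u 2 uw.
  move=> y v uy yv; have xy : spm_orbit M K x y.
    by apply: orbit_trans uy; apply: orbit_sym.
  have xv := orbit_trans xy yv.
  exact: (chain_rk (orb3 y xy) (orb3 v xv)).
have := u2 2%N c2 => u4.
by have -> : rank (spm_orbit M K u) = 2%N by apply/eqP; rewrite eqn_leq u3 u4.
Qed.

End Orbits.

Lemma near_strict w M K : special_partial_matching w M -> special_partial_matching w K ->
  near w M K -> strictly_coherent w M K.
Proof.
move=> sM sK [e|[ne c]|[s [t [st [ds dt] hM hK]]]]; first exact: strict_eqon.
  exact: strict_commute.
exact: (strict_adj sM sK st).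
Qed.

Lemma near_path_coherent w M K : near_path w M K -> coherent w M K.
Proof.
elim=> [{}M sM|{}M K' {}K sM nM _ [k [F [F0 Fk Fs Fc]]]].
  by exists 0%N, (fun=> M); split.
exists k.+1, (fun i => if i is i'.+1 then F i' else M); split=> // [[//|i]|[|i]]; rewrite ?ltnS.
- exact: Fs.
- by move=> _; rewrite F0; apply: near_strict => //; rewrite -F0; apply: Fs.
- exact: Fc.
Qed.

Theorem twisted_dircon : dircon (twisted n).
Proof.
split; first exact: twisted_pircon.
by move=> w M K sM sK; apply/near_path_coherent/near_connected.
Qed.

End Near.

(** * The recursion attached to a matching *)

Section Polynomials.
Variable n : nat.
Local Notation N := (n.*2).
Local Notation one := (twisted_one n).
Implicit Types (u v w x y z g : twisted n) (j k s t : nat)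
  (M K : twisted n -> twisted n).
Local Open Scope order_scope.

(** Induction on y, going down to a coatom above x. *)
Lemma spm_le_image w M x y : special_partial_matching w M -> x <= y -> y <= w ->
  M x <= y \/ M x <= M y.
Proof.
move=> sM; have IM := spm_pmatch sM; have [m] := ubnP (rk y).
elim: m y => // m IH y ltm; rewrite le_eqVlt => /predU1P[->|xy] yw; first by right.
have [z xz zy] := coatom_ex xy; have zw : z <= w by apply: le_trans yw; apply/ltW/cov_lt.
have [|Mxz|Mxz] := IH z _ xz zw; first by have := cov_rk zy; lia.
- by left; apply: le_trans Mxz (ltW (cov_lt zy)).
- have [e|/eqP ne] := eqVneq (M z) y; first by left; rewrite -e.
  by right; apply: le_trans Mxz (ltW (pm_lift IM yw zy ne)).
Qed.

Lemma spm_restrict w M v : special_partial_matching w M -> v <= w -> cov (M v) v ->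
  special_partial_matching v M.
Proof.
move=> sM vw cv; have [h1 h2 h3 h4 h5] := sM.
have le x : x <= v -> x <= w by move=> xv; apply: le_trans xv vw.
split=> [x xv|x /le/h2//| |x /le/h4//|x y /le xv /le yv]; last exact: h5.
- have [//|Mxv] := spm_le_image sM xv vw.
  exact: le_trans Mxv (ltW (cov_lt cv)).
- exact/coversP.
Qed.

(** A commuting pair of matchings keeps the type of a step, unless both make
    the same step. *)
Lemma commute_up w M K u : special_partial_matching w M -> special_partial_matching w K ->
  (forall x, x <= w -> M (K x) = K (M x)) -> u <= w -> K u <> M u ->
  rk (M u) = (rk u).+1 -> rk (M (K u)) = (rk (K u)).+1.
Proof.
move=> sM sK cMK uw ne up; have IM := spm_pmatch sM; have IK := spm_pmatch sK.
have := pm_lift IK (pm_in IM uw) (pm_up IM uw up) ne.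
rewrite -cMK // => /lt_rk lt; case: (pm_rk IM (pm_in IK uw)) => //; last by lia.
by move=> e; rewrite e ltnn in lt.
Qed.

Lemma right_descentP w (k : 'I_N.-1) : right_descent w k <-> des w k.
Proof.
have kN : (k.+1 < N)%N by have := ltn_ord k; lia.
rewrite /right_descent !lengthE; have := arc_lt w (ltnW kN); have := arc_lt w kN => l1 l2.
split=> [lt|/des_asc[_ lt]]; last by rewrite -inv_down // !pos_val //; lia.
have asc : (arc w k < arc w k.+1)%N.
  rewrite ltnNge leq_eqVlt; apply/negP => /predU1P[e|ge].
    by have := arc_inj kN (ltnW kN) e; lia.
  by move: lt; rewrite inv_up ?pos_val ?(ltnW kN) //; lia.
by rewrite /des [X in (_ < X)%N](rk_asc kN asc).
Qed.

Section Operator.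
Variable c : {poly int}.
Implicit Types f : twisted n -> {poly int}.
Local Open Scope ring_scope.

Definition coef M u : {poly int} * {poly int} :=
  if (rk (M u) < rk u)%N then (0, 1) else if M u == u then (c, 0) else ('X - 1, 'X).

(** The right-hand side of the recursion defined by the matching M. *)
Definition recop M f u : {poly int} := (coef M u).1 * f u + (coef M u).2 * f (M u).

Lemma coef_down M u : (rk (M u) < rk u)%N -> coef M u = (0, 1).
Proof. by rewrite /coef => ->. Qed.

Lemma coef_fix M u : M u = u -> coef M u = (c, 0).
Proof. by rewrite /coef => ->; rewrite ltnn eqxx. Qed.

Lemma coef_up M u : (rk u < rk (M u))%N -> coef M u = ('X - 1, 'X).
Proof.
move=> lt; rewrite /coef ltnNge (ltnW lt) /=; case: eqP => // e.
by rewrite e ltnn in lt.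
Qed.

Lemma recop_ext M K f h u : M u = K u -> f u = h u -> f (M u) = h (M u) ->
  recop M f u = recop K h u.
Proof. by rewrite /recop /coef => <- <- <-. Qed.

Lemma recopE w M u P f : special_partial_matching w M -> (u <= w)%O ->
  P = recop M f u <->
  [/\ covers (M u) u -> P = f (M u),
      covers u (M u) -> P = ('X - 1) * f u + 'X * f (M u)
    & M u = u -> P = c * f u].
Proof.
move=> sM uw; rewrite /recop; split=> [->|[h1 h2 h3]].
  split=> [/coversP/cov_lt/lt_rk d|/coversP/cov_lt/lt_rk d|e].
  - by rewrite coef_down // mul0r add0r mul1r.
  - by rewrite coef_up.
  - by rewrite coef_fix // mul0r addr0.
case: (pm_tri (spm_pmatch sM) uw) => [d|e|d].
- by rewrite (h2 (iffRL (coversP _ _) d)) coef_up // (cov_rk d).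
- by rewrite (h3 e) coef_fix //= mul0r addr0.
- by rewrite (h1 (iffRL (coversP _ _) d)) coef_down ?(cov_rk d) //= mul0r add0r mul1r.
Qed.

Lemma coef_commute w M K u : special_partial_matching w M -> special_partial_matching w K ->
  (forall x, (x <= w)%O -> M (K x) = K (M x)) -> (u <= w)%O -> K u <> M u ->
  coef M (K u) = coef M u.
Proof.
move=> sM sK cMK uw ne; have IM := spm_pmatch sM; have IK := spm_pmatch sK.
have Muw := pm_in IM uw.
case: (pm_rk IM uw) => e.
- have e' := commute_up sM sK cMK uw ne e.
  by rewrite !coef_up ?e ?e'.
- by rewrite !coef_fix // cMK // e.
- have ne' : K (M u) <> M (M u).
    by rewrite (pmK IM) // => e'; have := pmK IK Muw; rewrite e'.
  have cu := cMK u uw; have MM := pmK IM uw; have MMK := pmK IM (pm_in IK uw).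
  have := commute_up sM sK cMK Muw ne'; rewrite MM -cu MMK e.
  by move=> /(_ erefl) e'; rewrite !coef_down ?e ?e'.
Qed.

Lemma recop_commute w M K f u : special_partial_matching w M -> special_partial_matching w K ->
  (forall x, (x <= w)%O -> M (K x) = K (M x)) -> (u <= w)%O ->
  recop M (recop K f) u = recop K (recop M f) u.
Proof.
move=> sM sK cMK uw; have IM := spm_pmatch sM; have IK := spm_pmatch sK.
have [e|/eqP ne] := eqVneq (K u) (M u).
  have e' : recop M f u = recop K f u by apply: recop_ext.
  have e2 : recop M f (M u) = recop K f (M u).
    by apply: recop_ext; rewrite // (pmK IM) // -e (pmK IK).
  transitivity (recop M (recop M f) u); first exact: recop_ext.
  by apply: recop_ext; rewrite // e.
have c1 := coef_commute sM sK cMK uw ne.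
have c2 : coef K (M u) = coef K u.
  exact: (coef_commute sK sM (fun x xw => esym (cMK x xw)) uw (not_eq_sym ne)).
rewrite /recop c1 c2 (cMK u uw); ring.
Qed.

Notation "f |> k" := (recop (fun x => x ** k) f) (at level 40, left associativity).

Section Braid.
Variables s t : nat.
Hypotheses (st : adj s t) (sN : (s.+1 < N)%N) (tN : (t.+1 < N)%N).

Lemma recop_braid_hexagon f g y : rk (g ** s) = (rk g).+1 -> rk (g ** t) = (rk g).+1 ->
  [\/ y = g, y = g ** s | y = g ** s ** t] \/ y = g ** s ** t ** s ->
  (f |> s |> t |> s) y = (f |> t |> s |> t) y.
Proof.
move=> us ut; have [h1 h2 h3] := hexagon st sN tN us ut; have b := braid g st sN tN.
have [a aE] : {a | a = g ** s} by exists (g ** s).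
have [d dE] : {d | d = g ** t} by exists (g ** t).
have [a2 a2E] : {a2 | a2 = a ** t} by exists (a ** t).
have [d2 d2E] : {d2 | d2 = d ** s} by exists (d ** s).
have [z zE] : {z | z = a2 ** s} by exists (a2 ** s).
have zE' : z = d2 ** t by rewrite zE a2E aE b d2E dE.
rewrite -aE -?dE -?a2E -?d2E -?zE in us ut h1 h2 h3 *.
have as_ : a ** s = g by rewrite aE starK.
have dt : d ** t = g by rewrite dE starK.
have a2t : a2 ** t = a by rewrite a2E starK.
have d2s : d2 ** s = d by rewrite d2E starK.
have zs : z ** s = a2 by rewrite zE starK.
have zt : z ** t = d2 by rewrite zE' starK.
have up := @coef_up.
have cgs : coef (fun x => x ** s) g = ('X - 1, 'X) by rewrite coef_up -?aE ?us.
have cgt : coef (fun x => x ** t) g = ('X - 1, 'X) by rewrite coef_up -?dE ?ut.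
have cat : coef (fun x => x ** t) a = ('X - 1, 'X) by rewrite coef_up -?a2E ?h1 ?us.
have cds : coef (fun x => x ** s) d = ('X - 1, 'X) by rewrite coef_up -?d2E ?h2 ?ut.
have ca2s : coef (fun x => x ** s) a2 = ('X - 1, 'X) by rewrite coef_up -?zE ?h3 ?h1.
have cd2t : coef (fun x => x ** t) d2 = ('X - 1, 'X) by rewrite coef_up -?zE' ?h3 ?h2.
have cas : coef (fun x => x ** s) a = (0, 1) by rewrite coef_down ?as_ ?us.
have cdt : coef (fun x => x ** t) d = (0, 1) by rewrite coef_down ?dt ?ut.
have ca2t : coef (fun x => x ** t) a2 = (0, 1) by rewrite coef_down ?a2t ?h1 ?us.
have cd2s : coef (fun x => x ** s) d2 = (0, 1) by rewrite coef_down ?d2s ?h2 ?ut.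
have czs : coef (fun x => x ** s) z = (0, 1) by rewrite coef_down ?zs ?h3 ?h1.
have czt : coef (fun x => x ** t) z = (0, 1) by rewrite coef_down ?zt ?h3 ?h2.
have E := (cgs, cgt, cat, cds, ca2s, cd2t, cas, cdt, ca2t, cd2s, czs, czt).
have S := (esym aE, esym dE, esym a2E, esym d2E, esym zE, esym zE', as_, dt, a2t, d2s, zs, zt).
case=> [[->|->|->]|->]; rewrite /recop; do ! rewrite ?S ?E /=; ring.
Qed.

(** On a chain of three elements with both ends fixed, the braid relation
    amounts to the quadratic relation for c. *)
Lemma recop_braid_chain f g y : c * c = ('X - 1) * c + 'X -> g ** s = g -> rk (g ** t) = (rk g).+1 ->
  [\/ y = g, y = g ** t | y = g ** t ** s] ->
  (f |> s |> t |> s) y = (f |> t |> s |> t) y.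
Proof.
move=> hc fs ut; have b := braid g st sN tN.
have gsN : ~~ des g s by rewrite /des fs ltnn.
have h := up2 st sN tN gsN ut.
have [a aE] : {a | a = g ** t} by exists (g ** t).
have [z zE] : {z | z = a ** s} by exists (a ** s).
have zt : z ** t = z by rewrite zE aE -b fs.
rewrite -?zE -?aE -?zE in ut h *.
have at_ : a ** t = g by rewrite aE starK.
have zs : z ** s = a by rewrite zE starK.
have cgs : coef (fun x => x ** s) g = (c, 0) by rewrite coef_fix.
have cgt : coef (fun x => x ** t) g = ('X - 1, 'X) by rewrite coef_up -?aE ?ut.
have cas : coef (fun x => x ** s) a = ('X - 1, 'X) by rewrite coef_up -?zE ?h.
have cat : coef (fun x => x ** t) a = (0, 1) by rewrite coef_down ?at_ ?ut.
have czs : coef (fun x => x ** s) z = (0, 1) by rewrite coef_down ?zs ?h.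
have czt : coef (fun x => x ** t) z = (c, 0) by rewrite coef_fix.
have E := (cgs, cgt, cas, cat, czs, czt).
have S := (fs, zt, esym aE, esym zE, at_, zs).
case=> ->; rewrite /recop; do ! rewrite ?S ?E /=; ring: hc.
Qed.

End Braid.

(** Going down along s and t ends at a point without these descents, and the
    braid relation leaves six words for the way back. *)
Lemma lowest_point s t u : adj s t -> (s.+1 < N)%N -> (t.+1 < N)%N ->
  exists g, [/\ ~~ des g s, ~~ des g t &
    [\/ u = g, u = g ** s | u = g ** t] \/
    [\/ u = g ** s ** t, u = g ** t ** s | u = g ** s ** t ** s]].
Proof.
move=> st sN tN; have [m] := ubnP (rk u); elim: m u => // m IH u ltm.
have [du|ds] := boolP (des u s).
  have [|g [gs gt h]] := IH (u ** s); first by have := des_rk du; lia.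
  exists g; split=> //; have b := braid g st sN tN; rewrite -[u](starK u s).
  case: h => -[]->; rewrite ?starK.
  - by left; constructor 2. - by left; constructor 1. - by right; constructor 2.
  - by right; constructor 3. - by left; constructor 3. - by right; constructor 1.
have [du|dt] := boolP (des u t); last by exists u; split=> //; left; constructor 1.
have [|g [gs gt h]] := IH (u ** t); first by have := des_rk du; lia.
exists g; split=> //; have b := braid g st sN tN; rewrite -[u](starK u t).
case: h => -[]->; rewrite ?starK.
- by left; constructor 3. - by right; constructor 1. - by left; constructor 1.
- by left; constructor 2. - by right; constructor 3. - by right; constructor 2; rewrite b starK.
Qed.

Lemma recop_braid s t f u : c * c = ('X - 1) * c + 'X -> adj s t ->
  (s.+1 < N)%N -> (t.+1 < N)%N ->
  (f |> s |> t |> s) u = (f |> t |> s |> t) u.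
Proof.
move=> hc st sN tN; have ts : adj t s by rewrite adjC.
have [g [gs gt h]] := lowest_point u st sN tN; have b := braid g st sN tN.
have nd x k : ~~ des x k -> rk (x ** k) = (rk x).+1 \/ x ** k = x.
  by rewrite /des; case: (star_rk x k) => e; auto; rewrite [X in (_ < X)%N]e ltnSn.
case: (nd _ _ gs) (nd _ _ gt) => [us|fs] [ut|ft].
- have H := recop_braid_hexagon st sN tN f us ut.
  have H' := recop_braid_hexagon ts tN sN f ut us.
  case: h => -[]e.
  + by apply: H; left; constructor 1. + by apply: H; left; constructor 2.
  + by symmetry; apply: H'; left; constructor 2.
  + by apply: H; left; constructor 3. + by symmetry; apply: H'; left; constructor 3.
  + by apply: H; right.
- symmetry; apply: (recop_braid_chain ts tN sN f hc ft us).
  by case: h => -[]->; rewrite ?b ?ft; by [constructor 1|constructor 2|constructor 3].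
- apply: (recop_braid_chain st sN tN f hc fs ut).
  by case: h => -[]->; rewrite ?fs; by [constructor 1|constructor 2|constructor 3].
- by case: (star_adj (x := g) st sN tN); rewrite fs ft.
Qed.

(** * The family of polynomials *)

Definition pick_des w : nat := xget 0%N [set k | des w k]%classic.

Lemma pick_desP w : w <> one -> des w (pick_des w).
Proof. by move=> /des_ex[k dk]; exact: (@xgetPex _ 0%N [set k | des w k]%classic (ex_intro _ k dk)). Qed.

(** Recursion along the chosen descents; m stands for the rank of w. *)
Fixpoint rpoly_rec (m : nat) u w : {poly int} :=
  if (u <= w)%O then
    if m is m'.+1 then
      ((fun v => rpoly_rec m' v (w ** pick_des w)) |> pick_des w) u
    else 1
  else 0.

Definition rpoly u w := rpoly_rec (rk w) u w.

Lemma rpoly_nle u w : ~ (u <= w)%O -> rpoly u w = 0.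
Proof. by move=> /negP/negPf h; rewrite /rpoly; case: (rk w) => /=; rewrite h. Qed.

(* Both -1 and 'X are roots of this quadratic equation. *)
Hypothesis hc : c * c = ('X - 1) * c + 'X.

Definition satisfies w M := forall u, (u <= w)%O -> rpoly u w = recop M (rpoly^~ (M w)) u.

(** The recursion also holds for v outside the lower set of y: all the terms
    vanish, as K preserves this lower set. *)
Lemma satisfies_all y K v : special_partial_matching y K -> K (K v) = v ->
  satisfies y K -> rpoly v y = recop K (rpoly^~ (K y)) v.
Proof.
move=> sK KK h; have [/h//|vy] := boolP (v <= y)%O.
have Ky : (K y <= y)%O by case: sK => _ _ [lt _] _ _; apply: ltW.
have vKy : ~ (v <= K y)%O by move=> vKy; case/negP: vy; apply: le_trans Ky.
have KvKy : ~ (K v <= K y)%O.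
  move=> KvKy; case/negP: vy; rewrite -KK; apply: (pm_in (spm_pmatch sK)).
  exact: le_trans KvKy Ky.
by rewrite /recop (rpoly_nle (elimN idP vy)) (rpoly_nle vKy) (rpoly_nle KvKy) !mulr0 addr0.
Qed.

Lemma satisfies_pick w : w <> one -> satisfies w (fun x => x ** pick_des w).
Proof.
move=> w1 u uw; have dw := pick_desP w1.
by rewrite /rpoly (des_rk dw) /= uw.
Qed.

(** For equal matchings the recursions are the same. In the two other cases, the
    recursion for M followed by known recursions below w gives R(., w) as a
    product of operators applied to R(., v) with v the bottom of the orbit of w,
    and the commutation or braid relation turns it into the product that starts
    with K. *)
Lemma satisfies_near w M K : special_partial_matching w M -> special_partial_matching w K ->
  near w M K ->
  (forall v L, (rk v < rk w)%N -> special_partial_matching v L -> satisfies v L) ->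
  satisfies w M -> satisfies w K.
Proof.
move=> sM sK nMK IH hM u uw; have IM := spm_pmatch sM; have IK := spm_pmatch sK.
have ww : (w <= w)%O by []. have rM := spm_rk sM; have rK := spm_rk sK.
have cM : cov (M w) w by case: sM => _ _ /coversP.
have cK : cov (K w) w by case: sK => _ _ /coversP.
rewrite hM //; case: nMK => [e|[ne cMK]|[s [t [st [ds dt] eM eK]]]].
- by rewrite e //; apply: recop_ext; rewrite ?e.
- have Mww := pm_in IM ww; have Kww := pm_in IK ww; have cw := cMK w ww.
  have neK : K (M w) <> w by move=> e; apply: ne; rewrite -[LHS](pmK IK Mww) e.
  have neM : M (K w) <> w by move=> e; apply: ne; rewrite -[RHS](pmK IM Kww) e.
  have ltK := lt_rk (pm_lift IK ww cM neK); have ltM := lt_rk (pm_lift IM ww cK neM).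
  have cKM : cov (K (M w)) (M w).
    by apply: (pm_down IK Mww); case: (pm_rk IK Mww) => // e; move: ltK; rewrite e; lia.
  have cMK' : cov (M (K w)) (K w).
    by apply: (pm_down IM Kww); case: (pm_rk IM Kww) => // e; move: ltM; rewrite e; lia.
  have hKM : satisfies (M w) K by apply: IH; [rewrite rM|apply: spm_restrict sK Mww cKM].
  have hMK : satisfies (K w) M by apply: IH; [rewrite rK|apply: spm_restrict sM Kww cMK'].
  have sKM := spm_restrict sK Mww cKM; have sMK := spm_restrict sM Kww cMK'.
  have eM v : (v <= w)%O -> rpoly v (M w) = recop K (rpoly^~ (K (M w))) v.
    by move=> vw; apply: satisfies_all sKM _ hKM; rewrite (pmK IK).
  have eK v : (v <= w)%O -> rpoly v (K w) = recop M (rpoly^~ (K (M w))) v.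
    by move=> vw; rewrite -cw; apply: satisfies_all sMK _ hMK; rewrite (pmK IM).
  transitivity (recop M (recop K (rpoly^~ (K (M w)))) u).
    by apply: recop_ext => //; apply: eM => //; apply: (pm_in IM).
  rewrite (recop_commute _ sM sK cMK uw).
  by apply: recop_ext => //; rewrite eK //; apply: (pm_in IK).
- have sN := des_ok ds; have tN := des_ok dt; have ts : adj t s by rewrite adjC.
  have rs := des_rk ds; have rt := des_rk dt.
  have d1 : des (w ** s) t by apply: (down2 ts tN sN ds); lia.
  have d2 : des (w ** t) s by apply: (down2 st sN tN dt); lia.
  have r1 := des_rk d1; have r2 := des_rk d2.
  have d3 : des (w ** s ** t) s by apply: des_hexagon.
  have d4 : des (w ** t ** s) t by apply: des_hexagon.
  have l1 : (rk (w ** s) < rk w)%N by rewrite [X in (_ < X)%N]rs.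
  have l2 : (rk (w ** t) < rk w)%N by rewrite [X in (_ < X)%N]rt.
  have l3 : (rk (w ** s ** t) < rk w)%N by apply: ltn_trans l1; rewrite [X in (_ < X)%N]r1.
  have l4 : (rk (w ** t ** s) < rk w)%N by apply: ltn_trans l2; rewrite [X in (_ < X)%N]r2.
  have b := braid w st sN tN.
  have E v k : (rk v < rk w)%N -> des v k -> rpoly^~ v = rpoly^~ (v ** k) |> k.
    move=> vw dv; apply/funext => x; apply: satisfies_all (spm_star dv) _ _; rewrite ?starK //.
    by apply: IH => //; apply: spm_star.
  transitivity ((rpoly^~ (w ** s ** t ** s) |> s |> t |> s) u).
    have F : rpoly^~ (w ** s) = rpoly^~ (w ** s ** t ** s) |> s |> t.
      by rewrite (E (w ** s) t) ?(E (w ** s ** t) s).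
    by apply: recop_ext; rewrite !eM //; apply: (congr1 (fun f => f _) F).
  rewrite recop_braid //; symmetry.
  have F : rpoly^~ (w ** t) = rpoly^~ (w ** s ** t ** s) |> t |> s.
    by rewrite b (E (w ** t) s) ?(E (w ** t ** s) t).
  by apply: recop_ext; rewrite !eK //; apply: (congr1 (fun f => f _) F).
Qed.

Lemma satisfies_spm w M : special_partial_matching w M -> satisfies w M.
Proof.
have [m] := ubnP (rk w); elim: m w M => // m IH w M ltm sM.
have w1 : w <> one by move=> e; have := spm_rk sM; rewrite e rk_one.
have := near_connected (spm_star (pick_desP w1)) sM.
move: (satisfies_pick w1); set L := (fun x => _) => hL nL.
elim: nL hL => // {sM}{}M K {}L sM nMK nKL IHp hM; apply: IHp.
have sK : special_partial_matching w K by case: nKL.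
apply: satisfies_near sM sK nMK _ hM => v L' lt; apply: IH.
by apply: leq_trans lt _.
Qed.

Lemma rpoly_one : rpoly one one = 1.
Proof. by rewrite /rpoly rk_one /= lexx. Qed.

Lemma recop_diag w M (f : poly_family (twisted n)) : special_partial_matching w M ->
  recop M (f^~ (M w)) w = f (M w) (M w).
Proof. by move=> /spm_rk e; rewrite /recop coef_down ?e //= mul0r add0r mul1r. Qed.

Lemma rpoly_diag w : rpoly w w = 1.
Proof.
have [m] := ubnP (rk w); elim: m w => // m IH w ltm.
have [->|/eqP/pick_desP d] := eqVneq w one; first exact: rpoly_one.
have sM := spm_star d; rewrite (satisfies_spm sM) // (recop_diag rpoly sM).
by apply: IH; have := des_rk d; lia.
Qed.

Lemma rpoly_unique (R' : poly_family (twisted n)) : R' one one = 1 ->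
  (forall u w, ~ (u <= w)%O -> R' u w = 0) ->
  (forall w, w <> one -> exists2 M, special_partial_matching w M &
    forall u, (u <= w)%O -> R' u w = recop M (R'^~ (M w)) u) ->
  R' =2 rpoly.
Proof.
move=> R1 R0 Rr u w; have [m] := ubnP (rk w); elim: m u w => // m IH u w ltm.
have [uw|/negP uw] := boolP (u <= w)%O; last by rewrite R0 // rpoly_nle.
have [w1|/eqP/Rr[M sM h]] := eqVneq w one.
  have u1 : u = one.
    by apply: le_eq_rk; rewrite ?w1 ?rk_one // -w1.
  by rewrite w1 u1 R1 rpoly_one.
have lt : (rk (M w) < m)%N by have := spm_rk sM; lia.
by rewrite h // (satisfies_spm sM) //; apply: recop_ext => //; apply: IH.
Qed.

Lemma rpoly_KLV : unique_family (KLV_family c) rpoly.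
Proof.
split.
  split; [exact: rpoly_one|exact: rpoly_nle|move=> u w k /right_descentP d uw /=].
  rewrite -!star_ord; apply/(recopE _ (rpoly^~ (w ** k)) (spm_star d) uw).
  exact: (satisfies_spm (spm_star d)).
move=> R' [R1 R0 Rr]; apply: rpoly_unique => // w /des_ex[k d].
exists (fun x => x ** k); first exact: spm_star.
move=> u uw; have kN : (k < N.-1)%N by have := des_ok d; lia.
apply/(recopE _ _ (spm_star d) uw).
have := Rr u w (Ordinal kN) (iffRL (right_descentP w (Ordinal kN)) d) uw.
by rewrite /= -!star_ord.
Qed.

Lemma rpoly_dircon (a : {poly int}) : c = 'X - 1 - a -> dircon_Rx_polynomials a rpoly.
Proof.
move=> cE M refM.
have spm w : w <> one -> special_partial_matching w (M w).
  by move=> w1; apply: refM => /(_ one) w_le; apply: w1; apply/le_anti; rewrite w_le one_le.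
split.
  split; [exact: rpoly_diag|exact: rpoly_nle|move=> u w uw].
  have sM : special_partial_matching w (M w).
    by apply: spm => w1; move: uw; rewrite w1 => /lt_rk; rewrite rk_one.
  rewrite -cE; apply/(recopE _ (rpoly^~ (M w w)) sM (ltW uw)).
  exact: (satisfies_spm sM (ltW uw)).
move=> R' [R1 R0 Rr]; apply: rpoly_unique => // w /spm sM; exists (M w) => // u.
rewrite le_eqVlt => /predU1P[->|uw]; first by rewrite recop_diag // !R1.
by apply/(recopE _ _ sM (ltW uw)); rewrite cE; apply: Rr.
Qed.

End Operator.

End Polynomials.

Local Open Scope ring_scope.

Theorem theorem6p2 (n : nat) (hn : (1 <= n)%N) :
  dircon (twisted n) /\
  (exists R : poly_family (twisted n),
     KLV_R_polynomials R /\ dircon_Rx_polynomials 'X R) /\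
  (exists Q : poly_family (twisted n),
     KLV_Q_polynomials Q /\ dircon_Rx_polynomials (- 1) Q).
Proof.
split; first exact: twisted_dircon.
have hR : (- 1 : {poly int}) * - 1 = ('X - 1) * - 1 + 'X by ring.
have hQ : ('X : {poly int}) * 'X = ('X - 1) * 'X + 'X by ring.
split; [exists (rpoly (- 1))|exists (rpoly 'X)]; split.
- exact: rpoly_KLV. - by apply: rpoly_dircon => //; ring.
- exact: rpoly_KLV. - by apply: rpoly_dircon => //; ring.
Qed.
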